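(* Let $(R,\mathfrak m,k)$ be a Noetherian local ring of characteristic $p>0$ which is $F$-finite, strongly $F$-regular, and $\mathbb{Q}$-Gorenstein on the punctured spectrum. Then $R$ satisfies Condition (A). In particular, the $F$-signature of $R$ exists.
   Context: Throughout, $q=p^e$ with $e\ge 0$, and for an ideal $I$, $I^{[q]}$ denotes the ideal generated by the $q$-th powers of the elements of $I$. A ring of characteristic $p$ is $F$-finite if it is a finite module over itself via the Frobenius map. An $F$-finite reduced ring $R$ is strongly $F$-regular if for every $c\in R$ not in any minimal prime there is $q=p^e$ such that the $R$-linear map $R\to R^{1/q}$, $1\mapsto c^{1/q}$, splits. Such a local ring is a normal Cohen-Macaulay domain. $R$ is $\mathbb{Q}$-Gorenstein on the punctured spectrum if, for every prime $P\neq\mathfrak m$, the ring $R_P$ is $\mathbb{Q}$-Gorenstein, i.e. for a canonical ideal $J$ of $R$ (an ideal isomorphic to a canonical module, which exists for $F$-finite normal local rings), of pure height one, some symbolic power $J^{(h)}$ with $h\ge 1$ satisfies that $J^{(h)}R_P$ is principal. Here $J^{(n)}$ is the height one component of $J^n$. $F$-signature: let $d=\dim R$ and $\alpha(R)=\log_p[k:k^p]$. For each $q=p^e$ write $R^{1/q}\cong R^{a_q}\oplus M_q$ as $R$-modules, where $M_q$ has no nonzero free direct summand. The $F$-signature of $R$ is $s(R)=\lim_{q\to\infty} a_q/q^{d+\alpha(R)}$, if this limit exists. Condition (A): there exist a decreasing sequence $\{I_t\}_{t\ge 1}$ of irreducible $\mathfrak m$-primary ideals of $R$, cofinal with the powers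 of $\mathfrak m$, and an index $t_0$ such that, with $u_t\in R$ an element representing a generator of the socle of $R/I_t$ for each $t$, one has $(I_t^{[q]}:u_t^q)=(I_{t_0}^{[q]}:u_{t_0}^q)$ for all $t\ge t_0$ and all $q=p^e$. *)

(* Defs.v *)
From HB Require Import structures.
From mathcomp Require Import all_boot all_order all_algebra.
From mathcomp Require Import all_classical all_reals all_analysis.

Set Implicit Arguments.
Unset Strict Implicit.
Unset Printing Implicit Defensive.

Import Order.TTheory GRing.Theory Num.Theory.
Import numFieldNormedType.Exports.

Local Open Scope classical_set_scope.
Local Open Scope ring_scope.

(** * Ideals, given as classical subsets of the ring *)

Section Ideals.
Variable R : comNzRingType.
Implicit Types (I J K P Q m A : set R).

Definition is_ideal I : Prop :=
  [/\ I 0, (forall x y, I x -> I y -> I (x + y))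
    & (forall r x, I x -> I (r * x))].

Definition ideal_gen A : set R := smallest is_ideal A.

Definition ideal_mul I J : set R :=
  ideal_gen [set z | exists x y, [/\ I x, J y & z = x * y]].

Fixpoint ideal_pow I (n : nat) : set R :=
  if n is n'.+1 then ideal_mul I (ideal_pow I n') else setT.

(* I^[q] *)
Definition ideal_bracket I (q : nat) : set R :=
  ideal_gen [set x ^+ q | x in I].

(* (I : u) *)
Definition ideal_colon I (u : R) : set R := [set r | I (r * u)].

Definition is_prime P : Prop :=
  [/\ is_ideal P, P <> setT & forall x y, P (x * y) -> P x \/ P y].

Definition is_minimal_prime P : Prop :=
  is_prime P /\ forall Q, is_prime Q -> Q `<=` P -> Q = P.

Definition is_maximal m : Prop :=
  [/\ is_ideal m, m <> setT
    & forall I, is_ideal I -> m `<=` I -> I <> setT -> I = m].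

Definition is_local m : Prop :=
  is_maximal m /\ forall m', is_maximal m' -> m' = m.

Definition radical I : set R := [set x | exists n, I (x ^+ n)].

Definition is_primary I : Prop :=
  [/\ is_ideal I, I <> setT & forall x y, I (x * y) -> I x \/ radical I y].

Definition is_irreducible I : Prop :=
  [/\ is_ideal I, I <> setT
    & forall J K, is_ideal J -> is_ideal K -> I = J `&` K -> I = J \/ I = K].

Definition noetherian : Prop :=
  forall I, is_ideal I -> exists s : seq R, I = ideal_gen [set` s].

Definition reduced : Prop := forall (x : R) n, x ^+ n = 0 -> x = 0.

(* c 0 < c 1 < ... < c n *)
Definition prime_chain (n : nat) (c : nat -> set R) : Prop :=
  (forall i, (i <= n)%N -> is_prime (c i)) /\
  (forall i, (i < n)%N -> c i `<` c i.+1).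

Definition has_krull_dim (d : nat) : Prop :=
  (exists c, prime_chain d c) /\ (forall n c, prime_chain n c -> (n <= d)%N).

Definition has_height P (h : nat) : Prop :=
  (exists c, prime_chain h c /\ c h = P) /\
  (forall n c, prime_chain n c -> c n = P -> (n <= h)%N).

Definition associated_prime J P : Prop :=
  is_prime P /\ exists x, P = ideal_colon J x.

(* The unit ideal satisfies this vacuously; thus a field, whose only canonical
   ideal is the unit ideal, is not excluded. *)
Definition pure_height_one J : Prop :=
  forall P, associated_prime J P -> has_height P 1.

(* J^(n), the height one component of J^n: the intersection, over the primes P
   of height one, of the contractions to R of J^n R_P. When J is nonzero in a
   domain, this contraction is the P-primary component of J^n if P contains J,
   and is R otherwise. *)
Definition symbolic_pow J (n : nat) : set R :=
  [set x | forall P, has_height P 1 ->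
             exists s, ~ P s /\ ideal_pow J n (s * x)].

(* K R_P is principal. A generator may be multiplied by a unit of R_P, hence
   taken in the image of K; the equation says x/1 = (r/s) (a/1) in R_P. *)
Definition locally_principal P K : Prop :=
  exists a, K a /\ forall x, K x -> exists s r, ~ P s /\ s * x = r * a.

(* The class of u generates the socle (I : m)/I of R/I. *)
Definition socle_generator m I (u : R) : Prop :=
  forall x, (forall y, m y -> I (y * x)) <-> exists r, I (x - r * u).

End Ideals.

(** * Modules *)

(* S as an R-module through f. *)
Definition restr_scalars (R S : comNzRingType) (f : {rmorphism R -> S}) :
  Type := S.

Section RestrictionOfScalars.
Variables (R S : comNzRingType) (f : {rmorphism R -> S}).

HB.instance Definition _ := GRing.Zmodule.copy (restr_scalars f) S.

Definition restr_scale (r : R) (x : restr_scalars f) : restr_scalars f :=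
  f r * (x : S).

Fact restr_scaleA a b v :
  restr_scale a (restr_scale b v) = restr_scale (a * b) v.
Proof. by rewrite /restr_scale rmorphM mulrA. Qed.

Fact restr_scale1 : left_id 1 restr_scale.
Proof. by move=> v; rewrite /restr_scale rmorph1 mul1r. Qed.

Fact restr_scaleDr : right_distributive restr_scale +%R.
Proof. by move=> a u v; rewrite /restr_scale mulrDr. Qed.

Fact restr_scaleDl v : {morph restr_scale^~ v : a b / a + b}.
Proof. by move=> a b; rewrite /restr_scale rmorphD mulrDl. Qed.

HB.instance Definition _ := GRing.Zmodule_isLmodule.Build R (restr_scalars f)
  restr_scaleA restr_scale1 restr_scaleDr restr_scaleDl.

End RestrictionOfScalars.

Section Modules.
Variable R : comNzRingType.
Implicit Types (M N E : lmodType R).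

Definition fin_gen M : Prop :=
  exists s : seq M, forall x, exists c : 'I_(size s) -> R,
    x = \sum_(i < size s) c i *: s`_i.

Definition lmod_iso M N : Prop := exists f : {linear M -> N}, bijective f.

Definition no_free_summand M : Prop :=
  forall (n : nat) N, lmod_iso M ('rV[R]_n * N)%type -> n = 0%N.

(* (s_0, ..., s_(n-1)) M *)
Definition seq_smul (s : seq R) M : set M :=
  [set x | exists c : 'I_(size s) -> M, x = \sum_(i < size s) s`_i *: c i].

Definition regular_seq (s : seq R) M : Prop :=
  (forall i, (i < size s)%N -> forall z : M,
     seq_smul (take i s) (s`_i *: z) -> seq_smul (take i s) z) /\
  @seq_smul s M <> setT.

Definition has_depth (m : set R) M (t : nat) : Prop :=
  (exists s, [/\ [set` s] `<=` m, regular_seq s M & size s = t]) /\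
  (forall s, [set` s] `<=` m -> regular_seq s M -> (size s <= t)%N).

Definition injective_module E : Prop :=
  forall (A B : lmodType R) (i : {linear A -> B}) (f : {linear A -> E}),
    injective i -> exists g : {linear B -> E}, forall a, g (i a) = f a.

Record injective_resolution M := InjectiveResolution {
  ir_obj : nat -> lmodType R;
  ir_aug : {linear M -> ir_obj 0};
  ir_d : forall i, {linear ir_obj i -> ir_obj i.+1};
  ir_injective : forall i, injective_module (ir_obj i);
  ir_aug_inj : injective ir_aug;
  ir_exact0 : forall y, ir_d 0 y = 0 <-> exists x, ir_aug x = y;
  ir_exactS : forall i y, ir_d i.+1 y = 0 <-> exists x, ir_d i x = y }.

Definition finite_resolution M (E : injective_resolution M) : Prop :=
  exists n, forall i, (n < i)%N -> forall x : ir_obj E i, x = 0.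

Definition coboundary N M (E : injective_resolution M) (i : nat) :
    (N -> ir_obj E i) -> Prop :=
  match i with
  | 0 => fun phi => forall x, phi x = 0
  | j.+1 => fun phi =>
      exists psi : {linear N -> ir_obj E j}, forall x, phi x = ir_d E j (psi x)
  end.

Definition cocycle N M (E : injective_resolution M) (i : nat)
    (phi : N -> ir_obj E i) : Prop :=
  forall x, ir_d E i (phi x) = 0.

(* Ext^i_R(N, M) = H^i(Hom_R(N, E)) is nonzero and generated by one element.
   When N is the residue field k this says that its k-dimension is 1. *)
Definition ext_rank1 N M (E : injective_resolution M) (i : nat) : Prop :=
  exists phi : {linear N -> ir_obj E i},
    [/\ cocycle phi, ~ coboundary phi
      & forall psi : {linear N -> ir_obj E i}, cocycle psi ->
          exists r : R, coboundary (fun x => psi x - r *: phi x)].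

End Modules.

Section Canonical.
Variables (R : comNzRingType) (m : set R).
Variables (k : fieldType) (res : {rmorphism R -> k}).

(* A maximal Cohen-Macaulay module of type 1 and of finite injective dimension
   (Bruns-Herzog). Depth being dim R = d, the type is dim_k Ext^d_R(k, M). *)
Definition canonical_module (M : lmodType R) : Prop :=
  exists d, [/\ has_krull_dim R d, fin_gen M, has_depth m M d
    & exists E : injective_resolution M,
        finite_resolution E /\ ext_rank1 (restr_scalars res) E d].

Definition canonical_ideal (J : set R) : Prop :=
  is_ideal J /\
  exists (M : lmodType R) (f : {linear M -> R^o}),
    [/\ canonical_module M, injective f & range f = J].

Definition Q_Gorenstein_punctured : Prop :=
  exists J : set R, [/\ canonical_ideal J, pure_height_one J
    & forall P, is_prime P -> P <> m ->
        exists h, (1 <= h)%N /\ locally_principal P (symbolic_pow J h)].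

End Canonical.

(** * Frobenius *)

Section Frobenius.
Variables (R : comNzRingType) (p : nat) (charRp : p \in [pchar R]).

Definition frob (e : nat) of p \in [pchar R] : R -> R :=
  fun x => x ^+ (p ^ e).

Fact frob_is_zmod_morphism e : zmod_morphism (frob e charRp).
Proof.
have pn : [pchar R].-nat (p ^ e)%N.
  by rewrite pnatX pnatE ?charRp // (pcharf_prime charRp).
move=> x y; rewrite /frob exprDn_pchar //; congr (_ + _).
by apply/eqP; rewrite -subr_eq0 opprK -exprDn_pchar // addNr expr0n
  expn_eq0 -leqn0 leqNgt (prime_gt0 (pcharf_prime charRp)).
Qed.

Fact frob_is_monoid_morphism e : monoid_morphism (frob e charRp).
Proof. by split=> [|x y]; rewrite /frob ?expr1n ?exprMn. Qed.

HB.instance Definition _ e :=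
  GRing.isZmodMorphism.Build R R (frob e charRp) (frob_is_zmod_morphism e).
HB.instance Definition _ e :=
  GRing.isMonoidMorphism.Build R R (frob e charRp) (frob_is_monoid_morphism e).

(* R^(1/q), q = p^e, as an R-module: the element x of the carrier R stands for
   x^(1/q), so that the scaling is r *: x = r^q * x. *)
Definition root_mod (e : nat) : lmodType R := restr_scalars (frob e charRp).

Definition F_finite : Prop := fin_gen (root_mod 1).

(* R -> R^(1/q), 1 |-> c^(1/q), splits. *)
Definition root_splits (c : R) (e : nat) : Prop :=
  exists g : {linear root_mod e -> R^o},
    forall r : R, g (r *: (c : root_mod e)) = r.

Definition strongly_F_regular : Prop :=
  [/\ F_finite, reduced R
    & forall c : R, (forall P, is_minimal_prime P -> ~ P c) ->
        exists e, root_splits c e].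

(* R^(1/q) = R^a (+) M, where M has no nonzero free direct summand. *)
Definition free_rank_root (e a : nat) : Prop :=
  exists M : lmodType R,
    lmod_iso (root_mod e) ('rV[R]_a * M)%type /\ no_free_summand M.

Definition condition_A (m : set R) : Prop :=
  exists (I : nat -> set R) (u : nat -> R) (t0 : nat),
  [/\ (forall t, (1 <= t)%N ->
         [/\ is_irreducible (I t), is_primary (I t), radical (I t) = m,
             I t.+1 `<=` I t & socle_generator m (I t) (u t)]),
      (forall n, exists t, (1 <= t)%N /\ I t `<=` ideal_pow m n),
      (forall t, (1 <= t)%N -> exists n, ideal_pow m n `<=` I t),
      (1 <= t0)%N
    & forall t e, (t0 <= t)%N ->
        ideal_colon (ideal_bracket (I t) (p ^ e)) (u t ^+ (p ^ e)) =
        ideal_colon (ideal_bracket (I t0) (p ^ e)) (u t0 ^+ (p ^ e))].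

End Frobenius.

(* [k : k^p] = n: some n elements of k form a basis of k over k^p. *)
Definition frob_degree (k : fieldType) (p n : nat) : Prop :=
  exists b : 'I_n -> k, forall x, exists! c : {ffun 'I_n -> k},
    x = \sum_(i < n) c i ^+ p * b i.

(* s is the F-signature of R: the limit of a_q / q^(d + log_p [k : k^p]). *)
Definition is_F_signature (Re : realType) (R : comNzRingType) (p : nat)
    (charRp : p \in [pchar R]) (k : fieldType) (s : Re) : Prop :=
  exists (d n : nat) (a : nat -> nat),
  [/\ has_krull_dim R d, frob_degree k p n,
      (forall e, free_rank_root charRp e (a e))
    & (fun e : nat => (a e)%:R /
         ((p ^ e)%:R `^ (d%:R + ln n%:R / ln p%:R)) : Re) @ \oo --> s].

(* Main.v *)
(* Condition (A).  Write J for the canonical ideal.  Tight closure of ideals is trivial in R, so an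
   element c of J, which compares R with the Cohen-Macaulay module J up to the factor c, shows that
   R is Cohen-Macaulay.  Take parameters x, y_2, ..., y_d with x in J.  The irreducible ideals are
   I_t = (x^(t+1) J, y_i^(t+2)): multiplication by x embeds R/I_t in J/(x^(t+2), y_i^(t+2))J, whose
   socle embeds in Ext^d(k, J) (Rees) and is therefore one-dimensional.  As
   u_t = u (x y_2 ... y_d)^t, Condition (A) asks to cancel high powers of the y_i from
   r u_t^q in I_t^[q].  By tight closure it is enough to do so up to a factor c independent of q.
   Let N = (J^[q] : y_2^(Cq)), with y_2 chosen where J is locally principal.  If s J^(h) is
   contained in a R, with a in J^(h), then s^k N is contained in a^k R and c a^k lies in N, for
   k the integral part of q/h; as R is Cohen-Macaulay, c s^q annihilates the defect modules
   ((W)N : y_i^n)/(W)N.  Such s generate an ideal that lies in no prime P <> m, so powers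
   c y_i^(Cq) annihilate these modules, and y_i^n can be replaced with y_i^(Cq) at no loss in the
   difference of exponents.

   The F-signature.  Let a_e be the rank of the largest free summand of R^(1/p^e), let D be the rank
   of R^(1/p), and let Q = p^d [k : k^p].  A basis of R^(1/p) up to c-torsion gives
   a_(e+1) <= D a_e + O(Q^e / p^e), because R/(c) has dimension d - 1.  Counting generators of
   R^(1/p^e) gives D^e = O(Q^e), so D <= Q.  Hence a_e / Q^e is non-increasing up to a summable
   error (Polstra-Tucker). *)

From HB Require Import structures.
Require Import Defs.
From mathcomp Require Import all_boot all_order all_algebra.
From mathcomp Require Import ring lra zify.
From mathcomp Require Import all_classical all_reals all_analysis.

Set Implicit Arguments.
Unset Strict Implicit.
Unset Printing Implicit Defensive.

Import Order.TTheory GRing.Theory Num.Theory.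
Import numFieldNormedType.Exports.

Local Open Scope classical_set_scope.
Local Open Scope ring_scope.

(** * Ideals of a Noetherian ring *)

(** The obstacle is that I_t^[q] involves J^[q], in which powers of the y_i cannot be cancelled
    freely, and that J^(q) is no cure by itself: h need not divide q, and h changes with the prime
    P. Two devices deal with this. The remainder of q modulo h, being less than h, is paid for by a
    constant b^h, which tight closure tolerates because it does not grow with q. And all other
    exponents are rounded up to p^(f+e): since Frobenius is additive, the elements r such that c
    r^(p^(f+e)) works for every e form an ideal, which can be compared with primes. Cancelling
    inside N costs the p^f q-th power of the product of the y_i, and returning from N to J^[q] costs
    its p^f' q-th power; these fixed multiples of q are the origin of t_0 = p^f + p^f'.

    Neither localisations nor quotients are formed: a statement at P becomes an equation with a
    denominator outside P, a statement on J/(s)J a membership in [seqm J s]. The F-signature is not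
    deduced from Condition (A); the two arguments share the parameters and the fact that R is a
    domain. *)

Section Ideals.
Variable R : comNzRingType.
Implicit Types (I J K P W V A : set R) (x y z r s : R).

Lemma ideal0 I : is_ideal I -> I 0. Proof. by case. Qed.

Lemma idealD I x y : is_ideal I -> I x -> I y -> I (x + y).
Proof. by case=> _ + _; exact. Qed.

Lemma idealM I r x : is_ideal I -> I x -> I (r * x).
Proof. by case=> _ _; exact. Qed.

Lemma idealMr I r x : is_ideal I -> I x -> I (x * r).
Proof. by rewrite mulrC; exact: idealM. Qed.

Lemma idealN I x : is_ideal I -> I x -> I (- x).
Proof. by rewrite -mulN1r; exact: idealM. Qed.

Lemma idealB I x y : is_ideal I -> I x -> I y -> I (x - y).
Proof. by move=> hI hx hy; apply: idealD => //; exact: idealN. Qed.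

Lemma idealX I x n : is_ideal I -> I x -> I (x ^+ n.+1).
Proof. by rewrite exprS; exact: idealMr. Qed.

Lemma ideal_sum (T : Type) I (s : seq T) (Q : pred T) (F : T -> R) :
  is_ideal I -> (forall i, Q i -> I (F i)) -> I (\sum_(i <- s | Q i) F i).
Proof.
by move=> hI hF; elim/big_ind: _ => //; [exact: ideal0|move=> x y; exact: idealD].
Qed.

Lemma ideal1 I : is_ideal I -> I 1 -> I = setT.
Proof.
by move=> hI h1; rewrite -subTset => x _; rewrite -(mulr1 x); exact: idealM.
Qed.

Lemma ideal_proper I : is_ideal I -> I <> setT -> ~ I 1.
Proof. by move=> hI hT /(ideal1 hI). Qed.

Lemma ideal_setT : is_ideal (@setT R). Proof. by []. Qed.

Lemma ideal_set0 : is_ideal [set 0 : R].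
Proof.
by split=> [|x y -> ->|r x ->] //=; rewrite ?addr0 ?mulr0.
Qed.

Lemma ideal_setI I J : is_ideal I -> is_ideal J -> is_ideal (I `&` J).
Proof.
move=> hI hJ; split=> [|x y [? ?] [? ?]|r x [? ?]].
- by split; exact: ideal0.
- by split; exact: idealD.
- by split; exact: idealM.
Qed.

Lemma ideal_colon_ideal I u : is_ideal I -> is_ideal (ideal_colon I u).
Proof.
move=> hI; split=> [|x y|r x]; rewrite /ideal_colon /=.
- by rewrite mul0r; exact: ideal0.
- by rewrite mulrDl; exact: idealD.
- by rewrite -mulrA; exact: idealM.
Qed.

Lemma ideal_gen_ideal A : is_ideal (ideal_gen A).
Proof.
split=> [I [hI _]|x y hx hy I hIA|r x hx I hIA].
- exact: ideal0.
- by case: (hIA) => hI _; apply: idealD => //; [exact: hx|exact: hy].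
- by case: (hIA) => hI _; apply: idealM => //; exact: hx.
Qed.

Lemma sub_ideal_gen A : A `<=` ideal_gen A.
Proof. by move=> x hx I [_]; exact. Qed.

Lemma ideal_gen_min A I : is_ideal I -> A `<=` I -> ideal_gen A `<=` I.
Proof. by move=> hI hA x; apply. Qed.

Definition principal a : set R := [set z | exists r, z = r * a].

Lemma principal_ideal a : is_ideal (principal a).
Proof.
split=> [|_ _ [r ->] [s ->]|r _ [s ->]].
- by exists 0; rewrite mul0r.
- by exists (r + s); rewrite mulrDl.
- by exists (r * s); rewrite mulrA.
Qed.

Lemma ideal_mul_sub I J K : is_ideal K ->
  (forall x y, I x -> J y -> K (x * y)) -> ideal_mul I J `<=` K.
Proof.
by move=> hK h; apply: ideal_gen_min => // _ [x [y [? ? ->]]]; exact: h.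
Qed.

Lemma ideal_mul_mem I J x y : I x -> J y -> ideal_mul I J (x * y).
Proof. by move=> hx hy; apply: sub_ideal_gen; exists x, y. Qed.

Lemma ideal_bracket_ideal I q : is_ideal (ideal_bracket I q).
Proof. exact: ideal_gen_ideal. Qed.

Lemma ideal_bracket_mem I q x : I x -> ideal_bracket I q (x ^+ q).
Proof. by move=> hx; apply: sub_ideal_gen; exists x. Qed.

Lemma ideal_bracket_min I q K : is_ideal K -> (forall x, I x -> K (x ^+ q)) ->
  ideal_bracket I q `<=` K.
Proof. by move=> hK h; apply: ideal_gen_min => // _ [x hx <-]; exact: h. Qed.

Lemma ideal_pow_ideal I n : is_ideal (ideal_pow I n).
Proof. by case: n => [|n] /=; [exact: ideal_setT|exact: ideal_gen_ideal]. Qed.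

Lemma ideal_pow_mem I n x : I x -> ideal_pow I n (x ^+ n).
Proof.
by move=> hx; elim: n => [|n IH] //=; rewrite exprS; exact: ideal_mul_mem.
Qed.

(** A family without maximal member yields, by dependent choice, a strictly increasing sequence; the
    union is finitely generated, so one term already contains it. *)
Lemma noetherian_max (F : set (set R)) : noetherian R ->
  (forall I, F I -> is_ideal I) -> F !=set0 ->
  exists2 I, F I & forall I', F I' -> I `<=` I' -> I' `<=` I.
Proof.
move=> hN hF [I0 hI0]; apply: contrapT => hno.
have step (I : {I | F I}) :
    exists I' : {I | F I}, sval I `<=` sval I' /\ ~ (sval I' `<=` sval I).
  case: I => I hI; apply: contrapT => h; apply: hno; exists I => // I' hI' II'.
  by apply: contrapT => h'; apply: h; exists (exist _ I' hI').
have [f hf] := choice step.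
pose c n := sval (iter n f (exist _ I0 hI0)).
have cF n : F (c n) := svalP (iter n f (exist _ I0 hI0)).
have cS n : c n `<=` c n.+1 by rewrite /c iterS; case: (hf (iter n f (exist _ I0 hI0))).
have cM n k : (n <= k)%N -> c n `<=` c k.
  elim: k => [|k IH]; first by rewrite leqn0 => /eqP->.
  rewrite leq_eqVlt => /orP[/eqP->//|]; rewrite ltnS => /IH h x /h; exact: cS.
pose U := \bigcup_n c n.
have hU : is_ideal U.
  split=> [|x y [i _ hx] [j _ hy]|r x [i _ hx]].
  - by exists 0%N => //; exact: ideal0 (hF _ (cF 0%N)).
  - exists (maxn i j) => //; apply: idealD (hF _ (cF _)) _ _.
      by apply: cM hx; exact: leq_maxl.
    by apply: cM hy; exact: leq_maxr.
  - by exists i => //; exact: idealM (hF _ (cF _)) hx.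
have [s sU] := hN _ hU.
have [N hs] : exists N, [set` s] `<=` c N.
  have : [set` s] `<=` U by rewrite sU; exact: sub_ideal_gen.
  elim: s {sU} => [|x s IH] hs; first by exists 0%N.
  have [N hN'] : exists N, [set` s] `<=` c N.
    by apply: IH => y /= ys; apply: hs; rewrite /= inE ys orbT.
  have [k _ hk] : U x by apply: hs; rewrite /= inE eqxx.
  exists (maxn N k) => y /=; rewrite inE => /orP[/eqP->|ys].
    by apply: cM hk; exact: leq_maxr.
  by apply: (cM N); [exact: leq_maxl|exact: hN'].
have UN : U `<=` c N by rewrite sU; apply: ideal_gen_min => //; exact: hF.
have := hf (iter N f (exist _ I0 hI0)); rewrite -iterS => -[_]; apply => x hx.
by apply: UN; exists N.+1.
Qed.

Definition add_ideal W x : set R := [set z | exists w r, W w /\ z = w + r * x].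

Lemma add_ideal_ideal W x : is_ideal W -> is_ideal (add_ideal W x).
Proof.
move=> hW; split=> [|_ _ [w [r [hw ->]]] [w' [r' [hw' ->]]]|r _ [w [r' [hw ->]]]].
- by exists 0, 0; rewrite mul0r addr0; split=> //; exact: ideal0.
- by exists (w + w'), (r + r'); split; [exact: idealD|ring].
- by exists (r * w), (r * r'); split; [exact: idealM|ring].
Qed.

Lemma add_ideal_sub W x : W `<=` add_ideal W x.
Proof. by move=> w hw; exists w, 0; rewrite mul0r addr0. Qed.

Lemma add_ideal_mem W x : is_ideal W -> add_ideal W x x.
Proof. by move=> hW; exists 0, 1; rewrite mul1r add0r; split=> //; exact: ideal0. Qed.

(** An ideal maximal among those over [I] that miss [S] is prime: if it contained neither [x] nor
    [y], both enlargements would meet [S], and the product of the two common elements would lie in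
    it. *)
Lemma prime_avoiding (hN : noetherian R) I (S : set R) : is_ideal I -> S 1 ->
  (forall x y, S x -> S y -> S (x * y)) -> (forall x, S x -> ~ I x) ->
  exists P, [/\ is_prime P, I `<=` P & forall x, S x -> ~ P x].
Proof.
move=> hI S1 SM SI.
have [| |P [hP IP PS] Pmax] := @noetherian_max
    [set P | [/\ is_ideal P, I `<=` P & forall x, S x -> ~ P x]] hN.
- by move=> ? [].
- by exists I; split.
exists P; split=> //; split=> // [PT|x y Pxy]; first by apply: (PS 1) => //; rewrite PT.
apply: contrapT => /not_orP[nx ny].
have aux z : ~ P z -> exists s w r, [/\ S s, P w & s = w + r * z].
  move=> nz; apply: contrapT => h.
  have := Pmax (add_ideal P z); move/(_ _ (@add_ideal_sub _ _)) => hh; apply: nz.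
  apply: hh; last exact: add_ideal_mem.
  split; [exact: add_ideal_ideal|by move=> w /IP /(@add_ideal_sub P z)|].
  by move=> s hs [w [r [hw e]]]; apply: h; exists s, w, r.
have [s [w [r [hs hw es]]]] := aux _ nx.
have [s' [w' [r' [hs' hw' es']]]] := aux _ ny.
apply: (PS (s * s')); first exact: SM.
have -> : s * s' = w * s' + r * x * w' + r * r' * (x * y) by rewrite es es'; ring.
apply: idealD => //; last exact: idealM.
by apply: idealD => //; [exact: idealMr|exact: idealM].
Qed.

Lemma exists_maximal (hN : noetherian R) I : is_ideal I -> I <> setT ->
  exists2 P, is_maximal P & I `<=` P.
Proof.
move=> hI IT.
have [| |P [hP IP PT] Pmax] := @noetherian_max
    [set P | [/\ is_ideal P, I `<=` P & P <> setT]] hN.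
- by move=> ? [].
- by exists I; split.
exists P => //; split=> // Q hQ PQ QT; apply/seteqP; split=> //.
by apply: Pmax => //; split=> // x /IP /PQ.
Qed.

Lemma primeX P x n : is_prime P -> P (x ^+ n) -> P x.
Proof.
case=> hP PT hM; elim: n => [|n IH]; first by move/(ideal1 hP).
by rewrite exprS => /hM[].
Qed.

Lemma prime_notin1 P : is_prime P -> ~ P 1.
Proof. by case=> hP PT _; exact: ideal_proper. Qed.

Lemma prime_mulN P x y : is_prime P -> ~ P x -> ~ P y -> ~ P (x * y).
Proof. by case=> _ _ h nx ny /h[]. Qed.

Lemma prime_ideal P : is_prime P -> is_ideal P. Proof. by case. Qed.

Lemma maximal_prime P : is_maximal P -> is_prime P.
Proof.
case=> hP PT Pmax; split=> // x y Pxy; apply: contrapT => /not_orP[nx ny].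
have hA := add_ideal_ideal x hP.
have [AT|AT] := pselect (add_ideal P x = setT).
  have [w [r [hw e]]] : add_ideal P x 1 by rewrite AT.
  apply: ny; rewrite -(mul1r y) e mulrDl -mulrA.
  by apply: idealD => //; [exact: idealMr|exact: idealM].
by apply: nx; rewrite -(Pmax _ hA (@add_ideal_sub _ _) AT); exact: add_ideal_mem.
Qed.

(** Zorn's lemma for reversed inclusion; the intersection of a chain of primes is prime. *)
Lemma exists_minimal_prime_over I Q : is_ideal I -> is_prime Q -> I `<=` Q ->
  exists P, [/\ is_prime P, I `<=` P, P `<=` Q &
    forall P', is_prime P' -> I `<=` P' -> P' `<=` P -> P' = P].
Proof.
move=> hI hQ IQ.
pose T := {P : set R | [/\ is_prime P, I `<=` P & P `<=` Q]}.
pose le (P P' : T) := `[< sval P' `<=` sval P >].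
have [|||t tmax] := @ZL_preorder T (exist _ Q (And3 hQ IQ (@subset_refl _ Q))) le.
- by move=> t; exact/asboolP.
- by move=> a b c /asboolP h /asboolP h'; apply/asboolP => x /h' /h.
- move=> A Atot.
  have [[a Aa]|A0] := pselect (exists a, A a); last first.
    by exists (exist _ Q (And3 hQ IQ (@subset_refl _ Q))) => a Aa; exfalso; apply: A0; exists a.
  pose B := \bigcap_(t in A) sval t.
  have hB : [/\ is_prime B, I `<=` B & B `<=` Q].
    split; last by move=> x /(_ a Aa); case: (svalP a) => _ _; apply.
      split.
      - split=> [t _|x y hx hy t At|r x hx t At].
        + by case: (svalP t) => /prime_ideal/ideal0.
        + by case: (svalP t) => /prime_ideal ht _ _; apply: idealD => //; [exact: hx|exact: hy].
        + by case: (svalP t) => /prime_ideal ht _ _; apply: idealM => //; exact: hx.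
      - move=> BT; have : B 1 by rewrite BT.
        by move/(_ a Aa); case: (svalP a) => /prime_notin1.
      - move=> x y hxy; apply: contrapT => /not_orP[nx ny].
        have [t At ntx] : exists2 t, A t & ~ sval t x.
          by apply: contrapT => h; apply: nx => t At; apply: contrapT => h'; apply: h; exists t.
        have [t' At' nty] : exists2 t, A t & ~ sval t y.
          by apply: contrapT => h; apply: ny => u Au; apply: contrapT => h'; apply: h; exists u.
        have [/asboolP h|/asboolP h] := (Atot _ _ At At').
          case: (svalP t') => ht' _ _; apply: (prime_mulN ht' _ nty) (hxy _ At').
          by move/h.
        case: (svalP t) => ht _ _; apply: (prime_mulN ht ntx _) (hxy _ At).
        by move/h.
    by move=> x Ix t _; case: (svalP t) => _ + _; exact.
  by exists (exist _ B hB) => t At; apply/asboolP => x /=; apply.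
case: (svalP t) => ht It tQ; exists (sval t); split=> // P' hP' IP' P't.
have P'Q : P' `<=` Q by move=> x /P't /tQ.
apply/seteqP; split=> //; apply/asboolP.
by apply: (tmax (exist _ P' (And3 hP' IP' P'Q))); exact/asboolP.
Qed.

(** In R_P the maximal ideal is the only prime over [I], so its elements are nilpotent modulo [I].
    Without localising: a prime over [I] that misses all [s * x ^+ n] with [s] outside [P] would lie
    in [P] and miss [x]. *)
Lemma minimal_prime_over_nil (hN : noetherian R) I P x : is_ideal I -> is_prime P ->
  (forall P', is_prime P' -> I `<=` P' -> P' `<=` P -> P' = P) ->
  P x -> exists s n, ~ P s /\ I (s * x ^+ n).
Proof.
move=> hI hP Pmin Px; apply: contrapT => h.
have [|||Q [hQ IQ SQ]] := @prime_avoiding hN I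
    [set z | exists s n, ~ P s /\ z = s * x ^+ n] hI.
- by exists 1, 0%N; rewrite mul1r; split=> //; exact: prime_notin1.
- move=> _ _ [s [n [hs ->]]] [s' [n' [hs' ->]]]; exists (s * s'), (n + n')%N.
  by split; [exact: prime_mulN|rewrite exprD; ring].
- by move=> _ [s [n [hs ->]]] hI'; apply: h; exists s, n.
have QP : Q `<=` P.
  move=> z Qz; apply: contrapT => nPz; apply: (SQ z) => //.
  by exists z, 0%N; rewrite mulr1.
apply: (SQ x); last by rewrite (Pmin _ hQ IQ QP).
by exists 1, 1%N; split; [exact: prime_notin1|rewrite mul1r].
Qed.

Lemma local_unit (hN : noetherian R) m x : is_local m -> ~ m x -> exists y, y * x = 1.
Proof.
move=> [hm mU] nx; apply: contrapT => h.
have [|Q hQ xQ] := exists_maximal hN (principal_ideal x).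
  by move=> e; apply: h; have [y ->] : principal x 1 by [rewrite e]; exists y.
by apply: nx; rewrite -(mU _ hQ); apply: xQ; exists 1; rewrite mul1r.
Qed.

Lemma local_proper (hN : noetherian R) m I : is_local m -> is_ideal I -> I <> setT -> I `<=` m.
Proof.
by move=> [hm mU] hI IT; have [Q hQ xQ] := exists_maximal hN hI IT; rewrite -(mU _ hQ).
Qed.

(** The hypothesis is K in W + mK with one product instead of a sum, the form in which it arises. If
    [V] is maximal among the ideals over [W] that do not contain [K], and [z] in [K] is outside [V],
    then [z'] lies in V + Rz; as [1 - r * x] is a unit, [z] lies in [V]. *)
Lemma nakayama (hN : noetherian R) m W K : is_local m -> is_ideal W -> is_ideal K ->
  (forall z, K z -> exists w x z', [/\ W w, m x, K z' & z = w + x * z']) -> K `<=` W.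
Proof.
move=> hm hW hK h; apply: contrapT => KW.
have [| |V [hV WV KV] Vmax] := @noetherian_max
    [set V | [/\ is_ideal V, W `<=` V & ~ (K `<=` V)]] hN.
- by move=> ? [].
- by exists W; split.
apply: KV => z Kz; apply: contrapT => nVz.
have [w [x [z' [hw hx hz' e]]]] := h _ Kz.
have : add_ideal V z z'.
  apply: contrapT => n; apply: nVz.
  apply: (Vmax _ _ (@add_ideal_sub V z)) (add_ideal_mem z hV).
  split; [exact: add_ideal_ideal|by move=> t /WV; exact: add_ideal_sub|].
  by move/(_ _ hz').
move=> [v [r [hv ez']]].
have n1 : ~ m (1 - r * x).
  have [[hmi mT _] _] := hm; move=> h1; apply: (ideal_proper hmi mT).
  by rewrite -(subrK (r * x) 1); apply: idealD => //; exact: idealM.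
have [y hy] := local_unit hN hm n1; apply: nVz.
have -> : z = y * (w + x * v).
  rewrite -[LHS]mul1r -hy -mulrA mulrBl mul1r {1}e ez'; ring.
by apply: idealM => //; apply: idealD; [| |exact: idealM] => //; exact: WV.
Qed.

End Ideals.

(** * Regular sequences and depth *)

Section RegularSequences.
Variables (R : comNzRingType) (m : set R).
Hypotheses (hN : noetherian R) (hm : is_local m).
Implicit Types (I J K P W V A : set R) (x y z r : R) (s t u : seq R).

(** The submodule (s)J; for [J = setT] it is the ideal generated by [s]. The recursion exposes the
    coefficient of the head, which is the one that exchange arguments manipulate. *)
Fixpoint seqm J s : set R :=
  if s is x :: s' then [set z | exists w j, [/\ seqm J s' w, J j & z = w + x * j]]
  else [set 0].

(* Regularity is tested starting from the last entry of the list. *)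
Fixpoint regseq J s : Prop :=
  if s is x :: s' then
    (forall z, J z -> seqm J s' (x * z) -> seqm J s' z) /\ regseq J s'
  else True.

Lemma local_ideal : is_ideal m. Proof. by case: hm => -[]. Qed.

Lemma local_notT : m <> setT. Proof. by case: hm => -[]. Qed.

Lemma local_prime : is_prime m. Proof. by case: hm => + _; exact: maximal_prime. Qed.

Lemma seqm_ideal J s : is_ideal J -> is_ideal (seqm J s).
Proof.
move=> hJ; elim: s => [|x s IH] /=; first exact: ideal_set0.
split=> [|_ _ [w [j [hw hj ->]]] [w' [j' [hw' hj' ->]]]|r _ [w [j [hw hj ->]]]].
- by exists 0, 0; rewrite mulr0 addr0; split=> //; exact: ideal0.
- by exists (w + w'), (j + j'); split; [exact: idealD|exact: idealD|ring].
- by exists (r * w), (r * j); split; [exact: idealM|exact: idealM|ring].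
Qed.

Lemma seqm_head J x s j : is_ideal J -> J j -> seqm J (x :: s) (x * j).
Proof.
by move=> hJ hj; exists 0, j; rewrite add0r; split=> //; exact: ideal0 (seqm_ideal _ _).
Qed.

Lemma seqm_tail J x s : is_ideal J -> seqm J s `<=` seqm J (x :: s).
Proof.
by move=> hJ w hw; exists w, 0; rewrite mulr0 addr0; split=> //; exact: ideal0.
Qed.

Lemma seqm_mono J J' s : J `<=` J' -> seqm J s `<=` seqm J' s.
Proof.
by move=> hJ; elim: s => //= x s IH z [w [j [/IH ? /hJ ? ->]]]; exists w, j.
Qed.

Lemma seqm_min J V s : is_ideal V -> (forall x j, x \in s -> J j -> V (x * j)) ->
  seqm J s `<=` V.
Proof.
move=> hV; elim: s => [|x s IH] h z /= => [->|[w [j [hw hj ->]]]]; first exact: ideal0.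
apply: idealD => //; last by apply: h => //; rewrite inE eqxx.
by apply: IH => // y k ys; apply: h; rewrite inE ys orbT.
Qed.

Lemma seqm_mem J x s j : is_ideal J -> x \in s -> J j -> seqm J s (x * j).
Proof.
move=> hJ; elim: s => //= y s IH; rewrite inE => /orP[/eqP->|xs] hj.
  exact: seqm_head.
by apply: seqm_tail => //; exact: IH.
Qed.

Lemma seqm_subset J s t : is_ideal J -> {subset s <= t} -> seqm J s `<=` seqm J t.
Proof.
move=> hJ st; apply: seqm_min => [|x j xs hj]; first exact: seqm_ideal.
by apply: seqm_mem => //; exact: st.
Qed.

Lemma seqm_perm J s t : is_ideal J -> perm_eq s t -> seqm J s = seqm J t.
Proof.
move=> hJ st; apply/seteqP; split; apply: seqm_subset => // x;
  by rewrite (perm_mem st).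
Qed.

Lemma seqm_scale J V s a : is_ideal V -> (forall j, J j -> V (a * j)) ->
  forall z, seqm J s z -> seqm V s (a * z).
Proof.
move=> hV h; elim: s => [|x s IH] z /= => [->|[w [j [hw hj ->]]]]; first by rewrite mulr0.
by exists (a * w), (a * j); split; [exact: IH|exact: h|ring].
Qed.

Lemma seqm_factor J V s a b : is_ideal V ->
  (forall j, J j -> exists2 v, V v & a * j = b * v) ->
  forall z, seqm J s z -> exists2 v, seqm V s v & a * z = b * v.
Proof.
move=> hV h; elim: s => [|x s IH] z /= => [->|[w [j [/IH[v hv e] /h[v' hv' e'] ->]]]].
  by exists 0; rewrite ?mulr0.
exists (v + x * v'); first by exists v, v'.
by rewrite !mulrDr e mulrCA e'; ring.
Qed.

Lemma seqm_in_max J s : is_ideal J -> (forall x, x \in s -> m x) -> seqm J s `<=` m.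
Proof.
move=> hJ h; apply: seqm_min => [|x j /h ? _]; first exact: local_ideal.
exact: idealMr local_ideal _.
Qed.

(** The delicate point is that [y] is regular on J/(s)J. Its kernel K there satisfies K = xK,
    because [y] is regular modulo [x] and [x] is regular; Nakayama's lemma gives K = 0. *)
Lemma regseq_swap J x y s : is_ideal J -> m x -> regseq J (y :: x :: s) ->
  regseq J (x :: y :: s).
Proof.
move=> hJ mx /= [ry [rx rs]]; have hW := seqm_ideal s hJ.
have ry' z : J z -> seqm J s (y * z) -> seqm J s z.
  pose K := J `&` [set z | seqm J s (y * z)].
  have hK : is_ideal K.
    apply: ideal_setI => //; split=> [|a b|r a] /=.
    - by rewrite mulr0; exact: ideal0.
    - by rewrite mulrDr; exact: idealD.
    - by rewrite mulrCA; exact: idealM.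
  move=> hz hyz; apply: (nakayama hN hm hW hK); last by split.
  move=> {hz hyz}z [Jz hyz]; have [|w [j [hw hj e]]] := ry z Jz.
    by exists (y * z), 0; rewrite mulr0 addr0; split=> //; exact: ideal0.
  exists w, x, j; split=> //; split=> //=; apply: rx; first exact: idealM.
  have -> : x * (y * j) = y * z - y * w by rewrite e; ring.
  by apply: idealB => //; exact: idealM.
split=> [z Jz|]; last by split.
move=> [w [j [hw hj e]]].
have [|w' [j' [hw' hj' e']]] := ry j hj.
  exists (- w), z; split=> //; first exact: idealN.
  by rewrite e; ring.
exists (z - y * j'), j'; split=> //; last by ring.
apply: rx; first by apply: idealB => //; exact: idealM.
have -> : x * (z - y * j') = w + y * w' by rewrite mulrBr e e'; ring.
by apply: idealD => //; exact: idealM.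
Qed.

Lemma regseq_front J x s t : is_ideal J -> (forall y, y \in s ++ x :: t -> m y) ->
  regseq J (s ++ x :: t) -> regseq J (x :: s ++ t).
Proof.
move=> hJ; elim: s => // y s IH hms [hy rs].
have {}IH := IH (fun z zs => hms z (mem_behead (s := y :: _) zs)) rs.
apply: regseq_swap => //; first by apply: hms; rewrite inE mem_cat inE eqxx !orbT.
split=> // z Jz; rewrite -(@seqm_perm J (s ++ x :: t)) //; first exact: hy.
by rewrite -cat1s -(cat1s x (s ++ t)) perm_catCA.
Qed.

Lemma regseq_perm J s t : is_ideal J -> (forall y, y \in s -> m y) -> perm_eq s t ->
  regseq J s -> regseq J t.
Proof.
move=> hJ hs st rs; suff : (forall y, y \in t -> m y) -> regseq J t.
  by apply=> y; rewrite -(perm_mem st); exact: hs.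
have {hs rs} : (forall y, y \in s -> m y) -> regseq J s by [].
move: st; apply: (@catCA_perm_ind _ (fun s => (forall y, y \in s -> m y) -> regseq J s)).
move=> s1 s2 s3.
elim: s2 => // x s2 IH h hms.
have hms' y : y \in s1 ++ (x :: s2) ++ s3 -> m y.
  move=> hy; apply: hms; move: hy; rewrite /= !(inE, mem_cat).
  by case: (y \in s1); rewrite ?orbT.
have E : seqm J (s2 ++ s1 ++ s3) = seqm J (s1 ++ s2 ++ s3).
  by apply: seqm_perm => //; rewrite perm_catCA.
have [hx rs] := @regseq_front J x s1 (s2 ++ s3) hJ hms' (h hms').
split; first by move=> z Jz; rewrite -!/(cat _ _) E; exact: hx.
by apply: IH => // y ys; apply: hms; rewrite inE ys orbT.
Qed.

Lemma regseq_catr J s t : regseq J (s ++ t) -> regseq J t.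
Proof. by elim: s => //= x s IH [_]. Qed.

Lemma regular_expr J s x n : is_ideal J ->
  (forall z, J z -> seqm J s (x * z) -> seqm J s z) ->
  forall z, J z -> seqm J s (x ^+ n * z) -> seqm J s z.
Proof.
move=> hJ h; elim: n => [|n IH] z Jz; first by rewrite mul1r.
by rewrite exprS -mulrA => /(h _ (idealM _ hJ Jz)); exact: IH.
Qed.

(** At the head an entry may be replaced by a power at no cost, and permutability moves it there and
    back. *)
Lemma regseq_expr J s x t n : is_ideal J -> (forall y, y \in s ++ x :: t -> m y) ->
  regseq J (s ++ x :: t) -> regseq J (s ++ x ^+ n.+1 :: t).
Proof.
move=> hJ hms rs; have [hx rt] := regseq_front hJ hms rs.
have rx : regseq J (x ^+ n.+1 :: s ++ t) by split=> //; exact: regular_expr.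
apply: regseq_perm rx => //; last by rewrite -cat1s perm_catCA.
move=> y; rewrite inE => /orP[/eqP->|ys].
  by apply: idealX; [exact: local_ideal|apply: hms; rewrite mem_cat inE eqxx orbT].
by apply: hms; move: ys; rewrite !mem_cat inE => /orP[->//|->]; rewrite !orbT.
Qed.

Lemma regseq_map_expr J s t n : is_ideal J -> (forall y, y \in s ++ t -> m y) ->
  regseq J (s ++ t) -> regseq J (s ++ map (fun x => x ^+ n.+1) t).
Proof.
move=> hJ; elim: t s => // x t IH s hms rs.
rewrite map_cons -cat_rcons; apply: IH; rewrite cat_rcons; last exact: regseq_expr.
move=> y; rewrite mem_cat inE => /or3P[ys|/eqP->|yt].
- by apply: hms; rewrite mem_cat ys.
- by apply: idealX; [exact: local_ideal|apply: hms; rewrite mem_cat inE eqxx orbT].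
- by apply: hms; rewrite mem_cat inE yt !orbT.
Qed.

(* The maximal members of the family {(W : v) | v in J \ W} are prime, and finitely many. *)
Lemma zero_divisors_primes J W : is_ideal W -> is_ideal J -> exists Ps : seq (set R),
  (forall P, P \in Ps -> is_prime P /\ exists v, [/\ J v, ~ W v & P = ideal_colon W v]) /\
  (forall r v, J v -> ~ W v -> W (r * v) -> exists2 P, P \in Ps & P r).
Proof.
move=> hW hJ.
pose top v := [/\ J v, ~ W v & forall v', J v' -> ~ W v' ->
  ideal_colon W v `<=` ideal_colon W v' -> ideal_colon W v' `<=` ideal_colon W v].
have top_prime v : top v -> is_prime (ideal_colon W v).
  move=> [Jv nWv vmax]; have hC := ideal_colon_ideal v hW; split=> //.
    move=> e; apply: nWv; have : ideal_colon W v 1 by rewrite e.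
    by rewrite /ideal_colon /= mul1r.
  move=> x y; rewrite /ideal_colon /= => h.
  have [|n] := pselect (W (y * v)); first by right.
  left; apply: (vmax (y * v)) => //; rewrite ?/ideal_colon /=.
  - exact: idealM.
  - by move=> r /= hr; rewrite mulrCA; exact: idealM.
  - by rewrite mulrA.
(* The ideal generated by all [v] with (W : v) maximal is generated by finitely many of them. *)
have [Ps hPs] : exists vs : seq R, (forall v, v \in vs -> top v) /\
    (forall v, top v -> ideal_gen [set` vs] v).
  pose F := [set V | exists vs : seq R, (forall v, v \in vs -> top v) /\
    V = ideal_gen [set` vs]].
  have [||_ [vs [hvs ->]] Vmax] := @noetherian_max R F hN.
  - by move=> _ [vs [_ ->]]; exact: ideal_gen_ideal.
  - by exists (ideal_gen [set` [::]]), [::].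
  exists vs; split=> // v hv; apply: (Vmax (ideal_gen [set` v :: vs])).
  - by exists (v :: vs); split=> // w; rewrite inE => /orP[/eqP->|/hvs].
  - apply: ideal_gen_min; first exact: ideal_gen_ideal.
    by move=> w /= ws; apply: sub_ideal_gen; rewrite /= inE ws orbT.
  - by apply: sub_ideal_gen; rewrite /= inE eqxx.
have exists_top r v : J v -> ~ W v -> W (r * v) -> exists2 v, top v & W (r * v).
  move=> Jv nWv hrv.
  have [||_ [v' [J' n' c' ->]] Vmax] := @noetherian_max R [set V | exists v',
     [/\ J v', ~ W v', W (r * v') & V = ideal_colon W v']] hN.
  - by move=> _ [? [_ _ _ ->]]; exact: ideal_colon_ideal.
  - by exists (ideal_colon W v), v.
  exists v' => //; split=> // w Jw nw vw; apply: Vmax => //.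
  by exists w; split=> //; exact: vw.
exists [seq ideal_colon W v | v <- Ps]; split=> [P|r v Jv nWv hrv].
  move=> /mapP[v /(proj1 hPs) hv ->]; split; first exact: top_prime.
  by exists v; case: hv.
have [{Jv nWv hrv}v vtop hrv] := exists_top _ _ Jv nWv hrv.
suff [w wPs hw] : exists2 w, w \in Ps & ideal_colon W w `<=` ideal_colon W v.
  exists (ideal_colon W w); first by apply/mapP; exists w.
  have [/(_ w wPs) [_ _ wmax] _] := hPs.
  by case: vtop => Jv nWv _; apply: (wmax v).
(* Otherwise each (W : w) has an element outside the prime (W : v). The product [c] of these
   elements is outside (W : v), yet it sends all generators into [W], hence also [v]. *)
apply: contrapT => h.
have [c hc] : exists c : R, ~ ideal_colon W v c /\ forall w, w \in Ps -> W (c * w).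
  move: h; move: (Ps) => l; elim: l => [|w l IH] h.
    by exists 1; split=> //; exact: prime_notin1 (top_prime _ vtop).
  have [|c [nc hc]] := IH; first by move=> [u ul hu]; apply: h; exists u; rewrite ?inE ?ul ?orbT.
  have [c' [hc' nc']] : exists c', ideal_colon W w c' /\ ~ ideal_colon W v c'.
    apply: contrapT => h'; apply: h; exists w; rewrite ?inE ?eqxx // => c' hc'.
    by apply: contrapT => nc'; apply: h'; exists c'.
  exists (c * c'); split; first exact: prime_mulN (top_prime _ vtop) nc nc'.
  move=> u; rewrite inE => /orP[/eqP->|/hc hu].
    by rewrite -mulrA; exact: idealM.
  by rewrite mulrAC; exact: idealMr.
have [nc hc'] := hc; apply: nc.
have : ideal_gen [set` Ps] v by apply: (proj2 hPs).
suff : ideal_gen [set` Ps] `<=` [set w | W (c * w)] by apply.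
apply: ideal_gen_min => //; split=> [|a b|r' a] /=.
- by rewrite mulr0; exact: ideal0.
- by rewrite mulrDr; exact: idealD.
- by rewrite mulrCA; exact: idealM.
Qed.

Lemma prime_avoidance I (Ps : seq (set R)) : is_ideal I ->
  (forall P, P \in Ps -> is_prime P) -> (forall P, P \in Ps -> ~ (I `<=` P)) ->
  exists2 x, I x & forall P, P \in Ps -> ~ P x.
Proof.
move=> hI; have [n] := ubnP (size Ps); elim: n Ps => // n IH [|P Ps] /=.
  by move=> _ _ _; exists 0; [exact: ideal0|].
rewrite ltnS => sPs hP IP.
have [[Q QPs QP]|h] := pselect (exists2 Q, Q \in Ps & Q `<=` P).
  have sz : (size (P :: rem Q Ps) < n)%N.
    by rewrite /= size_rem // prednK //; case: (Ps) QPs.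
  have hin P' : P' \in P :: rem Q Ps -> P' \in P :: Ps.
    by rewrite !inE => /orP[->//|/mem_rem->]; rewrite orbT.
  have [x Ix hx] := IH _ sz (fun P' h => hP _ (hin _ h)) (fun P' h => IP _ (hin _ h)).
  exists x => // P'; rewrite inE => /orP[/eqP->|P'Ps]; first by apply: hx; rewrite inE eqxx.
  have [->|/eqP nPQ] := eqVneq P' Q; first by move/QP; apply: hx; rewrite inE eqxx.
  apply: hx; rewrite inE; apply/orP; right.
  by move: P'Ps; rewrite (perm_mem (perm_to_rem QPs)) inE => /orP[/eqP|].
have [x Ix hx] : exists2 x, I x & forall P, P \in Ps -> ~ P x.
  apply: IH => //.
  - by move=> Q QPs; apply: hP; rewrite inE QPs orbT.
  - by move=> Q QPs; apply: IP; rewrite inE QPs orbT.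
have PP : is_prime P by apply: hP; rewrite inE eqxx.
have [Px|nPx] := pselect (P x); last first.
  by exists x => // Q; rewrite inE => /orP[/eqP->//|]; exact: hx.
have [a Ia nPa] : exists2 a, I a & ~ P a.
  apply: contrapT => h'; apply: (IP P); rewrite ?inE ?eqxx // => a Ia.
  by apply: contrapT => h''; apply: h'; exists a.
(* [y] lies in every prime of the list but [P], so adding [a * y] repairs [x] at [P] and changes
   nothing at the others. *)
have [y ny hy] : exists2 y, ~ P y & forall Q, Q \in Ps -> Q y.
  have : forall Q, Q \in Ps -> is_prime Q by move=> Q QPs; apply: hP; rewrite inE QPs orbT.
  elim: (Ps) h => [|Q l IHl] h hl; first by exists 1 => //; exact: prime_notin1.
  have [||y ny hy] := IHl.
  - by move=> [Q' Q'l Q'P]; apply: h; exists Q'; rewrite ?inE ?Q'l ?orbT.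
  - by move=> Q' Q'l; apply: hl; rewrite inE Q'l orbT.
  have [b Qb nPb] : exists2 b, Q b & ~ P b.
    apply: contrapT => h'; apply: h; exists Q; rewrite ?inE ?eqxx // => b Qb.
    by apply: contrapT => h''; apply: h'; exists b.
  exists (y * b) => [|Q']; first exact: prime_mulN.
  rewrite inE => /orP[/eqP->|Q'l].
    by apply: idealM => //; apply/prime_ideal/hl; rewrite inE eqxx.
  by apply: idealMr (hy _ Q'l); apply/prime_ideal/hl; rewrite inE Q'l orbT.
exists (x + a * y) => [|Q]; first by apply: idealD => //; exact: idealMr.
rewrite inE => /orP[/eqP->|QPs] hh.
  apply: (prime_mulN PP nPa ny).
  have -> : a * y = x + a * y - x by ring.
  by apply: idealB => //; exact: prime_ideal.
have hQ : is_ideal Q by apply/prime_ideal/hP; rewrite inE QPs orbT.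
apply: (hx Q QPs); rewrite -(addrK (a * y) x); apply: idealB => //.
by apply: idealM => //; exact: hy.
Qed.

End RegularSequences.

(** * Exchange of regular sequences, depth and dimension *)

Section Depth.
Variables (R : comNzRingType) (m : set R).
Hypotheses (hN : noetherian R) (hm : is_local m).
Implicit Types (I J K P W V A : set R) (x y z r : R) (s t u : seq R).

Definition socle_elt J W v := [/\ J v, ~ W v & forall y, m y -> W (y * v)].

Lemma exists_regular J I (Ws : seq (set R)) : is_ideal J -> is_ideal I ->
  (forall W, W \in Ws -> is_ideal W) ->
  (forall W v, W \in Ws -> J v -> ~ W v -> is_prime (ideal_colon W v) ->
     ~ (I `<=` ideal_colon W v)) ->
  exists2 x, I x & forall W z, W \in Ws -> J z -> W (x * z) -> W z.
Proof.
move=> hJ hI hWs hI'.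
have [Ps [hPs hz]] : exists Ps : seq (set R),
    (forall P, P \in Ps -> is_prime P /\ ~ (I `<=` P)) /\
    (forall W r v, W \in Ws -> J v -> ~ W v -> W (r * v) -> exists2 P, P \in Ps & P r).
  elim: Ws hWs hI' => [|W Ws IH] hWs hI'; first by exists [::].
  have [||Ps [hPs hz]] := IH.
  - by move=> V hV; apply: hWs; rewrite inE hV orbT.
  - by move=> V v hV; apply: hI'; rewrite inE hV orbT.
  have [|Qs [hQs hz']] := zero_divisors_primes hN (hWs W _) hJ; first by rewrite inE eqxx.
  exists (Ps ++ Qs); split=> [P|V r v].
    rewrite mem_cat => /orP[/hPs//|/hQs[hP [v [Jv nv e]]]]; split=> //.
    by rewrite e; apply: hI'; rewrite ?inE ?eqxx // -e.
  rewrite inE => /orP[/eqP->|hV] Jv nv hrv.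
    by have [P hP Pr] := hz' _ _ Jv nv hrv; exists P => //; rewrite mem_cat hP orbT.
  by have [P hP Pr] := hz _ _ _ hV Jv nv hrv; exists P => //; rewrite mem_cat hP.
have [x Ix hx] := prime_avoidance hI (fun P h => (hPs P h).1) (fun P h => (hPs P h).2).
exists x => // W z hW Jz hxz; apply: contrapT => nz.
by have [P /hx] := hz _ _ _ hW Jz nz hxz.
Qed.

(* [v] corresponds to [v'] when [z v = x v'] modulo [(s)J]. *)
Lemma socle_exchange J s x z : is_ideal J -> m z ->
  regseq J (x :: s) -> regseq J (z :: s) ->
  (exists v, socle_elt J (seqm J (x :: s)) v) -> exists v, socle_elt J (seqm J (z :: s)) v.
Proof.
move=> hJ mz [hx hs] [hz _] [v [Jv nv hv]]; have hW := seqm_ideal s hJ.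
have [w [v' [hw Jv' e]]] := hv _ mz.
exists v'; split=> // [[w2 [u [hw2 Ju e2]]]|y my].
  apply: nv; exists (v - x * u), u; split=> //; last by ring.
  apply: hz; first by apply: idealB => //; exact: idealM.
  have -> : z * (v - x * u) = w + x * w2 by rewrite mulrBr e e2; ring.
  by apply: idealD => //; exact: idealM.
have [w1 [v1 [hw1 Jv1 e1]]] := hv _ my.
exists (y * v' - z * v1), v1; split=> //; last by ring.
apply: hx; first by apply: idealB => //; exact: idealM.
have -> : x * (y * v' - z * v1) = z * w1 - y * w.
  have : y * (z * v) = z * (y * v) by ring.
  by rewrite e e1 => h; have -> : x * (y * v' - z * v1) =
    y * (w + x * v') - z * (w1 + x * v1) + z * w1 - y * w by [ring]; rewrite h; ring.
by apply: idealB => //; exact: idealM.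
Qed.

Lemma regular_no_socle J s x : m x -> regseq J (x :: s) ->
  forall v, ~ socle_elt J (seqm J s) v.
Proof. by move=> mx [hx _] v [Jv nv hv]; apply/nv/hx => //; exact: hv. Qed.

(** Whether J/(s)J has a socle depends only on the length of [s]. One [w], regular modulo both
    tails, replaces [x] and [z]; moved behind the tails it is a common entry, and the lists get
    shorter. If no such [w] existed, m would annihilate some [v] modulo one of the tails, against
    the regularity of [x] or [z]. *)
Lemma socle_transfer J s t u : is_ideal J -> size s = size t ->
  (forall y, y \in s ++ u -> m y) -> (forall y, y \in t ++ u -> m y) ->
  regseq J (s ++ u) -> regseq J (t ++ u) ->
  (exists v, socle_elt J (seqm J (s ++ u)) v) -> exists v, socle_elt J (seqm J (t ++ u)) v.
Proof.
move=> hJ; elim: s t u => [|x s IH] [|z t] u //= [st] hsm htm rs rt hv.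
have mx : m x by apply: hsm; rewrite inE eqxx.
have mz : m z by apply: htm; rewrite inE eqxx.
have [w mw hw] : exists2 w, m w & forall W z, W \in [:: seqm J (s ++ u); seqm J (t ++ u)] ->
    J z -> W (w * z) -> W z.
  apply: exists_regular => // [||W v].
  - exact: local_ideal.
  - by move=> W; rewrite !inE => /orP[] /eqP->; exact: seqm_ideal.
  rewrite !inE => /orP[] /eqP-> Jv nv hP h.
  - by apply: (@regular_no_socle _ _ _ mx rs v).
  - by apply: (@regular_no_socle _ _ _ mz rt v).
have rws : regseq J (w :: s ++ u).
  by split; [move=> z' Jz; apply: hw; rewrite ?inE ?eqxx|case: rs].
have rwt : regseq J (w :: t ++ u).
  by split; [move=> z' Jz; apply: hw; rewrite ?inE ?eqxx ?orbT|case: rt].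
have pm l : perm_eq (w :: l ++ u) (l ++ w :: u) by rewrite -cat1s -[w :: u]cat1s perm_catCA.
have hwm l : (forall y, y \in l ++ u -> m y) -> forall y, y \in w :: l ++ u -> m y.
  by move=> h y; rewrite inE => /orP[/eqP->|/h].
have hws := hwm s (fun y h => hsm y (mem_behead (s := x :: _) h)).
have hwt := hwm t (fun y h => htm y (mem_behead (s := z :: _) h)).
apply: (@socle_exchange _ _ w) => //.
rewrite (seqm_perm hJ (pm t)); apply: (IH _ _ st).
- by move=> y; rewrite -(perm_mem (pm s)); exact: hws.
- by move=> y; rewrite -(perm_mem (pm t)); exact: hwt.
- exact: regseq_perm hN hm _ _ _ hJ hws (pm s) rws.
- exact: regseq_perm hN hm _ _ _ hJ hwt (pm t) rwt.
by rewrite -(seqm_perm hJ (pm s)); exact: socle_exchange hv.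
Qed.

(** The socle would be transferred to the end segment of [t] of the same length; the entry of [t]
    just before this segment is regular modulo it. *)
Lemma short_no_socle J s t : is_ideal J ->
  (forall y, y \in s -> m y) -> (forall y, y \in t -> m y) ->
  regseq J s -> regseq J t -> (size s < size t)%N ->
  forall v, ~ socle_elt J (seqm J s) v.
Proof.
move=> hJ hs ht rs rt sz v hv.
pose k := (size t - (size s).+1)%N.
have tE : t = take k t ++ drop k t by rewrite cat_take_drop.
have : size (drop k t) = (size s).+1 by rewrite size_drop /k subKn.
move: tE; case: (drop k t) => // z t2 tE [st2].
have htm y : y \in z :: t2 -> m y.
  by move=> yt; apply: ht; rewrite tE mem_cat yt orbT.
have rt2 : regseq J (z :: t2) by move: rt; rewrite tE => /regseq_catr.
have [||||||w hw] := @socle_transfer J s t2 [::] hJ; rewrite ?cats0 //.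
- by move=> y yt; apply: htm; rewrite inE yt orbT.
- by case: rt2.
- by exists v.
- by apply: (@regular_no_socle J t2 z _ rt2 w); [apply: htm; rewrite inE eqxx|rewrite -[t2]cats0].
Qed.

Lemma regseq_extend J s t : is_ideal J ->
  (forall y, y \in s -> m y) -> (forall y, y \in t -> m y) ->
  regseq J s -> regseq J t -> (size s <= size t)%N ->
  exists u, [/\ regseq J (u ++ s), size (u ++ s) = size t & forall y, y \in u ++ s -> m y].
Proof.
move=> hJ; move dk : (size t - size s)%N => k.
elim: k s dk => [|k IH] s dk hs ht rs rt sz.
  by exists [::]; split=> //=; apply/eqP; rewrite eqn_leq sz -subn_eq0 dk.
have [x mx hx] : exists2 x, m x & forall W z, W \in [:: seqm J s] -> J z -> W (x * z) -> W z.
  apply: exists_regular => // [||W v].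
  - exact: local_ideal.
  - by move=> W; rewrite inE => /eqP->; exact: seqm_ideal.
  rewrite inE => /eqP-> Jv nv hP h; apply: (@short_no_socle J s t _ _ _ _ _ _ v) => //.
  by rewrite -subn_gt0 dk.
have [u [ru su hu]] : exists u, [/\ regseq J (u ++ x :: s), size (u ++ x :: s) = size t
    & forall y, y \in u ++ x :: s -> m y].
  apply: IH => //; first by rewrite /= subnS dk.
  - by move=> y; rewrite inE => /orP[/eqP->|/hs].
  - by split=> // z Jz; apply: hx; rewrite ?inE.
  - by rewrite /= -subn_gt0 dk.
by exists (rcons u x); rewrite cat_rcons.
Qed.

Lemma ideal_pow_sub_add K a b : is_ideal K ->
  (forall x y, ideal_pow m a x -> ideal_pow m b y -> K (x * y)) ->
  ideal_pow m (a + b) `<=` K.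
Proof.
elim: a K => [|a IH] K hK h.
  by move=> y hy; rewrite -(mul1r y); exact: h.
apply: ideal_mul_sub => // x y mx; apply: (IH [set y | K (x * y)]).
  split=> [|u v|u v] /=; first by rewrite mulr0; exact: ideal0.
    by rewrite mulrDr; exact: idealD.
  by rewrite mulrCA; exact: idealM.
by move=> u v hu hv /=; rewrite mulrA; apply: h => //; exact: ideal_mul_mem.
Qed.

(** Noetherian induction replaces a choice of generators of m. In a maximal counterexample [V], some
    [x] of m outside [V] multiplies some [y] outside [V] into [V]. Powers of m lie in V + Ry and in
    (V : y), hence a power of m lies in [V]. *)
Lemma ideal_pow_sub I : is_ideal I -> (forall x, m x -> exists n, I (x ^+ n)) ->
  exists n, ideal_pow m n `<=` I.
Proof.
move=> hI hx; apply: contrapT => hno.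
have [||V [hV IV nV] Vmax] := @noetherian_max R
    [set V | [/\ is_ideal V, I `<=` V & ~ exists n, ideal_pow m n `<=` V]] hN.
- by move=> ? [].
- by exists I; split.
have bigger V' v : is_ideal V' -> V `<=` V' -> V' v -> ~ V v ->
    exists n, ideal_pow m n `<=` V'.
  move=> hV' VV' V'v nv; apply: contrapT => n; apply: nv.
  by apply: (Vmax V') => //; split=> // x /IV /VV'.
have [mV|/existsNP[x /not_implyP[mx nVx]]] := pselect (m `<=` V).
  by apply: nV; exists 1%N; apply: ideal_mul_sub => // x y /mV hx' _; exact: idealMr.
have [n hn] := hx _ mx.
have [y [Vxy nVy]] : exists y, V (x * y) /\ ~ V y.
  have {hn} : V (x ^+ n) by apply: IV.
  elim: n => [h|n IH]; first by case: nVx; rewrite -(mulr1 x); exact: idealM.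
  by rewrite exprS => h; have [/IH//|ny] := pselect (V (x ^+ n)); exists (x ^+ n).
have [a ha] := bigger (add_ideal V y) y (add_ideal_ideal y hV)
  (@add_ideal_sub _ V y) (add_ideal_mem y hV) nVy.
have [b hb] : exists n, ideal_pow m n `<=` ideal_colon V y.
  apply: (bigger _ x) => //; first exact: ideal_colon_ideal.
  by move=> z hz; rewrite /ideal_colon /=; exact: idealMr.
apply: nV; exists (b + a)%N; apply: ideal_pow_sub_add => // u v /hb hu /ha [w [r [hw ->]]].
rewrite mulrDr; apply: idealD => //; first exact: idealM.
by rewrite mulrCA; exact: idealM.
Qed.

(** Each entry lengthens the chain by one: [x] is outside every prime minimal over the tail, because
    an element of such a prime has a power that is a zero divisor modulo the tail. *)
Lemma regular_prime_chain s Q : regseq setT s -> is_prime Q -> seqm setT s `<=` Q ->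
  exists2 c, prime_chain (size s) c & c (size s) `<=` Q.
Proof.
elim: s Q => [|x s IH] Q /=; first by move=> _ hQ _; exists (fun=> Q).
move=> [hx rs] hQ sQ; have hW := seqm_ideal s (@ideal_setT R).
have sQ' : seqm setT s `<=` Q by move=> z /(@seqm_tail R setT x _ (@ideal_setT R)); exact: sQ.
have [P [hP sP PQ Pmin]] := exists_minimal_prime_over hW hQ sQ'.
have nPx : ~ P x.
  move=> Px; have [r [n [nr hr]]] := minimal_prime_over_nil hN hW hP Pmin Px.
  apply/nr/sP; rewrite mulrC in hr.
  exact: regular_expr hr.
have Qx : Q x.
  by apply: sQ; exists 0, 1; rewrite mulr1 add0r; split=> //; exact: ideal0.
have [c [hc1 hc2] cP] := IH P rs hP sP.
exists (fun i => if (i <= size s)%N then c i else Q); last by rewrite ltnn.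
split=> i hi.
  by case: ifP => h; [exact: hc1|].
rewrite -ltnS hi; case: ifP => h; first by apply: hc2; rewrite -ltnS.
have -> : i = size s by apply/eqP; rewrite eqn_leq -ltnS hi leqNgt h.
split; first by move=> z /cP /PQ.
by move/(_ x Qx)/cP.
Qed.

(** A prime over [I] different from m would end a chain of length [d], which m would prolong. *)
Lemma regular_primary s d I : has_krull_dim R d -> regseq setT s -> size s = d ->
  is_ideal I -> seqm setT s `<=` I -> exists n, ideal_pow m n `<=` I.
Proof.
move=> [_ hd] rs sz hI sI; apply: ideal_pow_sub => // x mx; apply: contrapT => h.
have [|||Q [hQ IQ xQ]] := @prime_avoiding R hN I [set y | exists n, y = x ^+ n] hI.
- by exists 0%N.
- by move=> _ _ [a ->] [b ->]; exists (a + b)%N; rewrite exprD.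
- by move=> _ [n ->] hn; apply: h; exists n.
have nQx : ~ Q x by apply: xQ; exists 1%N.
have [c [hc1 hc2] cQ] := regular_prime_chain rs hQ (fun z h => IQ _ (sI _ h)).
have Qm : Q `<=` m by apply: local_proper => //; [exact: prime_ideal|case: hQ].
suff /hd : prime_chain d.+1 (fun i => if (i <= d)%N then c i else m) by rewrite ltnn.
rewrite sz in hc1 hc2 cQ; split=> i hi.
  by case: ifP => h'; [exact: hc1|exact: local_prime].
rewrite -ltnS hi; case: ifP => h'; first by apply: hc2; rewrite -ltnS.
have -> : i = d by apply/eqP; rewrite eqn_leq -ltnS hi leqNgt h'.
split; first by move=> z /cQ /Qm.
by move/(_ x mx)/cQ.
Qed.

End Depth.

(** * Strong F-regularity *)

Section StronglyFRegular.
Variables (R : comNzRingType) (m : set R) (p : nat) (charRp : p \in [pchar R]).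
Hypotheses (hN : noetherian R) (hm : is_local m).
Implicit Types (I J K P W V A : set R) (a w x y z r c : R) (s t u : seq R) (e : nat).

Lemma pchar_prime_gt1 : (1 < p)%N.
Proof. exact: prime_gt1 (pcharf_prime charRp). Qed.

Lemma pexp_gt0 e : (0 < p ^ e)%N.
Proof. by rewrite expn_gt0 ltnW ?pchar_prime_gt1. Qed.

Lemma exprD_pchar e x y : (x + y) ^+ (p ^ e) = x ^+ (p ^ e) + y ^+ (p ^ e).
Proof. exact: (raddfD (frob e charRp)). Qed.

Lemma exprB_pchar e x y : (x - y) ^+ (p ^ e) = x ^+ (p ^ e) - y ^+ (p ^ e).
Proof. exact: (raddfB (frob e charRp)). Qed.

Lemma expr_sum_pchar e (T : Type) (l : seq T) (Q : pred T) (F : T -> R) :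
  (\sum_(i <- l | Q i) F i) ^+ (p ^ e) = \sum_(i <- l | Q i) F i ^+ (p ^ e).
Proof. exact: (raddf_sum (frob e charRp)). Qed.

Lemma expr0_pexp e : (0 : R) ^+ (p ^ e) = 0.
Proof. by rewrite expr0n gtn_eqF ?pexp_gt0. Qed.

Lemma ideal_expr_pexp I x e : is_ideal I -> I x -> I (x ^+ (p ^ e)).
Proof. by move=> hI hx; rewrite -(prednK (pexp_gt0 e)); exact: idealX. Qed.

(** A splitting of R -> R^(1/q), 1 |-> c^(1/q), read on the carrier R. *)
Definition splitting e c (g : R -> R) :=
  [/\ forall x y, g (x + y) = g x + g y, forall r x, g (r ^+ (p ^ e) * x) = r * g x & g c = 1].

Lemma root_splitsP c e : root_splits charRp c e -> exists g, splitting e c g.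
Proof.
case=> g hg; exists (fun x => g (x : root_mod charRp e)); split.
- by move=> x y; exact: (raddfD g).
- by move=> r x; exact: (linearZ_LR g r (x : root_mod charRp e)).
- have := hg 1; rewrite scale1r; exact.
Qed.

Lemma splitting0 e c g : splitting e c g -> g 0 = 0.
Proof. by case=> gD _ _; have := gD 0 0; rewrite addr0 -{1}(addr0 (g 0)) => /addrI. Qed.

Lemma splitting_bracket e c g I r : splitting e c g -> is_ideal I ->
  ideal_bracket I (p ^ e) (c * r ^+ (p ^ e)) -> I r.
Proof.
move=> hg hI h; have [gD gM gc] := hg.
(* The multiplier [a] makes the right-hand side an ideal. *)
suff : ideal_bracket I (p ^ e) `<=` [set z | forall a, I (g (a * z))].
  by move=> /(_ _ h) /(_ 1); rewrite mul1r mulrC gM gc mulr1.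
apply: ideal_gen_min; last first.
  by move=> _ [x hx <-] a; rewrite mulrC gM mulrC; exact: idealM.
split=> [a|x y hx hy a|a x hx b].
- by rewrite mulr0 (splitting0 hg); exact: ideal0.
- by rewrite mulrDr gD; exact: idealD hI (hx a) (hy a).
- by rewrite mulrA; exact: hx.
Qed.

Hypothesis hF : strongly_F_regular charRp.

(* If [x y = 0], some nonzerodivisor [c = a + b] has [a b = 0], and a splitting [g] of [c] gives
   [b g(a) = a g(b) = 0] with [g(a) + g(b) = 1]. *)
Lemma F_regular_domain x y : x * y = 0 -> x = 0 \/ y = 0.
Proof.
move=> xy0; apply: contrapT => /not_orP[nx ny].
case: hF => _ hred hc.
have h0 := ideal_set0 R.
pose C := add_ideal (ideal_colon [set 0] x) x.
have hC : is_ideal C by apply: add_ideal_ideal; exact: ideal_colon_ideal.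
(* [C] lies in no annihilator of a nonzero [v]: if [C] kills [v], then x v = 0, so [v] is itself in
   [C] and v^2 = 0, against reducedness. *)
have [|W v|c [b [r [b0 cE]]] creg] := @exists_regular R hN setT C [:: [set 0]] (@ideal_setT R) hC.
- by move=> W; rewrite inE => /eqP->.
- rewrite inE => /eqP-> _ nv hP Cv.
  have xv : x * v = 0 by apply: Cv; apply: add_ideal_mem; exact: ideal_colon_ideal.
  apply/nv/(hred v 2); rewrite expr2; apply: Cv; apply: add_ideal_sub.
  by rewrite /ideal_colon /= mulrC.
have {}creg z : c * z = 0 -> z = 0.
  by move=> cz; apply: (creg [set 0]) => //; rewrite ?inE.
have bx : b * x = 0 by [].
have [|e /root_splitsP[g hg]] := hc c.
  move=> P [hP Pmin] Pc; have [|s [n [ns hs]]] := minimal_prime_over_nil hN h0 hP _ Pc.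
    by move=> P' hP' _ P'P; exact: Pmin.
  apply: ns; suff -> : s = 0 by exact: ideal0 (prime_ideal hP).
  elim: n hs => [|n IH]; first by rewrite /= mulr1.
  by rewrite /= exprS mulrCA => /creg.
have [gD gM gc] := hg; have g0 := splitting0 hg.
have q0 : (p ^ e)%N = (p ^ e).-1.+1 by rewrite prednK ?pexp_gt0.
have bga : b * g (r * x) = 0.
  by rewrite -gM q0 exprSr; have -> : b ^+ (p ^ e).-1 * b * (r * x) =
    b ^+ (p ^ e).-1 * r * (b * x) by [ring]; rewrite bx mulr0.
have agb : (r * x) * g b = 0.
  by rewrite -gM q0 exprSr; have -> : (r * x) ^+ (p ^ e).-1 * (r * x) * b =
    (r * x) ^+ (p ^ e).-1 * r * (b * x) by [ring]; rewrite bx mulr0.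
have g1 : g b + g (r * x) = 1 by rewrite -gD -cE.
have [mb|nb] := pselect (m (g b)); last first.
  have [u hu] := local_unit hN hm nb.
  have a0 : r * x = 0 by rewrite -(mulr1 (r * x)) -hu mulrCA agb mulr0.
  by apply/nx/creg; rewrite cE a0 addr0.
have [ma|na] := pselect (m (g (r * x))).
  apply: (ideal_proper (local_ideal hm) (local_notT hm)); rewrite -g1.
  exact: idealD (local_ideal hm) _ _.
have [u hu] := local_unit hN hm na.
have b00 : b = 0 by rewrite -(mulr1 b) -hu mulrCA bga mulr0.
by apply/ny/creg; rewrite cE b00 add0r -mulrA xy0 mulr0.
Qed.

Lemma domain_cancel a x y : a <> 0 -> a * x = a * y -> x = y.
Proof.
move=> na h; apply/eqP; rewrite -subr_eq0; apply/eqP.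
by have /F_regular_domain[] : a * (x - y) = 0 by rewrite mulrBr h subrr.
Qed.

Lemma domain_mul x y : x <> 0 -> y <> 0 -> x * y <> 0.
Proof. by move=> nx ny /F_regular_domain[]. Qed.

Lemma domain_exp x n : x <> 0 -> x ^+ n <> 0.
Proof.
move=> nx; elim: n => [|n IH]; last by rewrite exprS; exact: domain_mul.
by rewrite expr0 => /eqP; rewrite oner_eq0.
Qed.

Lemma domain_prod s : (forall x, x \in s -> x <> 0) -> \prod_(x <- s) x <> 0.
Proof.
elim: s => [_|x s IH h]; first by rewrite big_nil => /eqP; rewrite oner_eq0.
rewrite big_cons; apply: domain_mul; first by apply: h; rewrite inE eqxx.
by apply: IH => y ys; apply: h; rewrite inE ys orbT.
Qed.

Lemma prime_set0 : is_prime [set 0 : R].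
Proof.
split; [exact: ideal_set0| |by move=> x y /F_regular_domain].
move=> h; have : [set 0 : R] 1 by rewrite h.
by move/eqP; rewrite oner_eq0.
Qed.

Lemma F_regular_splitting c : c <> 0 -> exists e g, splitting e c g.
Proof.
move=> nc; case: hF => _ _ /(_ c)[|e /root_splitsP he]; last by exists e.
move=> P [hP Pmin] Pc; apply: nc; suff : [set 0 : R] c by [].
by rewrite (Pmin _ prime_set0) // => z ->; exact: ideal0 (prime_ideal hP).
Qed.

Lemma tight_closure I c r : is_ideal I -> c <> 0 ->
  (forall e, ideal_bracket I (p ^ e) (c * r ^+ (p ^ e))) -> I r.
Proof.
move=> hI nc h; have [e [g hg]] := F_regular_splitting nc.
exact: splitting_bracket hg hI (h e).
Qed.

(** With n = q the hypothesis puts c w^q in (a)^[q]. This is normality: a fraction w/a almost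
    integral over R lies in R. *)
Lemma F_regular_normal a w c : c <> 0 ->
  (forall n, principal (a ^+ n) (c * w ^+ n)) -> principal a w.
Proof.
move=> nc h; apply: (tight_closure (principal_ideal a) nc) => e.
have [r ->] := h (p ^ e)%N.
apply: (@idealM _ (ideal_bracket _ _)); first exact: ideal_bracket_ideal.
by apply: ideal_bracket_mem; exists 1; rewrite mul1r.
Qed.

(* R is normal, so [w P] is not contained in [a P] and [P] is locally generated by one element
   [q]; a prime [Q] strictly inside [P] then has [s^n Q] inside [q^n R] for all [n]. *)
Lemma associated_principal_height a w : a <> 0 ->
  is_prime (ideal_colon (principal a) w) -> has_height (ideal_colon (principal a) w) 1.
Proof.
move=> na; set P := ideal_colon _ w => hP.
have nw : ~ principal a w.
  by move=> h; apply: (prime_notin1 hP); rewrite /P /ideal_colon /= mul1r.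
have [q [s [Pq nPs qw]]] : exists q (s : R), [/\ P q, ~ P s & q * w = s * a].
  apply: contrapT => h; apply/nw/(@F_regular_normal a w a na) => n.
  have Pa z : P z -> exists2 z', P z' & z * w = z' * a.
    move=> Pz; have [z' e] := Pz; exists z' => //.
    by apply: contrapT => nz'; apply: h; exists z, z'.
  suff [z _ ->] : exists2 z, P z & a * w ^+ n = z * a ^+ n by exists z.
  elim: n => [|n [z Pz e]].
    by exists a; rewrite ?mulr1 //; exists w; rewrite mulrC.
  have [z' Pz' e'] := Pa _ Pz; exists z' => //.
  by rewrite exprSr mulrA e mulrAC e' exprS mulrA.
have hs z : P z -> principal q (z * s).
  move=> [t e]; exists t; apply: (domain_cancel na).
  by rewrite mulrCA (mulrC a) -qw mulrCA e; ring.
have nq : q <> 0.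
  move=> q0; apply: nPs; suff -> : s = 0 by exact: (ideal0 (prime_ideal hP)).
  by apply: (domain_cancel na); rewrite mulr0 mulrC -qw q0 mul0r.
have small Q : is_prime Q -> Q `<` P -> Q = [set 0].
  move=> hQ [QP nPQ]; apply/seteqP; split; last by move=> _ ->; exact: ideal0 (prime_ideal hQ).
  have nQs : ~ Q s by move/QP.
  have nQq : ~ Q q.
    move=> Qq; apply: nPQ => z /hs[t e]; have : Q (z * s).
      by rewrite e; apply: idealM => //; exact: prime_ideal.
    by case: hQ => _ _ /[apply] -[].
  move=> b Qb; apply: contrapT => nb; apply: nPs.
  have [t ->] : principal q s.
    apply: (@F_regular_normal q s b nb) => n.
    suff [t _ ->] : exists2 t, Q t & b * s ^+ n = t * q ^+ n by exists t.
    elim: n => [|n [t Qt e]]; first by exists b.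
    have [t' e'] := hs _ (QP _ Qt); exists t'.
      have : Q (t' * q) by rewrite -e'; apply: idealMr => //; exact: prime_ideal.
      by case: hQ => _ _ /[apply] -[].
    by rewrite exprSr mulrA e mulrAC e' exprS; ring.
  by apply: idealM => //; exact: prime_ideal.
split.
  exists (fun i => if i is 0 then [set 0] else P); split=> //; split=> [[|i] _|[|i] //= _] //.
    exact: prime_set0.
  split; first by move=> _ ->; exact: ideal0 (prime_ideal hP).
  by move/(_ q Pq).
move=> [|[|n]] // c [hc1 hc2] cP; exfalso.
have cn1 : c n.+1 = [set 0] by apply: small; rewrite -?cP; [exact: hc1|exact: hc2].
have cn0 : c n = [set 0].
  apply: small; first by apply: hc1; rewrite ltnW.
  have [h1 h2] := hc2 n (leqnSn _); have [h3 h4] := hc2 n.+1 (leqnn _).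
  by rewrite -cP; split; [move=> z /h1 /h3|move=> h; apply: h4 => z /h /h1].
by have [_] := hc2 n (leqnSn _); rewrite cn1 cn0; apply.
Qed.

(** The elements of (a : w) are zero divisors modulo [a]; by prime avoidance they all lie in one of
    finitely many associated primes, which have height one. *)
Lemma height_one_in_associated a w : a <> 0 -> ~ principal a w ->
  exists v, [/\ is_prime (ideal_colon (principal a) v),
    has_height (ideal_colon (principal a) v) 1
    & ideal_colon (principal a) w `<=` ideal_colon (principal a) v].
Proof.
move=> na nw; have hA := principal_ideal a.
have [Ps [hPs hz]] := zero_divisors_primes hN hA (@ideal_setT R).
apply: contrapT => hno.
have [|||x /= hx hxP] := @prime_avoidance R (ideal_colon (principal a) w) Ps.
- exact: ideal_colon_ideal.
- by move=> P /hPs[].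
- move=> P PPs wP; have [hP [v [_ _ e]]] := hPs _ PPs; apply: hno; exists v.
  by rewrite -e; split=> //; rewrite e; apply: associated_principal_height; rewrite -?e.
by have [P /hxP] := hz x w I nw hx.
Qed.

Lemma principal_height_one a w : a <> 0 ->
  (forall P, has_height P 1 -> exists r, ~ P r /\ principal a (r * w)) -> principal a w.
Proof.
move=> na h; apply: contrapT => nw.
have [v [_ /h[s [ns hs]] wv]] := height_one_in_associated na nw.
by apply/ns/wv.
Qed.

End StronglyFRegular.

(** * Cancellation of parameters up to a uniform multiplier *)

Section Cancellation.
Variables (R : comNzRingType) (m : set R) (p : nat) (charRp : p \in [pchar R]).
Hypotheses (hN : noetherian R) (hm : is_local m) (hF : strongly_F_regular charRp).
Implicit Types (I J K N P W V A : set R) (a b w x y z r c u : R) (s t us vs ys : seq R) (e : nat).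

Let hT := @ideal_setT R.

Lemma seqm_pexp J s w e : seqm J s w ->
  seqm (ideal_bracket J (p ^ e)) (map (fun x => x ^+ (p ^ e)) s) (w ^+ (p ^ e)).
Proof.
elim: s w => [|x s IH] w /= => [->|[v [j [/IH hv hj ->]]]]; first by rewrite (expr0_pexp charRp).
exists (v ^+ (p ^ e)), (j ^+ (p ^ e)); rewrite exprD_pchar // exprMn.
by split=> //; exact: ideal_bracket_mem.
Qed.

(* An element [c] of [J] turns a relation on [R] into one on [J], hence relations on [R] are
   trivial up to the factor [c], and tight closure removes it. *)
Lemma regseq_setT J s : is_ideal J -> (exists2 c, J c & c <> 0) ->
  (forall x, x \in s -> m x) -> regseq J s -> regseq setT s.
Proof.
move=> hJ [c Jc nc]; elim: s => // x s IH hs rs; split; last first.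
  by apply: IH => [y ys|]; [apply: hs; rewrite inE ys orbT|case: rs].
move=> z _ hxz; apply: (tight_closure hN hm hF (c := c)) => [|//|e]; first exact: seqm_ideal.
pose F := fun x : R => x ^+ (p ^ e).
have hrs : regseq J (map F (x :: s)).
  have := @regseq_map_expr R m hN hm J [::] (x :: s) (p ^ e).-1 hJ hs rs.
  by rewrite prednK ?(pexp_gt0 charRp).
have : seqm J (map F s) (c * z ^+ (p ^ e)).
  apply: (proj1 hrs); first exact: idealMr.
  rewrite mulrCA -exprMn; apply: (seqm_scale (J := setT)) => //; first by move=> j _; exact: idealMr.
  by apply: seqm_mono (seqm_pexp _ hxz).
apply: seqm_min => [|_ j /mapP[y ys ->] _]; first exact: ideal_bracket_ideal.
apply: (idealMr _ (ideal_bracket_ideal _ _)); apply: ideal_bracket_mem.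
by rewrite -(mulr1 y); exact: seqm_mem.
Qed.

Lemma seqm_mulprod V ys (a b : nat) w : is_ideal V ->
  seqm V (map (fun x => x ^+ a) ys) w ->
  seqm V (map (fun x => x ^+ (a + b)) ys) (w * (\prod_(y <- ys) y) ^+ b).
Proof.
move=> hV; set Y := \prod_(y <- ys) y.
suff : seqm V (map (fun x => x ^+ a) ys) `<=`
    [set w | seqm V (map (fun x => x ^+ (a + b)) ys) (w * Y ^+ b)] by apply.
have hS := seqm_ideal (map (fun x => x ^+ (a + b)) ys) hV.
apply: seqm_min => [|_ j /mapP[y ys' ->] Vj] /=.
  split=> [|w1 w2|r w1] /=; first by rewrite mul0r; exact: ideal0.
    by rewrite mulrDl; exact: idealD.
  by rewrite -mulrA; exact: idealM.
have -> : y ^+ a * j * Y ^+ b = y ^+ (a + b) * (j * (\prod_(x <- rem y ys) x) ^+ b).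
  by rewrite /Y (big_rem y) //= exprMn exprD; ring.
apply: seqm_mem => //; last exact: idealMr.
by apply/mapP; exists y.
Qed.

(* Removing high powers of the [y]s one variable at a time loses nothing in the gap
   [g.+1] between the two exponents, only the factors [c * y ^+ B]. *)
Lemma cancel_powers S N c B g k vs ys z : is_ideal N -> is_ideal S ->
  (forall y us n z, y \in ys -> (forall u, u \in us -> m u) -> regseq S (y :: us) ->
     N z -> seqm N us (y ^+ n * z) -> seqm N us (c * y ^+ B * z)) ->
  (forall x, x \in vs ++ ys -> m x) -> regseq S (vs ++ ys) -> N z ->
  seqm N (vs ++ map (fun x => x ^+ (k + g).+1) ys) (z * (\prod_(y <- ys) y) ^+ k) ->
  seqm N (vs ++ map (fun x => x ^+ (B + g).+1) ys)
    (c ^+ size ys * z * (\prod_(y <- ys) y) ^+ B).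
Proof.
move=> hN' hS; elim: ys vs z => [|y ys IH] vs z kill hms rs Nz.
  by rewrite /= !big_nil !expr1n !mulr1 mul1r.
rewrite /= !big_cons; set us := vs ++ map (fun x => x ^+ (k + g).+1) ys.
set Y := \prod_(y <- ys) y.
have pm a l : perm_eq (vs ++ a :: l) (a :: vs ++ l).
  by rewrite -cat1s -[a :: vs ++ l]cat1s perm_catCA.
rewrite (seqm_perm hN' (pm _ _)) => -[w [j [hw Nj e]]].
have my : m y by apply: hms; rewrite mem_cat inE eqxx orbT.
have husm u : u \in us -> m u.
  rewrite mem_cat => /orP[uv|/mapP[x xs ->]]; first by apply: hms; rewrite mem_cat uv.
  by apply: (idealX _ (local_ideal hm)); apply: hms; rewrite mem_cat inE xs !orbT.
have rus : regseq S (y :: us).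
  apply: (regseq_perm hN hm hS _ (pm _ _)) => [x|].
    rewrite mem_cat inE => /or3P[xv|/eqP->//|xs]; apply: husm; rewrite mem_cat ?xv ?xs ?orbT //.
  rewrite -cat_rcons; have := @regseq_map_expr R m hN hm S (rcons vs y) ys (k + g) hS.
  by rewrite cat_rcons; exact.
have hz : seqm N us (c * y ^+ B * (z * Y ^+ k - y ^+ g.+1 * j)).
  apply: (kill y us k) => //; first by rewrite inE eqxx.
    by apply: idealB => //; [exact: idealMr|exact: idealM].
  suff -> : y ^+ k * (z * Y ^+ k - y ^+ g.+1 * j) = w by [].
  by rewrite -[RHS](addrK (y ^+ (k + g).+1 * j)) -e -addnS exprD exprMn; ring.
have := IH (y ^+ (B + g).+1 :: vs) (c * y ^+ B * z).
have -> : c ^+ size ys * (c * y ^+ B * z) * Y ^+ B = c ^+ (size ys).+1 * z * (y * Y) ^+ B.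
  by rewrite exprMn exprS; ring.
rewrite (seqm_perm hN' (pm _ _)); apply.
- by move=> y' us' n z' y's; apply: kill; rewrite inE y's orbT.
- move=> x; rewrite /= inE => /orP[/eqP->|].
    by apply: (idealX _ (local_ideal hm)).
  by rewrite mem_cat => h; apply: hms; rewrite mem_cat inE; case/orP: h => ->; rewrite ?orbT.
- apply: (regseq_perm hN hm hS _ (pm _ _)); last exact: (regseq_expr hN hm).
  move=> x; rewrite mem_cat inE => /or3P[h|/eqP->|h].
  + by apply: hms; rewrite mem_cat h.
  + exact: (idealX _ (local_ideal hm)).
  + by apply: hms; rewrite mem_cat inE h !orbT.
- exact: idealM.
exists (c * y ^+ B * (z * Y ^+ k - y ^+ g.+1 * j)), (c * j); split=> //; first exact: idealM.
by rewrite -addnS exprD; ring.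
Qed.

(* [r] annihilates the modules ((us)N : y^n)/(us)N, for all regular sequences at once. *)
Definition kills N r := forall us y n z, (forall u, u \in us -> m u) ->
  regseq setT (y :: us) -> N z -> seqm N us (y ^+ n * z) -> seqm N us (r * z).

Lemma kills_ideal N : is_ideal N -> is_ideal (kills N).
Proof.
move=> hN'; split=> [us y n z _ _ _ _|a b ha hb us y n z hu hr Nz h|r a ha us y n z hu hr Nz h].
- by rewrite mul0r; apply: ideal0; exact: seqm_ideal.
- rewrite mulrDl; apply: idealD; first exact: seqm_ideal.
    exact: (ha us y n).
  exact: (hb us y n).
- rewrite -mulrA; apply: idealM; first exact: seqm_ideal.
  exact: (ha us y n).
Qed.

(** Multiplication by [s] carries [N] into aR, a copy of R, where [y] is regular and the relation
    can be cancelled; the factor [c] brings the result back, as [c * a] lies in [N]. *)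
Lemma kills_of_factor N (s : R) a c : is_ideal N -> a <> 0 ->
  (forall z, N z -> principal a (s * z)) -> N (c * a) -> kills N (c * s).
Proof.
move=> hN' na hs Nca us y n z hu [hy _] Nz hz.
have [zeta sz] := hs _ Nz.
have hs' j : N j -> exists2 v, [set: R] v & s * j = a * v.
  by move=> /hs[v ->]; exists v => //; rewrite mulrC.
have [v hv e] := seqm_factor hT hs' hz.
have hzeta : seqm setT us zeta.
  apply: (regular_expr hT hy (n := n)) => //.
  suff -> : y ^+ n * zeta = v by [].
  by apply: (domain_cancel hN hm hF na); rewrite -e [RHS]mulrCA sz; ring.
have -> : c * s * z = c * a * zeta by rewrite -mulrA sz; ring.
by apply: seqm_scale hzeta => // j _; exact: idealMr.
Qed.

(** The ideal (vs)R + aJ. *)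
Definition mix J a vs : set R :=
  [set z | exists w j, [/\ seqm setT vs w, J j & z = w + a * j]].

Lemma mix_ideal J a vs : is_ideal J -> is_ideal (mix J a vs).
Proof.
move=> hJ; have hS := seqm_ideal vs hT.
split=> [|_ _ [w [j [hw hj ->]]] [w' [j' [hw' hj' ->]]]|r _ [w [j [hw hj ->]]]].
- by exists 0, 0; rewrite mulr0 addr0; split=> //; exact: ideal0.
- by exists (w + w'), (j + j'); split; [exact: idealD|exact: idealD|ring].
- by exists (r * w), (r * j); split; [exact: idealM|exact: idealM|ring].
Qed.

Lemma mix_bracket J a vs e : is_ideal J -> ideal_bracket (mix J a vs) (p ^ e) =
  mix (ideal_bracket J (p ^ e)) (a ^+ (p ^ e)) (map (fun x => x ^+ (p ^ e)) vs).
Proof.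
move=> hJ; have hB := ideal_bracket_ideal (mix J a vs) (p ^ e).
apply/seteqP; split.
  apply: ideal_bracket_min; first by apply: mix_ideal; exact: ideal_bracket_ideal.
  move=> _ [w [j [hw hj ->]]]; exists (w ^+ (p ^ e)), (j ^+ (p ^ e)).
  rewrite exprD_pchar // exprMn; split=> //; last exact: ideal_bracket_mem.
  exact: seqm_mono (seqm_pexp _ hw).
move=> _ [w [j [hw hj ->]]]; apply: (idealD hB).
  apply: (seqm_min hB _ hw) => _ i /mapP[y ys ->] _; apply: (idealMr _ hB).
  apply: ideal_bracket_mem; exists y, 0; rewrite mulr0 addr0; split=> //; last exact: ideal0.
  by rewrite -(mulr1 y); exact: seqm_mem.
suff : ideal_bracket J (p ^ e) `<=`
    [set j | ideal_bracket (mix J a vs) (p ^ e) (a ^+ (p ^ e) * j)] by apply.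
apply: ideal_bracket_min.
  split=> [|x y|r x] /=; first by rewrite mulr0; exact: ideal0.
    by rewrite mulrDr; exact: idealD.
  by rewrite mulrCA; exact: idealM.
move=> x Jx /=; rewrite -exprMn; apply: ideal_bracket_mem.
by exists 0, x; rewrite add0r; split=> //; apply: ideal0; exact: seqm_ideal.
Qed.

(** The exponent of [x] is one less than that of the [y]s since [x] lies in [J]: after
    multiplication by [x], all exponents agree and all coefficients are in [J]. *)
Definition param_ideal J x ys n : set R :=
  mix J (x ^+ n.+1) (map (fun y => y ^+ n.+2) ys).

Lemma param_bracket J x ys n e : is_ideal J ->
  ideal_bracket (param_ideal J x ys n) (p ^ e) =
  mix (ideal_bracket J (p ^ e)) (x ^+ (n.+1 * p ^ e)) (map (fun y => y ^+ (n.+2 * p ^ e)) ys).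
Proof.
move=> hJ; rewrite mix_bracket // -exprM -map_comp; congr (mix _ _ _).
by apply: eq_map => y /=; rewrite -exprM.
Qed.

(** The relation is moved into [N e], the powers of the [y]s are reduced there at the cost of
    p^(f+e), and p^(f'+e) pays for the way back to J^[q]. Both costs are multiples of q, so the
    final index [p ^ f + p ^ f'] depends neither on [n] nor on [e]. *)
Lemma uniform_multiplier J x ys u (N : nat -> set R) c f f' : is_ideal J -> J x ->
  (forall y, y \in x :: ys -> m y) -> regseq setT (x :: ys) ->
  (forall e, is_ideal (N e)) ->
  (forall e, ideal_bracket J (p ^ e) `<=` N e) ->
  (forall e z, N e z ->
     ideal_bracket J (p ^ e) (z * (\prod_(y <- ys) y) ^+ (p ^ (f' + e)))) ->
  (forall e y, y \in ys -> kills (N e) (c * y ^+ (p ^ (f + e)))) ->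
  forall n e r,
    ideal_bracket (param_ideal J x ys n) (p ^ e)
      (r * (u * (x * \prod_(y <- ys) y) ^+ n) ^+ (p ^ e)) ->
    ideal_bracket (param_ideal J x ys (p ^ f + p ^ f')) (p ^ e)
      (c ^+ size ys * r * (u * (x * \prod_(y <- ys) y) ^+ (p ^ f + p ^ f')) ^+ (p ^ e)).
Proof.
move=> hJ Jx hms rs hNi JN NJ kill n e r; rewrite !param_bracket //.
set Y := \prod_(y <- ys) y; set q := (p ^ e)%N.
have hq : (0 < q)%N by exact: (pexp_gt0 charRp).
have hq2 : q.*2 = q.*2.-1.+1 by rewrite prednK // double_gt0.
have Nx : N e (x ^+ q) by apply: JN; exact: ideal_bracket_mem.
(* The power of [x] puts everything into [N e], so that a single coefficient ideal remains; it is
   cancelled in R afterwards. *)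
pose z := r * u ^+ q * x ^+ (n.+1 * q).
have Nz : N e z.
  apply: idealM => //; rewrite mulSn exprD; exact: idealMr.
move=> [w [j [hw hj E]]].
(* The product of the [y]s has exponent nq and the generators have (n+2)q. The gap 2q, written
   [(q.*2.-1).+1], is preserved to the end. *)
have hz : seqm (N e) ([:: x ^+ (n.+2 * q)] ++ map (fun y => y ^+ (n * q + q.*2.-1).+1) ys)
    (z * Y ^+ (n * q)).
  exists (x ^+ q * w), j; split.
  - apply: (seqm_scale (J := setT)) => //; first by move=> i _; exact: idealMr.
    suff -> : map (fun y => y ^+ (n * q + q.*2.-1).+1) ys = map (fun y => y ^+ (n.+2 * q)) ys by [].
    by apply: eq_map => y; rewrite -addnS -hq2 -muln2 mulnC -mulnDr addn2 mulnC.
  - exact: JN.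
  rewrite [(n.+2 * q)%N]mulSn [x ^+ (q + _)]exprD -mulrA -mulrDr -E /z.
  by rewrite mulSn exprD !exprMn -!exprM; ring.
have rx : regseq setT (x :: map (fun y => y ^+ (p ^ (f + e) + q.*2.-1).+1) ys).
  by apply: (@regseq_map_expr _ _ hN hm _ [:: x]).
have := @cancel_powers setT (N e) c (p ^ (f + e)) _ _ _ _ _ (hNi e) hT _ _ _ Nz hz.
case=> [y us k z' ys' hu hr Nz' h|y||w' [i [hw' Ni E']]].
- by apply: kill h.
- rewrite inE => /orP[/eqP->|ys']; last by apply: hms; rewrite inE ys' orbT.
  by rewrite mulSn exprD; apply: idealMr (local_ideal hm) _; rewrite -(prednK hq);
    apply: idealX (local_ideal hm) _; apply: hms; rewrite inE eqxx.
- by split; [move=> v _ /=; apply: (regular_expr hT); case: rs|case: rs].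
have {}hw' := seqm_mono (@subsetT _ (N e)) hw'.
set B := (p ^ (f + e))%N in rx E' hw' *.
have hw2 : seqm setT (map (fun y => y ^+ (B + q.*2.-1).+1) ys)
    (c ^+ size ys * r * u ^+ q * Y ^+ B - x ^+ q * i).
  apply: (regular_expr hT (proj1 rx) (n := n.+1 * q)) => //.
  suff -> : x ^+ (n.+1 * q) * (c ^+ size ys * r * u ^+ q * Y ^+ B - x ^+ q * i) = w' by [].
  by rewrite -[w'](addrK (x ^+ (n.+2 * q) * i)) -E' /z [(n.+2 * q)%N]mulSn exprD; ring.
(* Multiplying by this power of the product returns [i] from [N e] to J^[q] and raises both
   exponents alike. *)
pose B' := (p ^ (f' + e))%N.
have hB : (B + B' = (p ^ f + p ^ f') * q)%N by rewrite /B /B' !expnD mulnDl.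
exists (x ^+ ((p ^ f + p ^ f') * q) *
    ((c ^+ size ys * r * u ^+ q * Y ^+ B - x ^+ q * i) * Y ^+ B')), (i * Y ^+ B'); split.
- apply: idealM; first exact: seqm_ideal.
  have := seqm_mulprod B' hT hw2.
  suff -> : map (fun y => y ^+ ((B + q.*2.-1).+1 + B')) ys =
    map (fun y => y ^+ ((p ^ f + p ^ f').+2 * q)) ys by [].
  by apply: eq_map => y; rewrite -addnS -hq2 addnAC hB -muln2 [(q * 2)%N]mulnC -mulnDl addn2.
- exact: NJ.
rewrite mulSn [x ^+ (q + _)]exprD -hB !exprMn -!exprM -hB !exprD; ring.
Qed.

End Cancellation.

(** * Choice of the parameters and of the saturated ideals *)

Section ParameterChoice.
Variables (R : comNzRingType) (m : set R) (p : nat) (charRp : p \in [pchar R]).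
Hypotheses (hN : noetherian R) (hm : is_local m) (hF : strongly_F_regular charRp).
Implicit Types (I J K P Q W V A : set R) (a b c r x y z w : R) (ys zs : seq R) (e f h n : nat).

Lemma has_height_prime P h : has_height P h -> is_prime P.
Proof. by move=> [[c [[hc _] <-]] _]; exact: hc. Qed.

Lemma symbolic_pow_ideal J h : is_ideal (symbolic_pow J h).
Proof.
have hP := ideal_pow_ideal J h.
split=> [P /has_height_prime hP1|x y hx hy P hP1|r x hx P hP1].
- by exists 1; split; [exact: prime_notin1|rewrite mulr0; exact: ideal0].
- have [s [ns hs]] := hx _ hP1; have [s' [ns' hs']] := hy _ hP1.
  exists (s * s'); split; first exact: prime_mulN (has_height_prime hP1) ns ns'.
  have -> : s * s' * (x + y) = s' * (s * x) + s * (s' * y) by ring.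
  by apply: idealD => //; exact: idealM.
- have [s [ns hs]] := hx _ hP1; exists s; split=> //.
  by rewrite mulrCA; exact: idealM.
Qed.

Lemma sub_symbolic_pow J h : ideal_pow J h `<=` symbolic_pow J h.
Proof.
by move=> x hx P /has_height_prime hP; exists 1; rewrite mul1r; split=> //; exact: prime_notin1.
Qed.

Lemma common_denominator P K a : is_prime P -> is_ideal K ->
  (forall x, K x -> exists s r, ~ P s /\ s * x = r * a) ->
  exists2 s, ~ P s & forall x, K x -> principal a (s * x).
Proof.
move=> hP hK h; have [l lK] := hN hK.
have hl x : x \in l -> K x by move=> xl; rewrite lK; apply: sub_ideal_gen.
have [s ns hs] : exists2 s, ~ P s & forall x, x \in l -> principal a (s * x).
  elim: l hl {lK} => [|x l IH] hl; first by exists 1 => //; exact: prime_notin1.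
  have [|s ns hs] := IH; first by move=> y yl; apply: hl; rewrite inE yl orbT.
  have [|s' [r [ns' e]]] := h x; first by apply: hl; rewrite inE eqxx.
  exists (s * s'); first exact: prime_mulN.
  move=> y; rewrite inE => /orP[/eqP->|/hs hy].
    by exists (s * r); rewrite -mulrA e mulrA.
  by rewrite mulrAC; exact: idealMr (principal_ideal _) _.
exists s => //; rewrite lK; apply: ideal_gen_min => [|x /hs //].
have hA := principal_ideal a; split=> [|x y hx hy|r x hx] /=.
- by rewrite mulr0; exact: ideal0.
- by rewrite mulrDr; exact: idealD.
- by rewrite mulrCA; exact: idealM.
Qed.

Lemma ideal_pow_factor J a r n : (forall j, J j -> principal a (r * j)) ->
  forall z, ideal_pow J n z -> principal (a ^+ n) (r ^+ n * z).
Proof.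
move=> hJ; elim: n => [|n IH] z; first by exists z; rewrite mul1r expr0 mulr1.
have hA := principal_ideal (a ^+ n.+1).
apply: (@ideal_mul_sub _ _ _ [set z | principal (a ^+ n.+1) (r ^+ n.+1 * z)]).
  split=> [|x y hx hy|r' x hx] /=; first by rewrite mulr0; exact: ideal0.
    by rewrite mulrDr; exact: idealD.
  by rewrite mulrCA; exact: idealM.
move=> x y /hJ[s es] /IH[t et] /=; exists (s * t).
have -> : r ^+ n.+1 * (x * y) = (r * x) * (r ^+ n * y) by rewrite exprS; ring.
by rewrite es et exprS; ring.
Qed.

Variable J : set R.
Hypotheses (hJ : is_ideal J) (Jnz : exists2 c, J c & c <> 0) (Jpure : pure_height_one J).
Hypothesis hQ : forall P, is_prime P -> P <> m ->
  exists h, (1 <= h)%N /\ locally_principal P (symbolic_pow J h).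

(** Where [s] is invertible, J^(h) is generated by [a]. *)
Definition denominator (s : R) h a := [/\ (0 < h)%N, a <> 0, symbolic_pow J h a &
  forall x, symbolic_pow J h x -> principal a (s * x)].

Lemma exists_denominator P : is_prime P -> P <> m ->
  exists s h a, ~ P s /\ denominator s h a.
Proof.
move=> hP Pm; have [h [h0 [a [ha hx]]]] := hQ hP Pm.
have [s ns hs] := common_denominator hP (symbolic_pow_ideal J h) hx.
exists s, h, a; split=> //; split=> // a0.
have [c Jc nc] := Jnz.
have [|r] := hs (c ^+ h); first by apply: sub_symbolic_pow; exact: ideal_pow_mem.
rewrite a0 mulr0; apply: (domain_mul hN hm hF) (domain_exp hN hm hF nc).
by move=> s0; apply: ns; rewrite s0; exact: ideal0 (prime_ideal hP).
Qed.

(** At [P] the ideals J^(h) and J^h agree, so JR_P is a factor of a principal ideal, hence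
    invertible, hence principal. In elements: some product [s * (j * y)] is a multiple of [a] by an
    element outside [P], and its factor [j] is the generator. *)
Lemma height_one_principal P : has_height P 1 -> P <> m ->
  exists s b, [/\ ~ P s, J b, b <> 0 & forall j, J j -> principal b (s * j)].
Proof.
move=> hP1 Pm; have hP := has_height_prime hP1; have hPi := prime_ideal hP.
have [s [[|h] [a [ns [h0 na ha hs]]]]] // := exists_denominator hP Pm.
have [s' [ns' hs']] := ha _ hP1.
have [j [y [r [Jj hy nr e]]]] : exists j y r, [/\ J j, ideal_pow J h y, ~ P r & s * (j * y) = r * a].
  apply: contrapT => hno.
  have : [set z | exists2 r, P r & s * z = r * a] (s' * a).
    move: hs'; apply: (@ideal_mul_sub _ _ _ [set z | exists2 r, P r & s * z = r * a]).
      split=> [|x y [r hr e] [r' hr' e']|t x [r hr e]].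
      + by exists 0; rewrite ?mulr0 ?mul0r //; exact: ideal0.
      + by exists (r + r'); [exact: idealD|rewrite mulrDr e e' mulrDl].
      + by exists (t * r); [exact: idealM|rewrite mulrCA e mulrA].
    move=> j y Jj hy; have [|r e] := hs (j * y).
      by apply: sub_symbolic_pow; exact: ideal_mul_mem.
    exists r => //; apply: contrapT => nr; apply: hno; exists j, y, r; split=> //.
  move=> [r Pr e]; apply: (prime_mulN hP ns ns').
  suff -> : s * s' = r by [].
  by apply: (domain_cancel hN hm hF na); rewrite mulrC -mulrA e mulrC.
have nra : r * a <> 0.
  apply: (domain_mul hN hm hF) => // r0; apply: nr; rewrite r0; exact: ideal0.
exists (r * s), j; split=> //.
- exact: prime_mulN.
- by move=> j0; apply: nra; rewrite -e j0 mul0r mulr0.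
move=> j' Jj'; have [|r' e'] := hs (j' * y).
  by apply: sub_symbolic_pow; exact: ideal_mul_mem.
exists (r' * s); apply: (@domain_cancel R m p charRp hN hm hF y).
  by move=> y0; apply: nra; rewrite -e y0 !mulr0.
have -> : y * (r * s * j') = r * (s * (j' * y)) by ring.
have -> : y * (r' * s * j) = r' * (s * (j * y)) by ring.
by rewrite e e'; ring.
Qed.

(** [f] must be common to all denominators while [c] may vary, because a single [x2] taken from this
    set has to serve every prime other than m. *)
Definition bracket_denominators : set R := [set r | exists f,
  forall s h a, denominator s h a -> exists2 c, c <> 0 &
    forall e, ideal_bracket J (p ^ e) (c * a ^+ (p ^ e %/ h) * r ^+ (p ^ (f + e)))].

Lemma expr_pexp_mono K f f' e c r : is_ideal K -> (f <= f')%N ->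
  K (c * r ^+ (p ^ (f + e))) -> K (c * r ^+ (p ^ (f' + e))).
Proof.
move=> hK ff'; rewrite -(subnK (leq_pexp2l (ltnW (pchar_prime_gt1 charRp))
  (leq_add ff' (leqnn e)))) exprD mulrCA; exact: idealM.
Qed.

Lemma bracket_denominators_ideal : is_ideal bracket_denominators.
Proof.
have hB e := ideal_bracket_ideal J (p ^ e).
split=> [|x y [f hf] [f' hf']|r x [f hf]].
- exists 0%N => s h a _; exists 1 => [/eqP|e]; first by rewrite oner_eq0.
  by rewrite add0n (expr0_pexp charRp) mulr0; exact: ideal0 (hB e).
- exists (maxn f f') => s h a hd.
  have [c nc hc] := hf _ _ _ hd; have [c' nc' hc'] := hf' _ _ _ hd.
  exists (c * c') => [|e]; first exact: (domain_mul hN hm hF).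
  have h1 := expr_pexp_mono (hB e) (leq_maxl f f') (hc e).
  have h2 := expr_pexp_mono (hB e) (leq_maxr f f') (hc' e).
  rewrite exprD_pchar // mulrDr; apply: (idealD (hB e)).
    by have := idealM c' (hB e) h1; congr (ideal_bracket _ _ _); ring.
  by have := idealM c (hB e) h2; congr (ideal_bracket _ _ _); ring.
- exists f => s h a hd; have [c nc hc] := hf _ _ _ hd; exists c => // e.
  by rewrite exprMn mulrCA; exact: idealM (hB e) (hc e).
Qed.

(** r^h J^h lies in b^h R, and testing at the primes of height one extends this to J^(h). With k the
    integral part of q/h, the k-th power of r^h a in b^h R gives b^h a^k r^q in b^q R, as q <= h +
    hk: the constant [b ^+ h] absorbs the remainder of q modulo h. *)
Lemma mem_bracket_denominators r b : J b -> b <> 0 ->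
  (forall j, J j -> principal b (r * j)) -> bracket_denominators r.
Proof.
move=> Jb nb hr; exists 0%N => s h a [h0 na ha _].
have [t et] : principal (b ^+ h) (r ^+ h * a).
  apply: (principal_height_one hN hm hF); first exact: (domain_exp hN hm hF).
  move=> P /ha[s' [ns' hs']]; exists s'; split=> //.
  by rewrite mulrCA; exact: ideal_pow_factor hs'.
exists (b ^+ h) => [|e]; first exact: (domain_exp hN hm hF).
rewrite add0n; set q := (p ^ e)%N; set k := (q %/ h)%N.
have hq : q = (h * k + q %% h)%N by rewrite [LHS](divn_eq q h) mulnC.
have hqh : (q <= h + h * k)%N.
  by rewrite [leqLHS]hq addnC leq_add2r ltnW // ltn_mod.
have -> : r ^+ q = (r ^+ h) ^+ k * r ^+ (q %% h) by rewrite {1}hq exprD exprM.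
have -> : b ^+ h * a ^+ k * ((r ^+ h) ^+ k * r ^+ (q %% h)) =
    b ^+ h * (r ^+ h * a) ^+ k * r ^+ (q %% h) by rewrite exprMn; ring.
rewrite et exprMn -exprM.
have -> : b ^+ h * (t ^+ k * b ^+ (h * k)) * r ^+ (q %% h) =
   t ^+ k * r ^+ (q %% h) * b ^+ (h + h * k - q) * b ^+ q.
  by rewrite -[RHS]mulrA -exprD subnK // exprD; ring.
by apply: idealM (ideal_bracket_ideal _ _) _; exact: ideal_bracket_mem.
Qed.

(* Stands in for the symbolic power J^(q), q = p ^ e: for the [x2] chosen below, both agree at
   the primes of height one. *)
Definition saturation (x2 : R) f e : set R :=
  ideal_colon (ideal_bracket J (p ^ e)) (x2 ^+ (p ^ (f + e))).

Lemma saturation_ideal x2 f e : is_ideal (saturation x2 f e).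
Proof. exact: ideal_colon_ideal _ (ideal_bracket_ideal _ _). Qed.

Lemma bracket_factor s h a e z : denominator s h a -> ideal_bracket J (p ^ e) z ->
  principal (a ^+ (p ^ e %/ h)) (s ^+ (p ^ e %/ h) * z).
Proof.
move=> [h0 na ha hs]; set q := (p ^ e)%N; set k := (q %/ h)%N.
have hA := principal_ideal (a ^+ k).
apply: (@ideal_bracket_min _ _ _ [set z | principal (a ^+ k) (s ^+ k * z)]).
  split=> [|x y|r x] /=; first by rewrite mulr0; exact: ideal0.
    by rewrite mulrDr; exact: idealD.
  by rewrite mulrCA; exact: idealM.
move=> j Jj /=; have [|t et] := hs (j ^+ h); first by apply: sub_symbolic_pow; exact: ideal_pow_mem.
have -> : s ^+ k * j ^+ q = (s * j ^+ h) ^+ k * j ^+ (q %% h).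
  by rewrite exprMn {1}(divn_eq q h) exprD mulnC exprM mulrA.
by exists (t ^+ k * j ^+ (q %% h)); rewrite et exprMn; ring.
Qed.

(** Depth two of aR, a copy of R: a fraction w/a that becomes integral after multiplication by a
    power of [x1] and by a power of [x2] is in R. *)
Lemma regular_pair_principal a w x1 x2 n n' : a <> 0 -> m x1 -> m x2 ->
  regseq setT [:: x2; x1] -> principal a (x1 ^+ n.+1 * w) -> principal a (x2 ^+ n'.+1 * w) ->
  principal a w.
Proof.
move=> na m1 m2 rs [t1 e1] [t2 e2]; have hT := @ideal_setT R.
have hms y : y \in [:: x2; x1] -> m y by rewrite !inE => /orP[] /eqP->.
have rs1 : regseq setT [:: x2; x1 ^+ n.+1].
  exact: (@regseq_expr R m hN hm setT [:: x2] x1 [::]).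
have [_ [j [-> _ E]]] : seqm setT [:: x1 ^+ n.+1] t1.
  apply: (regular_expr hT (proj1 rs1) (n := n'.+1)) => //.
  exists 0, t2; split=> //; rewrite add0r; apply: (domain_cancel hN hm hF na).
  have -> : a * (x2 ^+ n'.+1 * t1) = x2 ^+ n'.+1 * (t1 * a) by ring.
  by rewrite -e1 mulrCA e2; ring.
have nx1 : x1 ^+ n.+1 <> 0.
  move=> x10; have [_ [h1 _]] := rs1; have := h1 1 I; rewrite /= x10 mul0r => /(_ erefl)/eqP.
  by rewrite oner_eq0.
exists j; apply: (domain_cancel hN hm hF nx1); rewrite e1 E; ring.
Qed.

(** The pair argument applies: [x1 ^+ h] lies in J^(h), which settles [x1], and the saturation is
    defined by a power of [x2] that leads to J^[q]. *)
Lemma saturation_factor x1 x2 f e s h a z : J x1 -> m x1 -> m x2 ->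
  regseq setT [:: x2; x1] -> denominator s h a -> saturation x2 f e z ->
  principal (a ^+ (p ^ e %/ h)) (s ^+ (p ^ e %/ h) * z).
Proof.
move=> J1 m1 m2 rs hd hz; have [h0 na ha hs] := hd.
set q := (p ^ e)%N; set k := (q %/ h)%N.
apply: (@regular_pair_principal _ _ x1 x2 (h * k) (p ^ (f + e)).-1) => //.
- exact: (domain_exp hN hm hF).
- have [|t et] := hs (x1 ^+ h); first by apply: sub_symbolic_pow; exact: ideal_pow_mem.
  have -> : x1 ^+ (h * k).+1 * (s ^+ k * z) = x1 * z * (s * x1 ^+ h) ^+ k.
    by rewrite exprS exprM exprMn; ring.
  by rewrite et exprMn; exists (x1 * z * t ^+ k); ring.
rewrite prednK ?(pexp_gt0 charRp) // mulrCA (mulrC _ z).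
exact: bracket_factor.
Qed.

(** An ideal for the same reason as [bracket_denominators]; for the saturations it turns out to
    contain m. *)
Definition killing_elements (N : nat -> set R) : set R :=
  [set r | exists f c, c <> 0 /\ forall e, kills m (N e) (c * r ^+ (p ^ (f + e)))].

Lemma killing_elements_ideal N : (forall e, is_ideal (N e)) -> is_ideal (killing_elements N).
Proof.
move=> hNe; have hK e := kills_ideal m (hNe e).
split=> [|x y [f [c [nc hc]]] [f' [c' [nc' hc']]]|r x [f [c [nc hc]]]].
- exists 0%N, 1; split=> [/eqP|e]; first by rewrite oner_eq0.
  by rewrite (expr0_pexp charRp) mulr0; exact: ideal0 (hK e).
- exists (maxn f f'), (c * c'); split=> [|e]; first exact: (domain_mul hN hm hF).
  have h1 := expr_pexp_mono (hK e) (leq_maxl f f') (hc e).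
  have h2 := expr_pexp_mono (hK e) (leq_maxr f f') (hc' e).
  rewrite exprD_pchar // mulrDr; apply: (idealD (hK e)).
    by have := idealM c' (hK e) h1; congr (kills _ _ _); ring.
  by have := idealM c (hK e) h2; congr (kills _ _ _); ring.
- exists f, c; split=> // e.
  by rewrite exprMn mulrCA; exact: idealM (hK e) (hc e).
Qed.

Lemma denominator_killing x1 x2 f s h a : J x1 -> m x1 -> m x2 ->
  regseq setT [:: x2; x1] -> denominator s h a ->
  (forall s h a, denominator s h a -> exists2 c, c <> 0 &
    forall e, ideal_bracket J (p ^ e) (c * a ^+ (p ^ e %/ h) * x2 ^+ (p ^ (f + e)))) ->
  killing_elements (saturation x2 f) s.
Proof.
move=> J1 m1 m2 rs hd hx2; have [h0 na ha hs] := hd.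
have [c nc hc] := hx2 _ _ _ hd; exists 0%N, c; split=> // e; rewrite add0n.
have hk : (p ^ e %/ h <= p ^ e)%N by exact: leq_div.
rewrite -(subnKC hk) exprD mulrA.
apply: (idealMr _ (kills_ideal m (saturation_ideal x2 f e))).
apply: (kills_of_factor (a := a ^+ (p ^ e %/ h)) hN hm hF) => //.
- exact: saturation_ideal.
- exact: (domain_exp hN hm hF).
- by move=> z; exact: (saturation_factor J1).
- exact: hc.
Qed.

(** The ideal is closed under roots, since n <= p^n allows an exponent n to be absorbed into [f].
    Hence a prime over it would miss [y]; this prime is not m, so a denominator lies outside it. *)
Lemma max_killing N y : (forall e, is_ideal (N e)) -> m y ->
  (forall s h a, denominator s h a -> killing_elements N s) -> killing_elements N y.
Proof.
move=> hNe my hd; apply: contrapT => ny.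
have hK := killing_elements_ideal hNe.
have [|||P [hP KP yP]] := @prime_avoiding R hN _ [set r | exists n, r = y ^+ n] hK.
- by exists 0%N.
- by move=> _ _ [i ->] [j ->]; exists (i + j)%N; rewrite exprD.
- move=> _ [n ->] [f [c [nc hc]]]; apply: ny.
  have pn : (n <= p ^ n)%N by apply/ltnW/ltn_expl/(pchar_prime_gt1 charRp).
  exists (n + f)%N, c; split=> // e.
  have -> : (p ^ (n + f + e) = (p ^ n - n) * p ^ (f + e) + n * p ^ (f + e))%N.
    by rewrite -mulnDl subnK // -expnD addnA.
  rewrite exprD mulrCA; apply: (idealM _ (kills_ideal m (hNe e))).
  by rewrite exprM; exact: hc.
have Pm : P <> m by move=> E; apply: (yP y); [exists 1%N|rewrite E].
have [s [h [a [ns /hd hs]]]] := exists_denominator hP Pm.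
by apply: ns; exact: KP.
Qed.

Lemma max_killing_seq N ys : (forall e, is_ideal (N e)) ->
  (forall y, y \in ys -> killing_elements N y) ->
  exists f c, c <> 0 /\ forall e y, y \in ys -> kills m (N e) (c * y ^+ (p ^ (f + e))).
Proof.
move=> hNe; have hK e := kills_ideal m (hNe e).
elim: ys => [|y ys IH] hys.
  by exists 0%N, 1; split=> // /eqP; rewrite oner_eq0.
have [|f [c [nc hc]]] := IH; first by move=> y' h'; apply: hys; rewrite inE h' orbT.
have [|f' [c' [nc' hc']]] := hys y; first by rewrite inE eqxx.
exists (maxn f f'), (c * c'); split=> [|e y']; first exact: (domain_mul hN hm hF).
rewrite inE => /orP[/eqP->|h'].
  by rewrite -mulrA; apply: idealM (hK e) (expr_pexp_mono (hK e) (leq_maxr f f') (hc' e)).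
by rewrite mulrAC; apply: idealMr (hK e) (expr_pexp_mono (hK e) (leq_maxl f f') (hc e y' h')).
Qed.

Variable d : nat.
Hypothesis hd : has_krull_dim R d.

Lemma max_nonzero : (0 < d)%N -> exists2 x, m x & x <> 0.
Proof.
move=> d0; have [[c [hc1 hc2]] _] := hd.
have [h1 h2] := hc2 0%N d0; have /existsNP[x /not_implyP[cx nx]] := h2.
exists x; first by apply: (local_proper hN hm) cx; [exact: prime_ideal (hc1 _ _)|case: (hc1 _ d0)].
by move=> x0; apply: nx; rewrite x0; exact: ideal0 (prime_ideal (hc1 0%N _)).
Qed.

Lemma height_one_not_max P : (1 < d)%N -> has_height P 1 -> P <> m.
Proof.
move=> d1 [_ hP] E; have [[c hc] hmax] := hd; have [hc1 hc2] := hc.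
have cm : c d `<=` m.
  by have hcd := hc1 d (leqnn _); apply: (local_proper hN hm); [exact: prime_ideal|case: hcd].
have [/hP|nE] := pselect (c d = P); first by move=> /(_ hc); rewrite leqNgt d1.
suff /hmax : prime_chain d.+1 (fun i => if (i <= d)%N then c i else m) by rewrite ltnn.
split=> i hi; first by case: ifP => h'; [exact: hc1|exact: local_prime hm].
rewrite -ltnS hi; case: ifP => h'; first by apply: hc2; rewrite -ltnS.
have -> : i = d by apply/eqP; rewrite eqn_leq -ltnS hi leqNgt h'.
by split=> // mc; apply: nE; rewrite E; apply/seteqP.
Qed.

(* Either [v] is a multiple of [x1] and the prime is associated to [J], or it lies in an
   associated prime of [x1 R]. *)
Lemma associated_height_one x1 v : J x1 -> x1 <> 0 -> J v ->
  is_prime (ideal_colon (seqm J [:: x1]) v) ->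
  has_height (ideal_colon (seqm J [:: x1]) v) 1.
Proof.
move=> J1 n1 Jv; set P := ideal_colon _ v => hP.
have WE z : seqm J [:: x1] z <-> exists2 j, J j & z = x1 * j.
  split=> [[_ [j [-> Jj ->]]]|[j Jj ->]]; first by exists j; rewrite ?add0r.
  by exists 0, j; rewrite add0r.
have [[r er]|nv] := pselect (principal x1 v).
  apply: Jpure; split=> //; exists r; apply/seteqP; split=> z.
    rewrite /P /ideal_colon /= => /WE[j Jj]; rewrite er mulrA [RHS]mulrC.
    by move=> E; have /(domain_cancel hN hm hF n1) -> : x1 * (z * r) = x1 * j; [rewrite mulrC E mulrC|].
  rewrite /P /ideal_colon /= => hz; apply/WE; exists (z * r) => //.
  by rewrite er; ring.
have [v' [hQ1 hQ1' vQ]] := height_one_in_associated hN hm hF n1 nv.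
set Q := ideal_colon _ v' in hQ1 hQ1' vQ.
have PQ : P `<=` Q.
  by move=> z hz; apply: vQ; have /WE[j Jj e] := hz; exists j; rewrite e mulrC.
suff -> : P = Q by [].
apply/seteqP; split=> //; apply: contrapT => QP.
pose ch i := if i is 0 then [set 0] else if i is 1%N then P else Q.
suff hch : prime_chain 2 ch by have [_ /(_ 2%N ch hch erefl)] := hQ1'.
split=> [[|[|i]] _|[|[|i]] // _] //=; first exact: (prime_set0 hN hm hF).
split; first by move=> _ ->; exact: ideal0 (prime_ideal hP).
by move/(_ x1) => h; apply: n1; apply: h; apply/WE; exists v => //; rewrite mulrC.
Qed.

Variable zs : seq R.
Hypotheses (zsm : forall z, z \in zs -> m z) (zsr : regseq J zs) (zsd : size zs = d).

(** In dimension at least two, [x2] must be regular on J/x1 J and belong to [bracket_denominators].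
    This is possible because the zero divisors on J/x1 J lie in primes of height one, where [J] is
    principal. *)
Lemma exists_parameters : (0 < d)%N -> exists x ys (N : nat -> set R) c f f',
  [/\ J x, (forall y, y \in x :: ys -> m y), regseq J (x :: ys), size (x :: ys) = d & c <> 0] /\
  [/\ forall e, is_ideal (N e),
      forall e, ideal_bracket J (p ^ e) `<=` N e,
      forall e z, N e z ->
        ideal_bracket J (p ^ e) (z * (\prod_(y <- ys) y) ^+ (p ^ (f' + e)))
    & forall e y, y \in ys -> kills m (N e) (c * y ^+ (p ^ (f + e)))].
Proof.
move=> d0; have [c Jc nc] := Jnz; have [t mt nt] := max_nonzero d0.
pose x1 := c * t; have n1 : x1 <> 0 by exact: (domain_mul hN hm hF).
have J1 : J x1 by exact: idealMr.
have m1 : m x1 by exact: idealM (local_ideal hm) _.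
have hB e := ideal_bracket_ideal J (p ^ e).
have BM e z w : ideal_bracket J (p ^ e) z -> ideal_bracket J (p ^ e) (z * w).
  exact: (@idealMr _ (ideal_bracket J (p ^ e))).
have r1 : regseq J [:: x1].
  by split=> // z _ /= h; apply: (domain_cancel hN hm hF n1); rewrite h mulr0.
have [d1|d2] := leqP d 1.
  have dE : d = 1%N by apply/eqP; rewrite eqn_leq d1.
  (* In dimension one there is no [y] to cancel, and J^[q] itself serves as [N]. *)
  exists x1, [::], (fun e => ideal_bracket J (p ^ e)), c, 0%N, 0%N; split; split=> //.
  - by move=> y; rewrite inE => /eqP->.
  - by move=> e z.
  - by move=> e z hz; exact: (BM e z _ hz).
have [x2 [[f hf] m2] hx2] : exists2 x, (bracket_denominators `&` m) x &
    forall W z, W \in [:: seqm J [:: x1]] -> J z -> W (x * z) -> W z.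
  apply: (exists_regular hN) => //.
  - by apply: ideal_setI; [exact: bracket_denominators_ideal|exact: local_ideal hm].
  - by move=> W; rewrite inE => /eqP->; exact: seqm_ideal.
  move=> W v; rewrite inE => /eqP-> Jv nv hP hsub.
  have hP1 := associated_height_one J1 n1 Jv hP.
  have Pm := height_one_not_max d2 hP1.
  have [s [b [ns Jb nb hs]]] := height_one_principal hP1 Pm.
  have /existsNP[y /not_implyP[my ny]] : ~ (m `<=` ideal_colon (seqm J [:: x1]) v).
    move=> h; apply: Pm; have [[_ _ hmax] _] := hm.
    by apply: hmax => //; [exact: prime_ideal|case: hP].
  apply: (prime_mulN hP ns ny); apply: hsub; split; last exact: idealM (local_ideal hm) _.
  by apply: idealMr bracket_denominators_ideal _; exact: mem_bracket_denominators hs.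
have r2 : regseq J [:: x2; x1] by split=> // z; apply: hx2; rewrite inE.
have hm2 y : y \in [:: x2; x1] -> m y by rewrite !inE => /orP[] /eqP->.
have [|l [rl sl ml]] := regseq_extend hN hm hJ hm2 zsm r2 zsr; first by rewrite zsd.
have pm : perm_eq (l ++ [:: x2; x1]) (x1 :: x2 :: l).
  by apply/permP => a; rewrite count_cat /=; lia.
have r2' := regseq_setT hN hm hF hJ Jnz hm2 r2.
pose N := saturation x2 f.
have hNe e : is_ideal (N e) := saturation_ideal x2 f e.
have [|f2 [c' [nc' hc']]] := @max_killing_seq N (x2 :: l) hNe.
  move=> y hy; apply: max_killing => //.
    by apply: ml; rewrite (perm_mem pm) inE hy orbT.
  by move=> s h a hsa; exact: (denominator_killing J1 m1 m2 r2' hsa hf).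
(* [x2] is among the [y]s, so their product to the power p^(f+e) contains the power of [x2] that
   defines the saturation; hence [f] is also the exponent of the way back. *)
exists x1, (x2 :: l), N, c', f2, f; split; split=> //.
- by move=> y; rewrite -(perm_mem pm); exact: ml.
- exact: (regseq_perm hN hm hJ ml pm).
- by rewrite -(perm_size pm) sl.
- by move=> e z hz; exact: (BM e z _ hz).
- by move=> e z hz; rewrite big_cons exprMn mulrA; exact: (BM e _ _ hz).
Qed.

End ParameterChoice.

(** * Irreducible ideals from parameters, and comparison of their colons *)

Section ConditionA.
Variables (R : comNzRingType) (m : set R) (p : nat) (charRp : p \in [pchar R]).
Hypotheses (hN : noetherian R) (hm : is_local m) (hF : strongly_F_regular charRp).
Implicit Types (I K P A : set R) (a b c r v y z w : R) (us vs : seq R) (e n : nat).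

Let hT := @ideal_setT R.

Lemma ideal_bracket_expr I e e' z : ideal_bracket I (p ^ e) z ->
  ideal_bracket I (p ^ (e + e')) (z ^+ (p ^ e')).
Proof.
have hB := ideal_bracket_ideal I (p ^ (e + e')).
suff h : ideal_bracket I (p ^ e) `<=` [set z | ideal_bracket I (p ^ (e + e')) (z ^+ (p ^ e'))].
  exact: h.
apply: ideal_bracket_min.
  split=> [|x y hx hy|r x hx] /=; first by rewrite (expr0_pexp charRp); exact: ideal0 hB.
    by rewrite exprD_pchar //; exact: idealD hB hx hy.
  by rewrite exprMn; exact: idealM hB hx.
by move=> x Ix /=; rewrite -exprM -expnD; exact: ideal_bracket_mem.
Qed.

Lemma ideal_bracket_comp I e e' :
  ideal_bracket I (p ^ (e + e')) `<=` ideal_bracket (ideal_bracket I (p ^ e)) (p ^ e').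
Proof.
apply: ideal_bracket_min; first exact: ideal_bracket_ideal.
by move=> x Ix; rewrite expnD exprM; apply: ideal_bracket_mem; exact: ideal_bracket_mem.
Qed.

Lemma exists_socle_elt A I n : is_ideal A -> is_ideal I -> ideal_pow m n `<=` I ->
  (exists2 a, A a & ~ I a) -> exists u, [/\ A u, ~ I u & forall y, m y -> I (y * u)].
Proof.
move=> hA hI hn [a Aa na].
have : forall y, ideal_pow m n y -> I (y * a) by move=> y /hn; exact: idealMr.
elim: n a Aa na {hn} => [|n IH] a Aa na hn; first by case: na; rewrite -(mul1r a); exact: hn.
have [h|/existsNP[y /not_implyP[my ny]]] := pselect (forall y, m y -> I (y * a)).
  by exists a.
apply: (IH (y * a)) => //; first exact: idealM.
by move=> z hz; rewrite mulrA [z * y]mulrC; apply: hn; exact: (ideal_mul_mem my hz).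
Qed.

Lemma primary_of_pow I n : is_ideal I -> I <> setT -> ideal_pow m n `<=` I ->
  is_primary I /\ radical I = m.
Proof.
move=> hI IT hn; have Im := local_proper hN hm hI IT.
have rad : radical I = m.
  apply/seteqP; split=> z; first by move=> [k /Im]; exact: primeX (local_prime hm).
  by move=> mz; exists n; apply: hn; exact: ideal_pow_mem.
split=> //; split=> // x y hxy; rewrite rad.
have [my|ny] := pselect (m y); first by right.
left; have [t ht] := local_unit hN hm ny.
by rewrite -(mul1r x) -ht -mulrA [y * x]mulrC; exact: idealM.
Qed.

(** Every ideal strictly larger than [I] contains a socle element of R/I, hence [u]; two such ideals
    cannot meet in [I]. *)
Lemma irreducible_of_socle I n u : is_ideal I -> I <> setT -> ideal_pow m n `<=` I ->
  socle_generator m I u -> is_irreducible I.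
Proof.
move=> hI IT hn hu; split=> // A B hA hB IE.
have mu y : m y -> I (y * u).
  by apply: (proj2 (hu u)); exists 1; rewrite mul1r subrr; exact: ideal0.
have key C : is_ideal C -> I `<=` C -> I <> C -> C u.
  move=> hC IC nIC; have [|v [Cv nv hv]] := exists_socle_elt hC hI hn.
    apply: contrapT => h; apply: nIC; apply/seteqP; split=> // z Cz.
    by apply: contrapT => nz; apply: h; exists z.
  have [r hr] := (hu v).1 hv.
  have nr : ~ m r.
    by move=> mr; apply: nv; rewrite -(subrK (r * u) v); apply: idealD => //; exact: mu.
  have [t ht] := local_unit hN hm nr.
  have -> : u = t * (v - (v - r * u)) by rewrite subKr mulrA ht mul1r.
  by apply: idealM => //; apply: idealB => //; exact: IC.
apply: contrapT => /not_orP[nA nB].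
have [IA IB] : I `<=` A /\ I `<=` B by split; rewrite IE => z [].
have Iu : I u by rewrite IE; split; exact: key.
have [y [ny hy]] : exists y, ~ I y /\ forall z, m z -> I (z * y).
  have [|v [_ nv hv]] := exists_socle_elt hT hI hn; last by exists v.
  by exists 1 => //; exact: ideal_proper.
have [r hr] := (hu y).1 hy; apply: ny; rewrite -(subrK (r * u) y).
by apply: idealD => //; exact: idealM.
Qed.

Variable J : set R.
Hypotheses (hJ : is_ideal J) (Jnz : exists2 c, J c & c <> 0).
Variable d : nat.
Hypothesis hd : has_krull_dim R d.
Hypothesis hsoc : forall vs, regseq J vs -> (forall y, y \in vs -> m y) -> size vs = d ->
  forall v v', J v -> J v' -> (forall y, m y -> seqm J vs (y * v)) ->
    (forall y, m y -> seqm J vs (y * v')) -> ~ seqm J vs v' ->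
    exists r, seqm J vs (v - r * v').

Variables (x : R) (ys : seq R).
Hypotheses (Jx : J x) (hms : forall y, y \in x :: ys -> m y) (rJ : regseq J (x :: ys))
  (sxy : size (x :: ys) = d).

Let Y := \prod_(y <- ys) y.
Let pw n := map (fun y : R => y ^+ n.+2) ys.
Let pI n := param_ideal J x ys n.

Lemma param_ideal_ideal n : is_ideal (pI n).
Proof. exact: mix_ideal. Qed.

Let rJn n : regseq J (map (fun y => y ^+ n.+2) (x :: ys)).
Proof. exact: (@regseq_map_expr R m hN hm J [::] (x :: ys)). Qed.

Let rT : regseq setT (x :: ys).
Proof. exact: (regseq_setT hN hm hF hJ Jnz). Qed.

Let rTn n : regseq setT (map (fun y => y ^+ n.+2) (x :: ys)).
Proof. exact: (@regseq_map_expr R m hN hm setT [::] (x :: ys)). Qed.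

Let rTx n : regseq setT (x :: pw n).
Proof. exact: (@regseq_map_expr R m hN hm setT [:: x] ys). Qed.

Let hmsn n y : y \in map (fun y => y ^+ n.+2) (x :: ys) -> m y.
Proof. by move=> /mapP[z zs ->]; apply: (idealX _ (local_ideal hm)); exact: hms. Qed.

Lemma param_idealP n z : pI n z <-> seqm J (map (fun y => y ^+ n.+2) (x :: ys)) (x * z).
Proof.
split=> [[w [j [hw Jj ->]]]|[w [j [hw Jj E]]]].
  exists (x * w), j; split=> //; last by rewrite mulrDr [in RHS]exprS mulrA.
  by apply: (seqm_scale (J := setT)) => // i _; exact: idealMr.
exists (z - x ^+ n.+1 * j), j; split=> //; last by rewrite subrK.
apply: (proj1 (rTx n)) => //.
suff -> : x * (z - x ^+ n.+1 * j) = w by apply: seqm_mono hw.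
by rewrite mulrBr E mulrA -exprS addrK.
Qed.

Lemma param_ideal_max n : pI n `<=` m.
Proof.
have hmi := local_ideal hm; move=> _ [w [j [hw Jj ->]]]; apply: idealD => //.
  apply: (seqm_in_max hm hT _ hw) => y hy; apply: (@hmsn n).
  by rewrite inE hy orbT.
by apply: idealMr => //; apply: idealX => //; apply: hms; rewrite inE eqxx.
Qed.

Lemma param_ideal_notT n : pI n <> setT.
Proof.
move=> h; apply: (local_notT hm); apply/seteqP; split=> // z _.
by apply: (@param_ideal_max n); rewrite h.
Qed.

Lemma param_ideal_decr n : pI n.+1 `<=` pI n.
Proof.
move=> _ [w [j [hw Jj ->]]]; apply: (idealD (param_ideal_ideal n)).
  exists w, 0; rewrite mulr0 addr0; split=> //; last exact: ideal0.
  apply: (seqm_min _ _ hw); first exact: seqm_ideal.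
  move=> _ i /mapP[y yys ->] _; rewrite exprSr -mulrA; apply: seqm_mem => //.
  by apply/mapP; exists y.
exists 0, (x * j); split; [by apply: ideal0; exact: seqm_ideal|exact: idealM|].
by rewrite exprSr; ring.
Qed.

Lemma param_ideal_pow n : pI n `<=` ideal_pow m n.
Proof.
have hP := ideal_pow_ideal m n; move=> _ [w [j [hw Jj ->]]]; apply: idealD => //.
  apply: (seqm_min hP _ hw) => _ i /mapP[y yys ->] _.
  rewrite -addn2 exprD -mulrA; apply: idealMr => //; apply: ideal_pow_mem.
  by apply: hms; rewrite inE yys orbT.
rewrite exprSr -mulrA; apply: idealMr => //; apply: ideal_pow_mem.
by apply: hms; rewrite inE eqxx.
Qed.

Lemma param_ideal_primary n : exists k, ideal_pow m k `<=` pI n.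
Proof.
apply: (regular_primary hN hm hd (rTn n)); rewrite ?size_map //; first exact: param_ideal_ideal.
have hI := param_ideal_ideal n.
apply: seqm_min => // _ j /mapP[y yys ->] _; apply: (idealMr _ hI).
move: yys; rewrite inE => /orP[/eqP->|yys].
  exists 0, x; rewrite add0r -exprSr; split=> //; by apply: ideal0; exact: seqm_ideal.
exists (y ^+ n.+2), 0; rewrite mulr0 addr0; split=> //; last exact: ideal0.
by rewrite -[y ^+ _]mulr1; apply: seqm_mem => //; apply/mapP; exists y.
Qed.

Lemma param_ideal_mul n k z : pI n z -> pI (n + k) (z * (x * Y) ^+ k).
Proof.
move=> [w [j [hw Jj ->]]].
exists (x ^+ k * (w * Y ^+ k)), (j * Y ^+ k); split.
- apply: idealM; first exact: seqm_ideal.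
  have := seqm_mulprod k hT hw.
  suff -> : map (fun y => y ^+ (n.+2 + k)) ys = pw (n + k) by [].
  by apply: eq_map => y; rewrite !addSn.
- exact: idealMr.
by rewrite exprMn -addSn exprD; ring.
Qed.

Lemma exists_param_socle : exists u, ~ pI 0 u /\ forall y, m y -> pI 0 (y * u).
Proof.
have [k hk] := param_ideal_primary 0.
have [|u [_ nu hu]] := exists_socle_elt hT (param_ideal_ideal 0) hk; last by exists u.
exists 1 => //; exact: (ideal_proper (param_ideal_ideal 0) (@param_ideal_notT 0)).
Qed.

Lemma param_socle_generator u n : ~ pI 0 u -> (forall y, m y -> pI 0 (y * u)) ->
  socle_generator m (pI n) (u * (x * Y) ^+ n).
Proof.
move=> nu hu; set un := u * _.
have hI := param_ideal_ideal n.
have mun y : m y -> pI n (y * un).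
  by move=> /hu /param_ideal_mul - /(_ n); rewrite mulrA add0n.
have nun : ~ pI n un.
  move=> /param_idealP h; apply/nu/param_idealP.
  (* In [J], where the sequence itself is regular, cancellation is exact: multiplier 1, [B = 0], and
     exponents n and n + 2 go down to 0 and 2. Here [x] counts among the variables. *)
  have := @cancel_powers R m hN hm J J 1 0 1 n [::] (x :: ys) (x * u) hJ hJ.
  rewrite big_cons expr1n mul1r expr0 mulr1; apply=> //.
  - move=> y us k z _ _ [hy _] Jz; rewrite expr0 mul1r mul1r; exact: (regular_expr hJ hy).
  - exact: idealMr.
  - by rewrite cat0s addn1 -[x * u * _]mulrA.
move=> z; split=> [hz|[r hr] y my]; last first.
  rewrite -(subrK (r * un) z) mulrDr; apply: (idealD hI); first exact: (idealM _ hI hr).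
  by rewrite mulrCA; exact: (idealM _ hI (mun _ my)).
have [||||||r hr] := @hsoc _ (rJn n) (@hmsn n) _ (x * z) (x * un).
- by rewrite size_map.
- exact: idealMr.
- exact: idealMr.
- by move=> y my; rewrite mulrCA; apply/param_idealP/hz.
- by move=> y my; rewrite mulrCA; apply/param_idealP/mun.
- by move/param_idealP.
by exists r; apply/param_idealP; rewrite mulrBr [x * (r * un)]mulrCA.
Qed.

Lemma condition_A_of_parameters (N : nat -> set R) c f f' : c <> 0 ->
  (forall e, is_ideal (N e)) ->
  (forall e, ideal_bracket J (p ^ e) `<=` N e) ->
  (forall e z, N e z -> ideal_bracket J (p ^ e) (z * Y ^+ (p ^ (f' + e)))) ->
  (forall e y, y \in ys -> kills m (N e) (c * y ^+ (p ^ (f + e)))) ->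
  condition_A p m.
Proof.
move=> nc hNe JN NJ kill; have [u [nu hu]] := exists_param_socle.
pose t0 := (p ^ f + p ^ f')%N.
exists pI, (fun n => u * (x * Y) ^+ n), t0; split.
- move=> n _; have hI := param_ideal_ideal n; have nT := @param_ideal_notT n.
  have [k hk] := param_ideal_primary n; have hs := param_socle_generator n nu hu.
  have [hpr hrad] := primary_of_pow hI nT hk.
  by split=> //; [exact: (irreducible_of_socle hI nT hk hs)|exact: param_ideal_decr].
- move=> n; exists n.+1; split=> // z /param_ideal_decr; exact: param_ideal_pow.
- by move=> n _; exact: param_ideal_primary.
- by rewrite addn_gt0 (pexp_gt0 charRp).
move=> t e t0t; apply/seteqP; split=> r; rewrite /ideal_colon /=.
  (* A further power q' of the relation is taken first; then [c ^+ size ys] multiplies r^q' for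
     every q', and tight closure of I_t0^[q] removes it. *)
  move=> h; apply: (tight_closure hN hm hF (c := c ^+ size ys)) => [||e'].
  - exact: ideal_bracket_ideal.
  - exact: (domain_exp hN hm hF).
  apply: ideal_bracket_comp; rewrite exprMn -exprM -expnD mulrA.
  have := @uniform_multiplier R m p charRp hN hm J x ys u N c f f' hJ Jx hms rT
    hNe JN NJ kill t (e + e')%N (r ^+ (p ^ e')).
  by apply; rewrite {2}expnD exprM -exprMn; exact: ideal_bracket_expr.
have hB := ideal_bracket_ideal (pI t) (p ^ e).
(* For the reverse inclusion, [(x * Y) ^+ (t - t0)] maps I_t0 into I_t and u_t0 to u_t. *)
suff h : ideal_bracket (pI t0) (p ^ e) `<=`
    [set z | ideal_bracket (pI t) (p ^ e) (z * ((x * Y) ^+ (t - t0)) ^+ (p ^ e))].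
  by move=> /h /=; rewrite -mulrA -exprMn -mulrA -exprD subnKC.
apply: ideal_bracket_min.
  split=> [|y z hy hz|s y hy] /=; first by rewrite mul0r; exact: ideal0 hB.
    by rewrite mulrDl; exact: idealD hB hy hz.
  by rewrite -mulrA; exact: idealM hB hy.
move=> z hz /=; rewrite -exprMn; apply: ideal_bracket_mem.
by rewrite -(subnKC t0t); have := param_ideal_mul (t - t0) hz; rewrite !subnKC.
Qed.

End ConditionA.

(** * Socles of quotients of a canonical module *)

Section Submodules.
Variable R : comNzRingType.

Lemma linear_of_fun (U V : lmodType R) (f : U -> V) :
  (forall a u v, f (a *: u + v) = a *: f u + f v) -> exists g : {linear U -> V}, g =1 f.
Proof.
move=> hf; pose fL := GRing.isLinear.Build R U V _ f hf.
by pose g : {linear U -> V} := HB.pack f fL; exists g.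
Qed.

(** Bundled so that the subtype below is an [lmodType], as the test modules of [injective_module]
    have to be. *)
Record submod (V : lmodType R) := Submod {
  submod_set : set V;
  submod0 : submod_set 0;
  submodP : forall a u v, submod_set u -> submod_set v -> submod_set (a *: u + v) }.

Definition submod_pred (V : lmodType R) (S : submod V) : {pred V} := fun x => `[< submod_set S x >].

Fact submod_pred_closed (V : lmodType R) (S : submod V) : submod_closed (submod_pred S).
Proof.
split=> [|a u v]; rewrite ?unfold_in /submod_pred; first exact/asboolP/submod0.
by move=> /asboolP hu /asboolP hv; apply/asboolP; exact: submodP.
Qed.

HB.instance Definition _ (V : lmodType R) (S : submod V) :=
  GRing.isSubmodClosed.Build R V (submod_pred S) (submod_pred_closed S).

Record submod_of (V : lmodType R) (S : submod V) := SubmodOf {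
  submod_val :> V; _ : submod_val \in submod_pred S }.

HB.instance Definition _ (V : lmodType R) (S : submod V) :=
  [isSub of submod_of S for @submod_val V S].
HB.instance Definition _ (V : lmodType R) (S : submod V) := [Choice of submod_of S by <:].
HB.instance Definition _ (V : lmodType R) (S : submod V) :=
  [SubChoice_isSubLmodule of submod_of S by <:].

Lemma submod_valP (V : lmodType R) (S : submod V) (x : submod_of S) : submod_set S (submod_val x).
Proof. by case: x => x /= /asboolP. Qed.

Lemma submod_val_ex (V : lmodType R) (S : submod V) x : submod_set S x ->
  exists y : submod_of S, submod_val y = x.
Proof. by move=> /asboolP hx; exists (SubmodOf hx). Qed.

Lemma submod_val_inj (V : lmodType R) (S : submod V) : injective (@submod_val V S).
Proof. exact: val_inj. Qed.

Lemma submod_val_linear (V : lmodType R) (S : submod V) a (u v : submod_of S) :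
  submod_val (a *: u + v) = a *: submod_val u + submod_val v.
Proof. by []. Qed.

Lemma submod_val0 (V : lmodType R) (S : submod V) : submod_val (0 : submod_of S) = 0.
Proof. by []. Qed.

(* [Phi] is the graph of a linear map defined on a submodule of [B]. *)
Lemma injective_extend (B E : lmodType R) (Phi : B -> E -> Prop) :
  injective_module E -> Phi 0 0 ->
  (forall b e e', Phi b e -> Phi b e' -> e = e') ->
  (forall r b b' e e', Phi b e -> Phi b' e' -> Phi (r *: b + b') (r *: e + e')) ->
  exists g : {linear B -> E}, forall b e, Phi b e -> g b = e.
Proof.
move=> hE h0 hfun hlin.
have hS0 : exists e, Phi 0 e by exists 0.
have hSl a u v : (exists e, Phi u e) -> (exists e, Phi v e) -> exists e, Phi (a *: u + v) e.
  by move=> [e he] [e' he']; exists (a *: e + e'); exact: hlin.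
pose S := @Submod B [set b | exists e, Phi b e] hS0 hSl.
have hf (x : submod_of S) : {e | Phi (submod_val x) e} by apply/cid; exact: (submod_valP x).
pose f x := sval (hf x).
have fP x : Phi (submod_val x) (f x) by exact: svalP (hf x).
have flin a u v : f (a *: u + v) = a *: f u + f v.
  by apply: hfun (fP _) _; rewrite submod_val_linear; exact: hlin.
have [fl fE] := linear_of_fun flin.
have [il iE] := @linear_of_fun (submod_of S) B (@submod_val B S) (@submod_val_linear B S).
have [|g hg] := hE _ _ il fl.
  by move=> x y; rewrite !iE; exact: submod_val_inj.
exists g => b e hb; have [|x xE] := @submod_val_ex B S b; first by exists e.
by rewrite -xE -iE hg fE; apply: hfun (fP x) _; rewrite xE.
Qed.

End Submodules.

(** * Rees's theorem: M/(rs)M in the cohomology of an injective resolution *)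

Section Rees.
Variables (R : comNzRingType) (M : lmodType R) (E : injective_resolution M).
Variables (f : {linear M -> R^o}) (J : set R).
Hypotheses (f_inj : injective f) (fJ : range f = J).
Implicit Types (r x y z : R) (rs : seq R) (v w : M).

Local Notation d i := (ir_d E i).

(** These elements form Hom(R/(rs), V). *)
Definition killed (V : lmodType R) rs (e : V) := forall x, x \in rs -> x *: e = 0.

Lemma killed_cons (V : lmodType R) x rs (e : V) :
  killed (x :: rs) e <-> x *: e = 0 /\ killed rs e.
Proof.
split=> [h|[h1 h2] y]; last by rewrite inE => /orP[/eqP->|/h2].
by split=> [|y yrs]; apply: h; rewrite inE ?eqxx ?yrs ?orbT.
Qed.

Lemma killed_linear (V : lmodType R) rs r (e e' : V) :
  killed rs e -> killed rs e' -> killed rs (r *: e + e').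
Proof. by move=> h h' y hy; rewrite scalerDr scalerA mulrC -scalerA h // h' // scaler0 addr0. Qed.

Lemma killed0 (V : lmodType R) rs : killed rs (0 : V).
Proof. by move=> x _; rewrite scaler0. Qed.

Lemma killedB (V : lmodType R) rs (e e' : V) : killed rs e -> killed rs e' -> killed rs (e - e').
Proof.
by move=> h h' y hy; rewrite scalerBr h // h' // subr0.
Qed.

Lemma killedZ (V : lmodType R) rs r (e : V) : killed rs e -> killed rs (r *: e).
Proof. by move=> h y hy; rewrite scalerA mulrC -scalerA h // scaler0. Qed.

Lemma killed_map (V W : lmodType R) (g : {linear V -> W}) rs e : killed rs e -> killed rs (g e).
Proof. by move=> h y hy; rewrite -linearZ h // linear0. Qed.

Lemma killed_seqm (V : lmodType R) rs (e : V) z : killed rs e -> seqm setT rs z -> z *: e = 0.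
Proof.
elim: rs z => [|x rs IH] z /=; first by move=> _ ->; rewrite scale0r.
move=> /killed_cons[xe he] [w [j [hw _ ->]]].
by rewrite scalerDl IH // mulrC -scalerA xe scaler0 addr0.
Qed.

Lemma ir_dd i (e : ir_obj E i) : d i.+1 (d i e) = 0.
Proof. by apply: (proj2 (@ir_exactS R M E i _)); exists e. Qed.

Lemma ir_d_aug v : d 0 (ir_aug E v) = 0.
Proof. by apply: (proj2 (@ir_exact0 R M E _)); exists v. Qed.

(** The map w + x r |-> r e on the ideal (x, rs) is well defined because [x] is regular modulo [rs];
    the value at 1 of an extension to R is the required element. *)
Lemma injective_divisible (V : lmodType R) x rs (e : V) : injective_module V ->
  regseq setT (x :: rs) -> killed rs e -> exists2 e', killed rs e' & x *: e' = e.
Proof.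
move=> hV [hx _] he; have hS := seqm_ideal rs (@ideal_setT R).
pose Phi (b : R^o) (u : V) := exists (w r : R), [/\ seqm setT rs w, b = w + x * r :> R & u = r *: e].
have [|b u u'|r b b' u u'|g hg] := @injective_extend R R^o V Phi hV.
- by exists 0, 0; rewrite scale0r mulr0 addr0; split=> //; exact: ideal0.
- move=> [w [r [hw -> ->]]] [w' [r' [hw' E' ->]]]; apply/eqP; rewrite -subr_eq0 -scalerBl.
  apply/eqP/(killed_seqm he)/hx => //; rewrite mulrBr.
  have -> : x * r - x * r' = w' - w by rewrite -[x * r](addKr w) E'; ring.
  exact: idealB.
- move=> [w [s [hw -> ->]]] [w' [s' [hw' -> ->]]]; exists (r * w + w'), (r * s + s').
  split; [by apply: idealD => //; exact: idealM| |by rewrite scalerDl scalerA].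
  by rewrite /GRing.scale /=; ring.
have gE (a : R) u : Phi a u -> a *: g 1 = u.
  by move=> /hg <-; rewrite -linearZ; congr (g _); rewrite /GRing.scale /= mulr1.
exists (g 1).
  move=> y hy; apply: gE; exists y, 0; rewrite mulr0 addr0 scale0r; split=> //.
  by rewrite -(mulr1 y); apply: seqm_mem.
by apply: gE; exists 0, 1; rewrite mulr1 add0r scale1r; split=> //; exact: ideal0.
Qed.

(* The class of [v] under the isomorphism of [M/(rs)M] with the cohomology, in degree
   [size rs], of the subcomplex of [E] killed by [rs]. *)
Fixpoint cohomology_class rs : M -> ir_obj E (size rs) -> Prop :=
  match rs return M -> ir_obj E (size rs) -> Prop with
  | [::] => fun v e => e = ir_aug E v
  | x :: rs' => fun v e => exists e0 : ir_obj E (size rs'),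
      [/\ killed rs' e0, cohomology_class v (x *: e0) & e = d (size rs') e0]
  end.

Lemma class_linear rs r v w e e' : @cohomology_class rs v e -> @cohomology_class rs w e' ->
  cohomology_class (r *: v + w) (r *: e + e').
Proof.
elim: rs v w e e' => [|x rs IH] v w e e' /=.
  by move=> -> ->; rewrite -linearP.
move=> [a [ka ha ->]] [b [kb hb ->]]; exists (r *: a + b); split; last by rewrite linearP.
  exact: killed_linear.
by rewrite scalerDr scalerA mulrC -scalerA; exact: IH.
Qed.

Lemma class_scale rs r v e : @cohomology_class rs v e -> cohomology_class (r *: v) (r *: e).
Proof.
move=> h; have h0 : @cohomology_class rs 0 0.
  by have := class_linear (-1) h h; rewrite !scaleN1r !addNr.
by have := class_linear r h h0; rewrite !addr0.
Qed.

Lemma classB rs v w e e' : @cohomology_class rs v e -> @cohomology_class rs w e' ->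
  cohomology_class (v - w) (e - e').
Proof. by move=> h h'; have := class_linear (-1) h' h; rewrite !scaleN1r addrC [- e' + _]addrC. Qed.

Lemma class_cocycle rs v e : @cohomology_class rs v e -> killed rs e /\ d (size rs) e = 0.
Proof.
elim: rs v e => [|x rs IH] v e /=; first by move=> ->; split; [|exact: ir_d_aug].
move=> [a [ka /IH[_ da] ->]]; split; last exact: ir_dd.
apply/killed_cons; split; first by rewrite -linearZ.
exact: killed_map.
Qed.

Lemma class_exists rs v : regseq setT rs -> exists e, @cohomology_class rs v e.
Proof.
elim: rs => [|x rs IH] /=; first by exists (ir_aug E v).
move=> [hx rrs]; have [e he] := IH rrs; have [ke _] := class_cocycle he.
have [e' ke' xe'] := injective_divisible (@ir_injective R M E (size rs)) (conj hx rrs) ke.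
by exists (d _ e'), e'; rewrite xe'.
Qed.

Let hJ : is_ideal J.
Proof.
rewrite -fJ; split=> [|_ _ [v _ <-] [w _ <-]|r _ [v _ <-]].
- by exists 0; rewrite ?linear0.
- by exists (v + w); rewrite ?linearD.
- by exists (r *: v); rewrite ?linearZ.
Qed.

Let Jf v : J (f v). Proof. by rewrite -fJ; exists v. Qed.

Lemma class_of_seqm rs v : regseq setT rs -> seqm J rs (f v) -> @cohomology_class rs v 0.
Proof.
move=> rrs hv.
have h0 : @cohomology_class rs 0 0.
  by have [e he] := class_exists 0 rrs; have := class_scale 0 he; rewrite !scale0r.
have : [set z | exists2 w, f w = z & @cohomology_class rs w 0] (f v).
  apply: (seqm_min _ _ hv) => [|x j xrs].
    split=> [|_ _ [w <- hw] [w' <- hw']|r _ [w <- hw]].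
    - by exists 0; rewrite ?linear0.
    - exists (w + w'); first by rewrite linearD.
      by have := class_linear 1 hw hw'; rewrite !scale1r addr0.
    - exists (r *: w); first by rewrite linearZ.
      by have := class_scale r hw; rewrite scaler0.
  rewrite -fJ => -[w _ <-]; exists (x *: w); first by rewrite linearZ.
  have [e he] := class_exists w rrs; have [ke _] := class_cocycle he.
  by have := class_scale x he; rewrite ke.
by move=> [w /f_inj <-].
Qed.

(** The preimages under multiplication that enter a class are not unique; with [coboundary_class],
    this shows that the ambiguity consists exactly of coboundaries. Dividing a primitive [b] of x a
    by [x] gives the correction that makes [a] killed by [x] too. *)
Lemma class_coboundary x rs e : regseq setT (x :: rs) -> @cohomology_class (x :: rs) 0 e ->
  exists2 a, killed (x :: rs) a & d (size rs) a = e.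
Proof.
elim: rs x e => [|y rs IH] x e rrs /= [a [ka ha ->]].
  by exists a => //; apply/killed_cons; rewrite ha linear0.
have [b kb db] := IH y _ (proj2 rrs) ha.
have [b' kb' xb'] := injective_divisible (@ir_injective R M E (size rs)) 
   (x := x) (rs := y :: rs) rrs kb.
exists (a - d _ b'); last by rewrite linearB /= ir_dd subr0.
apply/killed_cons; split; first by rewrite scalerBr -linearZ xb' db subrr.
by apply: killedB => //; exact: killed_map.
Qed.

Lemma coboundary_class x rs a : regseq setT rs -> killed (x :: rs) a ->
  @cohomology_class (x :: rs) 0 (d (size rs) a).
Proof.
move=> rrs /killed_cons[xa ka]; exists a; split=> //; rewrite xa.
by apply: class_of_seqm => //; rewrite linear0; apply: ideal0; exact: seqm_ideal.
Qed.

(* Exactness of the subcomplex killed by [rs] away from degree [size rs]. *)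
Lemma killed_complex rs : regseq setT rs -> regseq J rs ->
  [/\ forall v, @cohomology_class rs v 0 -> seqm J rs (f v),
      forall e, killed rs e -> d (size rs) e = 0 -> exists v, @cohomology_class rs v e,
      forall e : ir_obj E 0, size rs <> 0%N -> killed rs e -> d 0 e = 0 -> e = 0
    & forall i (e : ir_obj E i.+1), i.+1 <> size rs -> killed rs e -> d i.+1 e = 0 ->
        exists2 a : ir_obj E i, killed rs a & d i a = e].
Proof.
elim: rs => [_ _|x rs IH rT rJ].
  split=> //=.
  - by move=> v /esym; rewrite -(linear0 (ir_aug E)) => /ir_aug_inj->; rewrite linear0.
  - by move=> e _ /(proj1 (@ir_exact0 R M E _))[v <-]; exists v.
  - by move=> i e _ _ /(proj1 (@ir_exactS R M E i _))[a <-]; exists a.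
have [h4 h5 h60 h6] := IH (proj2 rT) (proj2 rJ); split.
- move=> v /= [e [ke he /esym de]]; have [w hw] := h5 e ke de.
  have := classB he (class_scale x hw); rewrite subrr => /h4 h.
  by exists (f (v - x *: w)), (f w); split=> //; rewrite linearB linearZ /= subrK.
- move=> e /killed_cons[xe ke] de /=.
  have [|a ka ad] := h6 (size rs) e _ ke de; first by move/eqP; rewrite gtn_eqF.
  have [||v hv] := h5 (x *: a); first exact: killedZ.
    by rewrite linearZ /= ad.
  by exists v, a.
- move=> e _ /killed_cons[xe ke] de.
  have [s0|s0] := pselect (size rs = 0%N); last exact: h60.
  have := (proj1 rJ); case: (rs) s0 => // _ hx.
  have [v ve] := (proj1 (@ir_exact0 R M E _)) de.
  suff v0 : v = 0 by rewrite -ve v0 linear0.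
  apply: f_inj; rewrite linear0; apply: (hx (f v) (Jf v)) => /=.
  rewrite -[x * f v]/(x *: f v) -linearZ.
  suff -> : x *: v = 0 by rewrite linear0.
  by apply: (@ir_aug_inj _ _ E); rewrite linearZ /= ve xe linear0.
move=> i e /= ni /killed_cons[xe ke] de.
have [a ka ad] : exists2 a : ir_obj E i, killed rs a & d i a = e.
  have [si|] := pselect (i.+1 = size rs); last by move=> h; exact: h6.
  have rJx := proj1 rJ; have rrT := proj2 rT.
  case: (rs) si h4 h5 ke rJx rrT => // y rs' [si]; subst i => h4' h5' ke' rJx rrT.
  have [v hv] := h5' e ke' de.
  have hv0 : @cohomology_class (y :: rs') v 0.
    apply: class_of_seqm => //; apply: rJx => //.
    have := class_scale x hv; rewrite xe => /h4'; rewrite linearZ; exact.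
  have := classB hv hv0; rewrite subrr subr0; exact: class_coboundary.
have nis : i <> size rs by move=> h; apply: ni; rewrite h.
have kxa : killed rs (x *: a) by exact: killedZ.
have dxa : d i (x *: a) = 0 by rewrite linearZ /= ad.
case: i e ni ke de xe a ka ad nis kxa dxa => [|i] e ni ke de xe a ka ad nis kxa dxa.
  exists a => //; apply/killed_cons; split=> //; apply: h60 => // h; exact: nis.
have [b kb db] := h6 i _ nis kxa dxa.
have [b' kb' xb'] := injective_divisible (@ir_injective R M E (i)) rT kb.
exists (a - d _ b'); last by rewrite linearB /= ir_dd subr0.
apply/killed_cons; split; first by rewrite scalerBr -linearZ xb' db subrr.
by apply: killedB => //; exact: killed_map.
Qed.

(** Injectivity of [S] over R/(rs), without that ring: [Phi] is the graph of a partial map vanishing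
    on (rs)B. *)
Definition relatively_injective rs i (S : set (ir_obj E i)) :=
  forall (B : lmodType R) (Phi : B -> ir_obj E i -> Prop), Phi 0 0 ->
  (forall b e e', Phi b e -> Phi b e' -> e = e') ->
  (forall r b b' e e', Phi b e -> Phi b' e' -> Phi (r *: b + b') (r *: e + e')) ->
  (forall b e, Phi b e -> S e) -> (forall b x, x \in rs -> Phi (x *: b) 0) ->
  exists2 g : {linear B -> ir_obj E i}, forall b, S (g b) & forall b e, Phi b e -> g b = e.

Lemma relatively_injective_killed rs i : relatively_injective rs [set e : ir_obj E i | killed rs e].
Proof.
move=> B Phi h0 hfun hlin hS hx; have [g hg] := 
  injective_extend (@ir_injective R M E i) h0 hfun hlin.
by exists g => // b x xrs; rewrite -linearZ; apply/hg/hx.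
Qed.

(** The injective module [Z] of cocycles splits off the module C of killed elements by a projection
    [pr], so the image of the differential is isomorphic to the complement of [Z]. A partial map to
    the image lifts to that complement and extends inside C. *)
Lemma relatively_injective_image rs i (Z := [set e : ir_obj E i | killed rs e /\ d i e = 0]) :
  relatively_injective rs Z ->
  relatively_injective rs [set e | exists2 a, killed rs a & d i a = e].
Proof.
move=> hZ.
have hk a (u v : ir_obj E i) : killed rs u -> killed rs v -> killed rs (a *: u + v).
  exact: killed_linear.
pose C := @Submod R (ir_obj E i) [set e | killed rs e] (@killed0 _ rs) hk.
pose PhiC (b : submod_of C) e := Z (submod_val b) /\ e = submod_val b.
have [|b e e' [_ ->] [_ ->]//|r b b' e e' [[kb db] ->] [[kb' db'] ->]|b e [hb ->]//|b x xrs|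
    pr prZ prE] := hZ _ PhiC.
- by split=> //; split; [exact: killed0|rewrite linear0].
- by split=> //; split; [exact: killed_linear|rewrite submod_val_linear linearP /= db db' scaler0 addr0].
- have -> : x *: b = 0.
    apply: (@submod_val_inj R _ C); rewrite -[x *: b]addr0 submod_val_linear.
    by rewrite (submod_valP b x xrs) add0r.
  by split=> //; split; [exact: killed0|rewrite linear0].
have prK (b : submod_of C) : d i (submod_val b) = 0 -> pr b = submod_val b.
  by move=> db; apply: prE; split=> //; split=> //; exact: (submod_valP b).
move=> B Phi h0 hfun hlin hS hx.
pose Psi (b : B) e := exists2 c : submod_of C, e = submod_val c - pr c & Phi b (d i (submod_val c)).
have [|b e e' [c -> hc] [c' -> hc']|r b b' e e' [c -> hc] [c' -> hc']|b e [c -> _] x xrs|b x xrs|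
    g kg gE] :=
   @relatively_injective_killed rs i B Psi.
- exists 0; rewrite submod_val0; last by rewrite linear0.
  by rewrite linear0 subr0.
- have cc' : submod_val ((-1) *: c' + c) = submod_val c - submod_val c'.
    by rewrite submod_val_linear scaleN1r addrC.
  have := prK ((-1) *: c' + c); rewrite cc' linearB /= (hfun _ _ _ hc hc') subrr => /(_ erefl).
  rewrite linearP /= scaleN1r addrC => E1.
  have -> : submod_val c = pr c - pr c' + submod_val c' by rewrite E1 subrK.
  by rewrite addrAC [pr c - _]addrC addrK addrC.
- exists (r *: c + c'); first by rewrite submod_val_linear linearP scalerBr opprD addrACA.
  by rewrite submod_val_linear linearP; exact: hlin.
- have [kp _] := prZ c; rewrite scalerBr (submod_valP c) // kp // subrr //.
- exists 0; rewrite submod_val0; last by rewrite linear0; exact: hx.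
  by rewrite linear0 subr0.
have hd r (u u1 : B) : d i (g (r *: u + u1)) = r *: d i (g u) + d i (g u1) by rewrite !linearP.
have [dg dgE] := linear_of_fun hd; exists dg => [b|b e hb].
  by rewrite dgE; exists (g b) => //; exact: kg.
rewrite dgE; have [a ka ad] := hS _ _ hb; have [c cE] := @submod_val_ex R _ C a ka.
rewrite (gE b (submod_val c - pr c)); last by exists c => //; rewrite cE ad.
by have [_ dp] := prZ c; rewrite linearB /= dp subr0 cE.
Qed.

(** Below degree [size rs] the killed complex is exact: there are no cocycles in degree 0, and those
    of degree i + 1 are the image of degree i, so injectivity propagates upwards. *)
Lemma relatively_injective_cocycles rs i : regseq setT rs -> regseq J rs -> (i < size rs)%N ->
  relatively_injective rs [set e : ir_obj E i | killed rs e /\ d i e = 0].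
Proof.
move=> rT rJ; have [_ _ h0 h] := killed_complex rT rJ; elim: i => [|i IH] hi.
  move=> B Phi p0 hfun hlin hS hx.
  have [|g gE] := @linear_of_fun R B (ir_obj E 0) (fun=> 0).
    by move=> *; rewrite scaler0 addr0.
  exists g => [b|b e hb]; first by rewrite gE; split; [exact: killed0|rewrite linear0].
  have [ke de] := hS _ _ hb; rewrite gE; apply/esym/h0 => // s0.
  by rewrite s0 in hi.
suff -> : [set e : ir_obj E i.+1 | killed rs e /\ d i.+1 e = 0] =
    [set e | exists2 a, killed rs a & d i a = e].
  by apply/relatively_injective_image/IH/ltnW.
apply/seteqP; split=> e [].
  by move=> ke de; apply: h => // E1; rewrite E1 ltnn in hi.
by move=> a ka <-; split; [exact: killed_map|exact: ir_dd].
Qed.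

Variables (m : set R) (hmi : is_ideal m).

(** For any class [e] of [v], m carries [e] into the coboundaries. These are injective over R/(rs),
    so y |-> y e extends from m to R, and subtracting the value at 1 gives a class killed by m. *)
Lemma socle_class rs v : regseq setT rs -> regseq J rs -> (0 < size rs)%N ->
  (forall y, y \in rs -> m y) -> (forall y, m y -> seqm J rs (y * f v)) ->
  exists2 e, @cohomology_class rs v e & forall y, m y -> y *: e = 0.
Proof.
case: rs => // x rs rT rJ _ hms hv.
have [e he] := class_exists v rT; have [ke _] := class_cocycle he.
have hd y : m y -> exists2 a, killed (x :: rs) a & d (size rs) a = y *: e.
  move=> my; apply: class_coboundary => //.
  have := classB (class_scale y he) (class_of_seqm (v := y *: v) rT _).
  by rewrite subrr subr0; apply; rewrite linearZ; exact: hv.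
pose Phi (a : R^o) u := m a /\ u = (a : R) *: e.
have hI := relatively_injective_image (relatively_injective_cocycles rT rJ (leqnn _)).
have [|b u u' [_ ->] [_ ->]//|r b b' u u' [mb ->] [mb' ->]|b u [mb ->]|b y hy|g gS gE] :=
  hI R^o Phi.
- by split; [exact: ideal0|rewrite scale0r].
- split; last by rewrite scalerDl scalerA.
  by apply: idealD => //; exact: idealM.
- exact: hd.
- split; first by apply: idealMr => //; exact: hms.
  by rewrite -[y *: b]/(y * (b : R)) mulrC -scalerA ke // scaler0.
have [a ka da] := gS 1.
exists (e - g 1).
  by have := classB he (coboundary_class (proj2 rT) ka); rewrite da subr0; exact.
move=> y my; rewrite scalerBr -linearZ (gE _ (y *: e)) ?subrr //; split; last first.
  by rewrite /GRing.scale /= mulr1.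
by rewrite /GRing.scale /= mulr1.
Qed.

Variables (k : fieldType) (res : {rmorphism R -> k}).
Hypotheses (hres_surj : forall c : k, exists x, res x = c) (hres_ker : forall x, m x <-> res x = 0)
  (hmu : forall x, ~ m x -> exists y, y * x = 1).

Lemma residue_map (V : lmodType R) (e : V) : (forall y, m y -> y *: e = 0) ->
  exists phi : {linear restr_scalars res -> V}, forall r, phi (res r) = r *: e.
Proof.
move=> he; pose lift (y : k) : R := sval (cid (hres_surj y)).
have liftK (c : k) : res (lift c) = c by exact: svalP (cid (hres_surj c)).
have hr r r' : res r = res r' -> r *: e = r' *: e.
  move=> E1; apply/eqP; rewrite -subr_eq0 -scalerBl; apply/eqP/he/hres_ker.
  by rewrite rmorphB E1 subrr.
have [|phi phiE] := @linear_of_fun R (restr_scalars res) V (fun c : restr_scalars res => lift c *: e).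
  move=> a u v; rewrite scalerA -scalerDl; apply: hr.
  by rewrite rmorphD rmorphM !liftK.
by exists phi => r; rewrite phiE; apply: hr; rewrite liftK.
Qed.

Lemma residue_map_socle (V : lmodType R) (phi : {linear restr_scalars res -> V}) y c :
  m y -> y *: phi c = 0.
Proof.
move=> /hres_ker my; rewrite -linearZ.
suff -> : y *: c = 0 by rewrite linear0.
by rewrite -[y *: c]/(res y * (c : k)) my mul0r.
Qed.

(** The two socle elements become maps from k, hence multiples [r] and [r'] of the generator of Ext
    modulo coboundaries. If [r'] were in m, the class of [v'] would be a coboundary; so [r'] is a
    unit and r/r' is the required multiplier. *)
Lemma canonical_socle rs v v' : regseq setT rs -> regseq J rs -> (0 < size rs)%N ->
  (forall y, y \in rs -> m y) -> ext_rank1 (restr_scalars res) E (size rs) ->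
  (forall y, m y -> seqm J rs (y * f v)) -> (forall y, m y -> seqm J rs (y * f v')) ->
  ~ seqm J rs (f v') -> exists r, seqm J rs (f v - r * f v').
Proof.
case: rs => // x rs rT rJ s0 hms [phi0 [_ _ phiP]] hv hv' nv'.
have [e he se] := socle_class rT rJ s0 hms hv.
have [e' he' se'] := socle_class rT rJ s0 hms hv'.
have [phi phiE] := residue_map se; have [phi' phiE'] := residue_map se'.
have rsurj (c : restr_scalars res) : exists r, c = res r.
  by have [r <-] := hres_surj c; exists r.
have [r [psi psiE]] : exists r, coboundary (fun c => phi c - r *: phi0 c).
  apply: phiP => c; have [t ->] := rsurj c.
  by rewrite phiE linearZ /= (proj2 (class_cocycle he)) scaler0.
have [r' [psi' psiE']] : exists r, coboundary (fun c => phi' c - r *: phi0 c).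
  apply: phiP => c; have [t ->] := rsurj c.
  by rewrite phiE' linearZ /= (proj2 (class_cocycle he')) scaler0.
pose one : restr_scalars res := res 1.
have E1 : e = d (size rs) (psi one) + r *: phi0 one.
  by rewrite -psiE phiE scale1r subrK.
have E1' : e' = d (size rs) (psi' one) + r' *: phi0 one.
  by rewrite -psiE' phiE' scale1r subrK.
have [h4 _ _ _] := killed_complex rT rJ.
have ksoc (p : {linear restr_scalars res -> ir_obj E (size rs)}) : killed (x :: rs) (p one).
  by move=> y /hms; exact: residue_map_socle.
have [mr'|nr'] := pselect (m r').
  case: nv'; apply: h4; have := classB he' (coboundary_class (proj2 rT) (ksoc psi')).
  by rewrite E1' (residue_map_socle _ _ mr') addr0 subrr subr0.
have [t ht] := hmu nr'; exists (r * t).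
have key : e - (r * t) *: e' = d (size rs) (psi one - (r * t) *: psi' one).
  rewrite E1 E1' scalerDr [(r * t) *: (r' *: _)]scalerA -mulrA ht mulr1.
  rewrite opprD addrACA subrr addr0 -!scaleNr addrC [psi one + _]addrC.
  by rewrite linearP.
have kk : killed (x :: rs) (psi one - (r * t) *: psi' one).
  by apply: killedB; [exact: ksoc|apply: killedZ; exact: ksoc].
have := classB (classB he (class_scale (r * t) he')) (coboundary_class (proj2 rT) kk).
by rewrite key subrr subr0 => /h4; rewrite linearB linearZ.
Qed.

End Rees.

(** * From the canonical module to the canonical ideal *)

Section CanonicalIdeal.
Variables (R : comNzRingType) (M : lmodType R) (f : {linear M -> R^o}) (J : set R).
Hypotheses (f_inj : injective f) (fJ : range f = J) (hJ : is_ideal J).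
Implicit Types (x y z r : R) (s : seq R) (v w : M).

Lemma seq_smul_cons x s v :
  seq_smul (x :: s) v <-> exists a w, seq_smul s w /\ v = w + x *: a.
Proof.
split=> [[c ->]|[a [w [[c ->] ->]]]].
  exists (c ord0), (\sum_(i < size s) s`_i *: c (lift ord0 i)).
  rewrite big_ord_recl addrC; split=> //.
  by exists (fun i => c (lift ord0 i)).
exists (fun i : 'I_(size s).+1 => if unlift ord0 i is Some j then c j else a).
rewrite big_ord_recl unlift_none addrC; congr (_ + _).
by apply: eq_bigr => i _; rewrite liftK.
Qed.

Lemma seq_smulP s v : seq_smul s v <-> seqm J s (f v).
Proof.
elim: s v => [|x s IH] v.
  split=> [[c ->]|/= h]; first by rewrite big_ord0 linear0.
  by exists (fun=> 0); rewrite big_ord0; apply: f_inj; rewrite h linear0.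
rewrite seq_smul_cons; split=> [[a [w [/IH hw ->]]]|[b [j [hb Jj E]]]].
  exists (f w), (f a); rewrite linearD linearZ; split=> //.
  by rewrite -fJ; exists a.
rewrite -fJ in Jj; have [a _ aj] := Jj.
exists a, (v - x *: a); split; last by rewrite subrK.
by apply/IH; rewrite linearB linearZ /= aj E [_ *: _]/(x * j) addrK.
Qed.

(** The list is reversed because [regseq] starts from the last entry and [regular_seq] from the
    first. *)
Lemma regular_seq_regseq s : regular_seq s M -> regseq J (rev s).
Proof.
move=> [hs _]; suff h n : (n <= size s)%N -> regseq J (rev (take n s)).
  by rewrite -{1}(take_size s); exact: h.
elim: n => [|n IH] hn; first by rewrite take0.
rewrite (take_nth 0) // rev_rcons; split; last exact/IH/ltnW.
move=> z; rewrite -{1}fJ => -[v _ <-].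
have E : seqm J (rev (take n s)) = seqm J (take n s).
  by apply: seqm_perm => //; rewrite perm_rev.
rewrite E => h; apply/seq_smulP/hs => //; apply/seq_smulP.
by rewrite linearZ.
Qed.

End CanonicalIdeal.

(** * Condition (A) in every dimension *)

Section ConditionAHolds.
Variables (R : comNzRingType) (m : set R) (k : fieldType) (res : {rmorphism R -> k}).
Variables (p : nat) (charRp : p \in [pchar R]).
Hypotheses (hN : noetherian R) (hm : is_local m).
Hypotheses (hres_surj : forall c, exists x, res x = c) (hres_ker : forall x, m x <-> res x = 0).
Hypothesis hF : strongly_F_regular charRp.

Lemma dim0_max : has_krull_dim R 0 -> m = [set 0].
Proof.
move=> [_ h]; apply: contrapT => nm.
suff /h : prime_chain 1 (fun i => if i is 0 then [set 0 : R] else m) by [].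
split=> [[|i] _|[|i] // _]; first exact: (prime_set0 hN hm hF).
  exact: local_prime hm.
have m0 : [set 0 : R] `<=` m by move=> _ ->; exact: ideal0 (local_ideal hm).
by split=> // h'; apply: nm; apply/seteqP.
Qed.

(** R is a field, and the constant sequences I_t = m = 0 and u_t = 1 do. *)
Lemma condition_A_dim0 : has_krull_dim R 0 -> condition_A p m.
Proof.
move=> /dim0_max mE; have hm0 := local_ideal hm; have mT := local_notT hm.
have unit (x : R) : x <> 0 -> exists y, y * x = 1.
  by move=> nx; apply: (local_unit hN hm); rewrite mE.
exists (fun=> m), (fun=> 1), 1%N; split=> //.
- move=> t _; split=> //.
  + split=> // A B hA hB E.
    have [A0|/existsNP[x /not_implyP[Ax nx]]] := pselect (A `<=` m).
      by left; apply/seteqP; split=> // z; rewrite E => -[].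
    right; apply/seteqP; split=> z; first by rewrite E => -[].
    rewrite mE in nx; have [y hy] := unit x nx => Bz; rewrite E; split=> //.
    by rewrite -(mul1r z) -hy mulrAC; exact: idealM.
  + split=> // x y; rewrite mE => /(F_regular_domain hN hm hF)[]; [by left|right].
    by exists 1%N; rewrite expr1.
  + apply/seteqP; split=> x; last by move=> mx; exists 1%N; rewrite expr1.
    by move=> [n]; exact: primeX (local_prime hm).
  + move=> x; split=> [_|_ y]; first by exists x; rewrite mulr1 subrr; exact: ideal0.
    by rewrite mE => ->; rewrite mul0r.
- move=> n; exists 1%N; split=> //; rewrite {1}mE => _ ->.
  exact: ideal0 (ideal_pow_ideal _ _).
- by move=> t _; exists 1%N; apply: ideal_mul_sub => // x y mx _; exact: idealMr.
Qed.

Hypothesis hQG : Q_Gorenstein_punctured m res.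

Lemma canonical_data : exists J d zs,
  [/\ [/\ is_ideal J, exists2 c, J c & c <> 0, pure_height_one J & has_krull_dim R d],
     forall P, is_prime P -> P <> m ->
        exists h, (1 <= h)%N /\ locally_principal P (symbolic_pow J h),
     [/\ forall z, z \in zs -> m z, regseq J zs & size zs = d]
   & (0 < d)%N -> forall vs, regseq J vs -> (forall y, y \in vs -> m y) -> size vs = d ->
     forall v v', J v -> J v' -> (forall y, m y -> seqm J vs (y * v)) ->
     (forall y, m y -> seqm J vs (y * v')) -> ~ seqm J vs v' ->
     exists r, seqm J vs (v - r * v')].
Proof.
have [J [[hJ [M [f [hM f_inj fJ]]]] Jpure hP]] := hQG.
have [d [hd _ [[s [sm rs ss]] _] [E [_ hE]]]] := hM.
(* If [J] were zero, (s)M would be all of [M], which [regular_seq] excludes. *)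
have Jnz : exists2 c, J c & c <> 0.
  apply: contrapT => h; have [_ nT] := rs; apply: nT; apply/seteqP; split=> // v _.
  apply/(seq_smulP f_inj fJ); suff -> : f v = 0 by apply: ideal0; exact: seqm_ideal.
  by apply: contrapT => nv; apply: h; exists (f v) => //; rewrite -fJ; exists v.
exists J, d, (rev s); split=> //.
  split; [|exact: (regular_seq_regseq f_inj fJ hJ rs)|by rewrite size_rev].
  by move=> z; rewrite mem_rev => zs; exact: sm.
move=> d0 vs rv hv sv v v'; rewrite -{1 2}fJ => -[w _ <-] [w' _ <-] hw hw' nw'.
have rT := regseq_setT hN hm hF hJ Jnz hv rv.
move: hE d0; rewrite -sv => hE d0.
exact: (canonical_socle f_inj fJ (local_ideal hm) hres_surj hres_ker
  (fun x => local_unit hN hm (x := x)) rT rv d0 hv hE hw hw' nw').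
Qed.

Lemma condition_A_holds : condition_A p m.
Proof.
have [J [d [zs [[hJ Jnz Jpure hd] hP [zm zr zd] hsoc]]]] := canonical_data.
have [d0|d0] := posnP d; first by apply: condition_A_dim0; rewrite -d0.
have [x [ys [N [c [f [f' [[Jx hms rJ sxy nc] [hNe JN NJ kill]]]]]]]] :=
  exists_parameters hN hm hF hJ Jnz Jpure hP hd zm zr zd d0.
exact: (condition_A_of_parameters hN hm hF hJ Jnz hd (hsoc d0) Jx hms rJ sxy nc hNe JN NJ kill).
Qed.

End ConditionAHolds.

(** * The F-signature *)

Section FiniteLength.
Variables (R : comNzRingType) (m : set R) (p : nat) (charRp : p \in [pchar R]).
Hypotheses (hN : noetherian R) (hm : is_local m).
Implicit Types (A B C I K : set R) (x y z r c : R) (s us ys : seq R) (e l n : nat).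

(** A linear combination in R^(1/q). Finite index types, unlike lists, allow index sets that are
    sums and products. *)
Definition comb e (T : finType) (g c : T -> R) : R := \sum_t c t ^+ (p ^ e) * g t.

Lemma combD e (T : finType) (g c c' : T -> R) :
  comb e g (fun t => c t + c' t) = comb e g c + comb e g c'.
Proof. by rewrite -big_split; apply: eq_bigr => t _ /=; rewrite exprD_pchar // mulrDl. Qed.

Lemma combZ e (T : finType) (g c : T -> R) r :
  comb e g (fun t => r * c t) = r ^+ (p ^ e) * comb e g c.
Proof. by rewrite mulr_sumr; apply: eq_bigr => t _; rewrite exprMn mulrA. Qed.

(* [A] is obtained from [B] by at most [l] extensions with cyclic quotient killed by [m]. *)
Fixpoint len_le A B l : Prop :=
  if l is l'.+1 then
    exists a C, [/\ is_ideal C, len_le C B l', forall z, A z -> exists r, C (z - r * a)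
      & forall y, m y -> C (y * a)]
  else A `<=` B.

Lemma len_le_subl A A' B l : A' `<=` A -> len_le A B l -> len_le A' B l.
Proof.
case: l => [|l] /= AA'; first by move=> AB x /AA'/AB.
by move=> [a [C [hC h1 h2 h3]]]; exists a, C; split=> // z /AA'/h2.
Qed.

Lemma len_le_subr A B B' l : B `<=` B' -> len_le A B l -> len_le A B' l.
Proof.
move=> BB'; elim: l A => [|l IH] A /=; first by move=> AB x /AB/BB'.
by move=> [a [C [hC /IH h1 h2 h3]]]; exists a, C.
Qed.

Lemma len_le_trans A B C l l' : len_le A B l -> len_le B C l' -> len_le A C (l + l').
Proof.
elim: l A => [|l IH] A /=; first exact: len_le_subl.
by move=> [a [D [hD h1 h2 h3]]] h; exists a, D; split=> //; exact: IH.
Qed.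

Lemma len_le_mix A B K x l : is_ideal K -> is_ideal A -> len_le A B l ->
  len_le [set z | exists a w, [/\ A a, K w & z = x * a + w]]
         [set z | exists a w, [/\ B a, K w & z = x * a + w]] l.
Proof.
move=> hK; elim: l A => [|l IH] A hA /=.
  by move=> AB _ [a [w [/AB ha hw ->]]]; exists a, w.
move=> [a [C [hC h1 h2 h3]]].
exists (x * a), [set z | exists a w, [/\ C a, K w & z = x * a + w]]; split.
- split=> [|_ _ [b [w [hb hw ->]]] [b' [w' [hb' hw' ->]]]|r _ [b [w [hb hw ->]]]].
  + by exists 0, 0; rewrite mulr0 addr0; split=> //; exact: ideal0.
  + by exists (b + b'), (w + w'); split; [exact: idealD|exact: idealD|ring].
  + by exists (r * b), (r * w); split; [exact: idealM|exact: idealM|ring].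
- exact: IH.
- move=> _ [b [w [/h2[r hr] hw ->]]]; exists r, (b - r * a), w; split=> //; ring.
- move=> y /h3 hy; exists (y * a), 0; split=> //; [exact: ideal0|ring].
Qed.

(** Multiplication by x^n maps R/(x, s) onto (x^n, s)/(x^(n+1), s). *)
Lemma len_le_expr s x l n : len_le setT (seqm setT (x :: s)) l ->
  len_le setT (seqm setT (x ^+ n :: s)) (n * l).
Proof.
have hT := @ideal_setT R; have hS := seqm_ideal s hT => h.
elim: n => [|n IH].
  by move=> z _; exists 0, z; rewrite mul1r add0r; split=> //; exact: ideal0.
rewrite mulSn addnC; apply: len_le_trans IH _.
have := @len_le_mix _ _ (seqm setT s) (x ^+ n) l hS hT h.
move/(@len_le_subl _ (seqm setT (x ^+ n :: s)) _ _) => h'.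
apply: (len_le_subr _ (h' _)) => [_ [a [w [[v [j [hv _ ->]]] hw ->]]]|_ [w [j [hw _ ->]]]].
  exists (x ^+ n * v + w), j; split=> //; last by rewrite exprSr; ring.
  by apply: idealD => //; exact: idealM.
by exists j, w; split=> //; rewrite addrC.
Qed.

Lemma len_le_map_expr ys us l n : len_le setT (seqm setT (ys ++ us)) l ->
  len_le setT (seqm setT (map (fun y => y ^+ n) ys ++ us)) (n ^ size ys * l).
Proof.
have hT := @ideal_setT R.
have pm (a : R) s1 s2 : seqm setT (s1 ++ a :: s2) = seqm setT (a :: s1 ++ s2).
  by apply: seqm_perm => //; rewrite -cat1s -[a :: _ ++ _]cat1s perm_catCA.
elim: ys us => [|y ys IH] us; first by rewrite mul1n.
rewrite map_cons !cat_cons => h; have := IH (y :: us).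
by rewrite !pm => /(_ h) /len_le_expr - /(_ n); rewrite expnS mulnA.
Qed.

Lemma len_le_exists I n : is_ideal I -> ideal_pow m n `<=` I -> exists l, len_le setT I l.
Proof.
move=> hI hn; apply: contrapT => hno.
have [| |V [hV nV hnV] Vmax] := @noetherian_max R
    [set V | [/\ is_ideal V, ideal_pow m n `<=` V & ~ exists l, len_le setT V l]] hN.
- by move=> ? [].
- by exists I; split.
have [|u [_ nu hu]] := exists_socle_elt (@ideal_setT R) hV nV.
  exists 1 => // V1; apply: hnV; exists 0%N; by rewrite (ideal1 hV V1).
have [l hl] : exists l, len_le setT (add_ideal V u) l.
  apply: contrapT => h; apply: nu.
  apply: (Vmax (add_ideal V u)); last exact: add_ideal_mem.
    by split=> //; [exact: add_ideal_ideal|move=> z /nV; exact: add_ideal_sub].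
  exact: add_ideal_sub.
apply: hnV; exists (l + 1)%N; apply: len_le_trans hl _.
exists u, V; split=> //= z [w [r [hw ->]]]; exists r.
by rewrite addrK.
Qed.

(** On a cyclic quotient killed by m, generated by [a], a coefficient matters only modulo m, so the
    products of [a] with the [g t] span it over q-th powers. *)
Lemma len_le_span A B l : is_ideal A -> len_le A B l -> exists E : 'I_l -> R,
  forall e (T : finType) (g : T -> R), (forall x, exists c : T -> R, m (x - comb e g c)) ->
  forall z, A z -> exists c : 'I_l * T -> R,
    B (z - comb e (fun it => E it.1 * g it.2) c).
Proof.
elim: l A => [|l IH] A hA /=.
  move=> AB; exists (fun=> 0) => e T g _ z /AB hz; exists (fun=> 0).
  by rewrite /comb big1 ?subr0 // => -[[]].
move=> [a [C [hC /(IH C hC)[E hE] h2 h3]]].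
exists (fun i => if unlift ord0 i is Some j then E j else a) => e T g hg z /h2[r hr].
have [c0 hc0] := hg r.
have hz : C (z - comb e g c0 * a).
  have -> : z - comb e g c0 * a = (z - r * a) + (r - comb e g c0) * a by ring.
  by apply: idealD => //; exact: h3.
have [c hc] := hE e T g hg _ hz.
exists (fun it => if unlift ord0 it.1 is Some j then c (j, it.2) else c0 it.2).
move: hc; congr B; rewrite -addrA -opprD; congr (z - _).
have pairE (I : finType) (h : I -> R) (b : I * T -> R) :
    comb e (fun it => h it.1 * g it.2) b = \sum_i comb e g (fun t => b (i, t)) * h i.
  under eq_bigr do rewrite mulr_suml.
  by rewrite pair_bigA /=; apply: eq_bigr => -[i t] _ /=; ring.
rewrite (pairE _ E c) (pairE _ (fun i : 'I_l.+1 => if unlift ord0 i is Some j then E j else a)).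
rewrite big_ord_recl /= unlift_none; congr (_ + _).
by apply: eq_bigr => i _; rewrite liftK.
Qed.

End FiniteLength.

Lemma pow_growth L D Q : (forall e, D ^ e <= L * Q ^ e)%N -> (D <= Q)%N.
Proof.
move=> h; rewrite leqNgt; apply/negP => QD.
case: Q h QD => [|Q] h QD.
  by have := h 1%N; rewrite !expn1 muln0 leqNgt QD.
have L0 : (0 < L)%N by have := h 0%N; rewrite !expn0 muln1.
(* Bernoulli's inequality (1 + 1/Q')^e >= 1 + e/Q' for Q' = [Q.+1], without denominators. *)
have bern e : (Q.+1 ^ e * (Q.+1 + e) <= Q.+1 * Q.+2 ^ e)%N.
  elim: e => [|e IH]; first by rewrite !expn0; lia.
  rewrite [(Q.+2 ^ _)%N]expnS [(Q.+1 ^ _)%N]expnS.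
  have h1 : (Q.+1 * (Q.+1 + e.+1) <= (Q.+1 + e) * Q.+2)%N by nia.
  have h2 : (Q.+1 ^ e * (Q.+1 * (Q.+1 + e.+1)) <= Q.+1 ^ e * ((Q.+1 + e) * Q.+2))%N.
    by rewrite leq_mul2l h1 orbT.
  have h3 : (Q.+1 ^ e * (Q.+1 + e) * Q.+2 <= Q.+1 * Q.+2 ^ e * Q.+2)%N by rewrite leq_mul2r IH orbT.
  by move: h2 h3; rewrite !mulnA; nia.
(* For this [e] the bound [Q.+1 + e] exceeds L Q', which is [e]. *)
pose e := (L * Q.+1)%N; have := bern e; rewrite leqNgt => /negP; apply.
have hD : (Q.+2 ^ e <= L * Q.+1 ^ e)%N.
  by apply: leq_trans (h e); case: (e) => // e'; rewrite leq_exp2r.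
have : (Q.+1 * Q.+2 ^ e <= Q.+1 * (L * Q.+1 ^ e))%N by rewrite leq_mul2l hD orbT.
move/leq_ltn_trans; apply.
have -> : (Q.+1 * (L * Q.+1 ^ e) = Q.+1 ^ e * e)%N by rewrite mulnA [(Q.+1 * L)%N]mulnC mulnC.
by rewrite ltn_pmul2l ?expn_gt0 // addSn ltnS leq_addl.
Qed.

(** * Generating and independent families in R^(1/q) *)

Section FrobeniusRank.
Variables (R : comNzRingType) (m : set R) (k : fieldType) (res : {rmorphism R -> k}).
Variables (p : nat) (charRp : p \in [pchar R]).
Hypotheses (hN : noetherian R) (hm : is_local m).
Hypotheses (hres_surj : forall c, exists x, res x = c) (hres_ker : forall x, m x <-> res x = 0).
Hypothesis hFfin : F_finite charRp.
Implicit Types (I V : set R) (x y z r : R) (us ys : seq R) (e l n : nat).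

Lemma comb0 (K : comNzRingType) (pK : p \in [pchar K]) e (T : finType) (g : T -> K) :
  comb p e g (fun=> 0) = 0.
Proof. by rewrite /comb big1 // => t _; rewrite (expr0_pexp pK) mul0r. Qed.

Lemma combN (K : comNzRingType) (pK : p \in [pchar K]) e (T : finType) (g c : T -> K) :
  comb p e g (fun t => - c t) = - comb p e g c.
Proof.
apply/eqP; rewrite -addr_eq0 -(combD pK).
by rewrite -[X in _ == X](comb0 pK e g); apply/eqP/eq_bigr => t _; rewrite addNr.
Qed.

Lemma F_finite_family : exists n (t : 'I_n -> R), forall x, exists c, x = comb p 1 t c.
Proof.
have [s hs] := hFfin; exists (size s), (fun i => s`_i) => x.
by have [c ->] := hs x; exists c.
Qed.

(** Generators of R^(1/p) map to a spanning family of k over k^p, and one of least size is a basis: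
    a nontrivial relation would allow an element to be removed. *)
Lemma exists_frob_degree : exists n, frob_degree k p n /\
  exists g : 'I_n -> R, forall x, exists c, m (x - comb p 1 g c).
Proof.
have pk : p \in [pchar k] := rmorph_pchar res charRp.
pose spans n := `[< exists b : 'I_n -> k, forall a : k, exists c, a = comb p 1 b c >].
have exs : exists n, spans n.
  have [n [t ht]] := F_finite_family; exists n; apply/asboolP; exists (res \o t) => y.
  have [x <-] := hres_surj y; have [c ->] := ht x; exists (res \o c).
  by rewrite /comb rmorph_sum; apply: eq_bigr => i _; rewrite rmorphM rmorphXn.
pose n := ex_minn exs; have [nspan nmin] : spans n /\ forall n', spans n' -> (n <= n')%N.
  by rewrite /n; case: ex_minnP.
have /asboolP[b hb] := nspan.
have indep (c : 'I_n -> k) : comb p 1 b c = 0 -> forall i, c i = 0.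
  move: b hb nmin c; rewrite /comb; case: (n) => [|n'] b hb nmin c hc i; first by case: i.
  apply/eqP/negPn/negP => ci.
  suff /nmin : spans n' by rewrite ltnn.
  apply/asboolP; exists (fun j => b (lift i j)) => y; have [c' ->] := hb y.
  exists (fun j => c' (lift i j) - c' i / c i * c (lift i j)); rewrite /comb.
  have -> : \sum_t c' t ^+ (p ^ 1) * b t = 
      \sum_t (c' t - c' i / c i * c t) ^+ (p ^ 1) * b t.
    have h0 : \sum_t (c' i / c i) ^+ (p ^ 1) * (c t ^+ (p ^ 1) * b t) = 0.
      by rewrite -mulr_sumr hc mulr0.
    rewrite -[LHS]subr0 -[X in _ - X = _]h0 -sumrB.
    by apply: eq_bigr => t _; rewrite mulrA -exprMn (exprB_pchar pk) mulrBl.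
  by rewrite (bigD1_ord i) //= divfK // subrr (expr0_pexp pk) mul0r add0r.
exists n; split.
  exists b => y; have [c ->] := hb y; exists (finfun c); split.
    by apply: eq_bigr => i _; rewrite ffunE.
  move=> c' E; apply/ffunP => i; rewrite ffunE; apply/eqP; rewrite -subr_eq0; apply/eqP.
  apply: (indep (fun i => c i - c' i)); rewrite (combD pk) (combN pk); apply/eqP.
  by rewrite subr_eq0; apply/eqP; exact: E.
pose g i := sval (cid (hres_surj (b i))).
have gE i : res (g i) = b i by exact: svalP (cid (hres_surj (b i))).
exists g => x; have [c hc] := hb (res x).
exists (fun i => sval (cid (hres_surj (c i)))); apply/hres_ker.
rewrite rmorphB hc rmorph_sum; apply/eqP; rewrite subr_eq0; apply/eqP/eq_bigr => i _.
by rewrite rmorphM rmorphXn gE (svalP (cid (hres_surj (c i)))).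
Qed.

Lemma comb_pair e (T T' : finType) (f : T -> R) (h : T' -> R) (c : T * T' -> R) :
  comb p e.+1 (fun it => h it.2 ^+ p * f it.1) c =
  \sum_i comb p e h (fun t => c (i, t)) ^+ (p ^ 1) * f i.
Proof.
have -> : comb p e.+1 (fun it => h it.2 ^+ p * f it.1) c =
    \sum_i \sum_t c (i, t) ^+ (p ^ e.+1) * (h t ^+ p * f i).
  by rewrite pair_bigA /=; apply: eq_bigr => -[i t].
apply: eq_bigr => i _; rewrite (expr_sum_pchar charRp) mulr_suml.
by apply: eq_bigr => t _; rewrite exprMn -exprM -expnD addn1 expn1 mulrA.
Qed.

Lemma iterated_span V n (g : 'I_n -> R) : is_ideal V ->
  (forall x, exists c, V (x - comb p 1 g c)) ->
  forall e, exists T : finType, #|T| = (n ^ e)%N /\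
    exists h : T -> R, forall x, exists c, V (x - comb p e h c).
Proof.
move=> hV hg; elim=> [|e [T [cT [h hh]]]].
  exists unit; split; first by rewrite card_unit.
  exists (fun=> 1) => x; exists (fun=> x); rewrite /comb.
  by rewrite (big_pred1 tt) ?mulr1 ?expr1 ?subrr; [exact: ideal0|case].
exists ('I_n * T)%type; split; first by rewrite card_prod card_ord cT expnS.
exists (fun it => h it.2 ^+ p * g it.1) => x; have [c hc] := hg x.
have [b hb] := choice (fun i => hh (c i)).
exists (fun it => b it.1 it.2); rewrite comb_pair.
rewrite -[x](subrK (comb p 1 g c)) -addrA; apply: idealD => //.
rewrite -sumrB; apply: ideal_sum => // i _; rewrite -mulrBl -(exprB_pchar charRp).
by apply: idealMr => //; apply: (ideal_expr_pexp charRp).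
Qed.


(** Only [ys] is raised to the power q. An entry kept in [us] saves a factor q in the count. *)
Lemma span_mod_regular ys us N n (g : 'I_n -> R) :
  (forall x, exists c, m (x - comb p 1 g c)) ->
  ideal_pow m N `<=` seqm setT (ys ++ us) ->
  exists l, forall e, exists T : finType, #|T| = ((p ^ e) ^ size ys * l * n ^ e)%N /\
    exists h : T -> R, forall x, exists c,
      seqm setT (map (fun y => y ^+ (p ^ e)) ys ++ us) (x - comb p e h c).
Proof.
move=> hg hN'; have hT := @ideal_setT R.
have [l hl] := len_le_exists hN (seqm_ideal _ hT) hN'; exists l => e.
have [E hE] := len_le_span p hT (len_le_map_expr (p ^ e) hl).
have [T [cT [h hh]]] := iterated_span (local_ideal hm) hg e.
exists ('I_((p ^ e) ^ size ys * l) * T)%type; split.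
  by rewrite card_prod card_ord cT.
by exists (fun it => E it.1 * h it.2) => x; exact: (hE e T h hh x I).
Qed.

Hypothesis hdom : forall x y, x * y = 0 -> x = 0 \/ y = 0.

(** Gaussian elimination without division: rows are cross-multiplied with the pivot, and in a domain
    the relation stays nontrivial. *)
Lemma dependent_rows a b (A : 'I_a -> 'I_b -> R) : (b < a)%N ->
  exists v : 'I_a -> R, (exists j, v j <> 0) /\ forall i, \sum_j v j * A j i = 0.
Proof.
elim: b a A => [|b IH] [|a] A // hab.
  exists (fun=> 1); split=> [|[]//]; exists ord0; apply/eqP; exact: oner_neq0.
have [h|/existsNP[j0 nz]] := pselect (forall j, A j ord0 = 0).
  have [|v [vnz hv]] := IH a.+1 (fun j i => A j (lift ord0 i)); first exact: ltnW.
  exists v; split=> // i; have [i' ->|->] := unliftP ord0 i; first exact: hv.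
  by rewrite big1 // => j _; rewrite h mulr0.
pose A' j i := A j0 ord0 * A (lift j0 j) (lift ord0 i) - A (lift j0 j) ord0 * A j0 (lift ord0 i).
have [|v [[j vj] hv]] := IH a A'; first by [].
exists (fun t => if unlift j0 t is Some j then A j0 ord0 * v j
   else - \sum_j v j * A (lift j0 j) ord0); split.
  by exists (lift j0 j); rewrite liftK => /hdom[].
move=> i; rewrite (bigD1_ord j0) //= unlift_none.
rewrite [X in _ + X](eq_bigr (fun t => A j0 ord0 * v t * A (lift j0 t) i)); last first.
  by move=> t _; rewrite liftK.
have [i' ->|->] := unliftP ord0 i; last first.
  rewrite mulNr addrC; apply/eqP; rewrite subr_eq0 mulr_suml; apply/eqP/eq_bigr => t _; ring.
rewrite -[RHS](hv i') mulNr mulr_suml addrC -sumrB; apply: eq_bigr => t _.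
by rewrite /A'; ring.
Qed.

Definition frob_indep e (T : finType) (f : T -> R) :=
  forall c, comb p e f c = 0 -> forall t, c t = 0.

Lemma frob_indep_card e (S T : finType) (f : S -> R) (g : T -> R) :
  frob_indep e f -> (forall x, exists c, x = comb p e g c) -> (#|S| <= #|T|)%N.
Proof.
move=> hf hg; rewrite leqNgt; apply/negP => lt.
have [A hA] := choice (fun s => hg (f s)).
have [v [[j nz] hv]] := @dependent_rows #|S| #|T| (fun j i => A (enum_val j) (enum_val i)) lt.
apply: nz; rewrite -[j]enum_valK; apply: (hf (fun s => v (enum_rank s))).
transitivity (\sum_t (\sum_s v (enum_rank s) * A s t) ^+ (p ^ e) * g t).
  under [RHS]eq_bigr do rewrite (expr_sum_pchar charRp) mulr_suml.
  rewrite exchange_big; apply: eq_bigr => s _; rewrite {1}hA mulr_sumr.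
  by apply: eq_bigr => t _; rewrite exprMn mulrA.
rewrite big1 // => t _; suff -> : \sum_s v (enum_rank s) * A s t = 0.
  by rewrite (expr0_pexp charRp) mul0r.
rewrite -[RHS](hv (enum_rank t)) (reindex (@enum_val S S)) /=; last first.
  by apply: onW_bij; exact: enum_val_bij.
by apply: eq_bigr => i _; rewrite enum_valK enum_rankK.
Qed.

(** In R^(1/q) the submodule generated by m is m^[q]. The auxiliary generators are eliminated one at
    a time: [t ord0] occurs in its own expression with a coefficient in m, and 1 minus this
    coefficient is a unit. *)
Lemma frob_nakayama e n (t : 'I_n -> R) (S : finType) (g : S -> R) :
  (forall x, exists c d, x = comb p e g c + comb p e t d) ->
  (forall x, exists c, ideal_bracket m (p ^ e) (x - comb p e g c)) ->
  forall x, exists c, x = comb p e g c.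
Proof.
move=> ht hg; elim: n t ht => [|n IH] t ht.
  by move=> x; have [c [d ->]] := ht x; exists c; rewrite [comb _ _ t d]big_ord0 addr0.
have mi := local_ideal hm.
pose Z := [set z | exists c d, (forall i, m (d i)) /\ z = comb p e g c + comb p e t d].
have hZ : ideal_bracket m (p ^ e) `<=` [set z | forall r, Z (r * z)].
  apply: ideal_bracket_min.
    split=> [r|x y hx hy r|s x hx r].
    - exists (fun=> 0), (fun=> 0); rewrite !(comb0 charRp) mulr0 addr0; split=> // i; exact: ideal0.
    - have [c [d [hd E]]] := hx r; have [c' [d' [hd' E']]] := hy r.
      exists (fun i => c i + c' i), (fun i => d i + d' i).
      by split=> [i|]; [exact: idealD|rewrite !(combD charRp) mulrDr E E' addrACA].
    - by rewrite mulrA; exact: hx.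
  move=> y my r; have [c [d ->]] := ht r.
  exists (fun i => y * c i), (fun i => y * d i); split=> [i|]; first exact: idealMr.
  by rewrite !combZ mulrC mulrDr.
have [c0 /hZ/(_ 1)] := hg (t ord0); rewrite mul1r => -[c [d [hd E]]].
have {}E : t ord0 = comb p e g (fun s => c0 s + c s) + comb p e t d.
  by rewrite (combD charRp) -addrA -E subrKC.
rewrite [comb _ _ t d]big_ord_recl in E.
have [u hu] : exists u, u * (1 - d ord0) = 1.
  apply: (local_unit hN hm) => h; apply: (ideal_proper mi (local_notT hm)).
  by rewrite -(subrK (d ord0) 1); exact: idealD.
have t0E : t ord0 = comb p e g (fun s => u * (c0 s + c s)) +
    comb p e (fun i => t (lift ord0 i)) (fun i => u * d (lift ord0 i)).
  rewrite !combZ -mulrDr.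
  have -> : comb p e g (fun s => c0 s + c s) + comb p e (fun i => t (lift ord0 i)) 
      (fun i => d (lift ord0 i)) = (1 - d ord0) ^+ (p ^ e) * t ord0.
    by rewrite (exprB_pchar charRp) expr1n mulrBl mul1r {1}E /comb; ring.
  by rewrite mulrA -exprMn hu expr1n mul1r.
apply: (IH (fun i => t (lift ord0 i))) => x; have [a [b ->]] := ht x.
exists (fun s => a s + b ord0 * (u * (c0 s + c s))).
exists (fun i => b (lift ord0 i) + b ord0 * (u * d (lift ord0 i))).
rewrite !(combD charRp) !combZ [comb _ _ t b]big_ord_recl t0E !combZ !(combD charRp).
rewrite /comb; ring.
Qed.

Lemma frob_indep_iter n (f : 'I_n -> R) : frob_indep 1 f ->
  forall e, exists T : finType, #|T| = (n ^ e)%N /\ exists h : T -> R, frob_indep e h.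
Proof.
move=> hf; elim=> [|e [T [cT [h hh]]]].
  exists unit; split; first by rewrite card_unit.
  exists (fun=> 1) => c; rewrite /comb (big_pred1 tt) ?mulr1 ?expr1; last by case.
  by move=> h [].
exists ('I_n * T)%type; split; first by rewrite card_prod card_ord cT expnS.
exists (fun it => h it.2 ^+ p * f it.1) => c; rewrite comb_pair => /hf h0 [i t].
exact: (hh (fun t => c (i, t))).
Qed.

End FrobeniusRank.

(** * Free summands of R^(1/q) *)

Section FreeRank.
Variables (R : comNzRingType) (m : set R) (k : fieldType) (res : {rmorphism R -> k}).
Variables (p : nat) (charRp : p \in [pchar R]).
Hypotheses (hN : noetherian R) (hm : is_local m).
Hypotheses (hres_ker : forall x, m x <-> res x = 0).
Implicit Types (x y z r : R) (e n a : nat).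

Definition frob_linear e (phi : R -> R) :=
  (forall x y, phi (x + y) = phi x + phi y) /\
  (forall r x, phi (r ^+ (p ^ e) * x) = r * phi x).

Lemma frob_linear0 e phi : frob_linear e phi -> phi 0 = 0.
Proof. by case=> hD _; have := hD 0 0; rewrite addr0 -{1}(addr0 (phi 0)) => /addrI. Qed.

Lemma frob_linear_sum e phi (T : finType) (F : T -> R) : frob_linear e phi ->
  phi (\sum_t F t) = \sum_t phi (F t).
Proof.
move=> h; apply: (big_morph phi) => [x y|]; [exact: (proj1 h)|exact: (frob_linear0 h)].
Qed.

Lemma frob_linear_comb e phi (T : finType) (g c : T -> R) : frob_linear e phi ->
  phi (comb p e g c) = \sum_t c t * phi (g t).
Proof.
move=> h; rewrite (frob_linear_sum _ h).
by apply: eq_bigr => t _; exact: (proj2 h).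
Qed.

Lemma frob_linearB e phi x y : frob_linear e phi -> phi (x - y) = phi x - phi y.
Proof.
move=> h; have := proj1 h (x - y) y; rewrite subrK => ->.
by rewrite addrK.
Qed.

(** Over the residue field, the coefficients of the [b j] and the values of the [pi i] on [w] form
    two matrices whose product is the identity of size [a], factored through #|T| dimensions. *)
Lemma rank_bound e a (pi : 'I_a -> R -> R) (b : 'I_a -> R) (T : finType) (w : T -> R) :
  (forall i, frob_linear e (pi i)) -> (forall i j, pi i (b j) = (i == j)%:R) ->
  (forall x, exists c, forall i, m (pi i (x - comb p e w c))) -> (a <= #|T|)%N.
Proof.
move=> hpi hb hw; have [c hc] := choice (fun j => hw (b j)).
pose C := \matrix_(j < a, t < #|T|) res (c j (enum_val t)).
pose W := \matrix_(t < #|T|, i < a) res (pi i (w (enum_val t))).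
suff CW : C *m W = 1%:M by rewrite -[X in (X <= _)%N](mxrank1 k) -CW mulmx_max_rank.
apply/matrixP => j i; rewrite !mxE.
have := hc j i; rewrite (frob_linearB _ _ (hpi i)) hb => /hres_ker.
rewrite rmorphB (frob_linear_comb _ _ (hpi i)) => /eqP; rewrite subr_eq0 eq_sym => /eqP.
rewrite rmorph_nat eq_sym => <-; rewrite rmorph_sum (reindex (@enum_val T T)) /=; last first.
  by apply: onW_bij; exact: enum_val_bij.
by apply: eq_bigr => t _; rewrite !mxE rmorphM.
Qed.

Lemma linear_bij_inv (U V : lmodType R) (f : {linear U -> V}) : bijective f ->
  exists g : {linear V -> U}, cancel f g /\ cancel g f.
Proof.
move=> [g fg gf].
have [|g' gE] := @linear_of_fun R V U g.
  by move=> r u v; apply: (can_inj fg); rewrite linearP !gf.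
by exists g'; split=> x; rewrite gE.
Qed.

Lemma split_free_summand (M : lmodType R) (chi : M -> R) v0 :
  (forall r v w, chi (r *: v + w) = r * chi v + chi w) -> chi v0 = 1 ->
  exists N : lmodType R, lmod_iso M ('rV[R]_1 * N)%type.
Proof.
move=> chiL chi1.
have chi0 : chi 0 = 0 by have := chiL (-1) v0 v0; rewrite scaleN1r addNr mulN1r addNr.
have kerP r u v : chi u = 0 -> chi v = 0 -> chi (r *: u + v) = 0.
  by move=> hu hv; rewrite chiL hu hv mulr0 addr0.
pose K := @Submod R M [set v | chi v = 0] chi0 kerP.
have hproj v : exists y : submod_of K, submod_val y = v - chi v *: v0.
  apply: submod_val_ex => /=; rewrite addrC -scaleNr chiL chi1 mulr1 addNr //.
have [pr prE] := choice hproj.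
have prL r v w : pr (r *: v + w) = r *: pr v + pr w.
  apply: (@submod_val_inj R M K); rewrite submod_val_linear !prE chiL.
  by rewrite scalerDl scalerBr scalerA opprD addrACA.
have [|f fE] := @linear_of_fun R M ('rV[R]_1 * submod_of K)%type
    (fun v => (\row_(i < 1) chi v, pr v)).
  move=> r v w; rewrite prL; congr (_, _).
  by apply/rowP => i; rewrite !mxE chiL.
exists (submod_of K), f.
exists (fun u : 'rV[R]_1 * submod_of K => u.1 0 0 *: v0 + submod_val u.2) => [v|[u y]]; rewrite fE /=.
  by rewrite mxE prE subrKC.
have chiE : chi (u 0 0 *: v0 + submod_val y) = u 0 0.
  by rewrite chiL chi1 mulr1 (submod_valP y) addr0.
congr (_, _); first by apply/rowP => i; rewrite mxE chiE (ord1 i).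
apply: (@submod_val_inj R M K); rewrite prE chiE.
by rewrite addrC addKr.
Qed.

(** For the last clause: a functional with a unit value on an element of [M] would split a free
    summand off [M]. *)
Lemma free_decomposition e a (M : lmodType R) :
  lmod_iso (root_mod charRp e) ('rV[R]_a * M)%type ->
  exists (pi : 'I_a -> R -> R) (b : 'I_a -> R),
    [/\ forall i, frob_linear e (pi i), forall i j, pi i (b j) = (i == j)%:R
      & no_free_summand M -> forall phi, frob_linear e phi ->
          forall x, (forall i, pi i x = 0) -> m (phi x)].
Proof.
move=> [g /linear_bij_inv[h [gh hg]]].
exists (fun i x => (g (x : root_mod charRp e)).1 0 i), (fun j => h (delta_mx 0 j, 0)); split.
- move=> i; split=> [x y|r x].
    by rewrite (linearD g (x : root_mod charRp e) y) mxE.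
  by rewrite (linearZ_LR g r (x : root_mod charRp e)) mxE.
- by move=> i j; rewrite hg mxE eqxx.
move=> nM phi hphi x hx; apply: contrapT => nx.
have [u hu] := local_unit hN hm nx.
have xE : x = h (0, (g (x : root_mod charRp e)).2).
  rewrite -[LHS]gh; congr (h _); move: hx; case: (g _) => v w /= hv; congr (_, _).
  by apply/rowP => i; rewrite mxE; exact: hv.
have [||N hiso] := @split_free_summand M (fun v => u * phi (h (0, v))) (g (x : root_mod charRp e)).2.
- move=> r v w; have -> : (0, r *: v + w) = r *: ((0, v) : 'rV[R]_a * M) + (0, w).
    by congr (_, _); rewrite /= ?scaler0 ?addr0.
  rewrite linearP.
  have -> : r *: h (0, v) + h (0, w) = r ^+ (p ^ e) * (h (0, v) : R) + (h (0, w) : R) by [].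
  by rewrite (proj1 hphi) (proj2 hphi); ring.
- by rewrite -xE.
by have := nM _ _ hiso.
Qed.

Lemma exists_free_rank e (T : finType) (g : T -> R) : (forall x, exists c, x = comb p e g c) ->
  exists a, free_rank_root charRp e a.
Proof.
move=> hg.
pose P a := `[< exists M : lmodType R, lmod_iso (root_mod charRp e) ('rV[R]_a * M)%type >].
have P0 : exists a, P a.
  exists 0%N; apply/asboolP; exists (root_mod charRp e).
  have [|f fE] := @linear_of_fun R (root_mod charRp e) ('rV[R]_0 * root_mod charRp e)%type
    (fun x => (0, x)).
    by move=> r u v; congr (_, _); rewrite /= scaler0 addr0.
  exists f; exists snd => [x|[u x]]; rewrite fE //.
  by congr (_, _); apply/rowP => -[].
have bound a : P a -> (a <= #|T|)%N.
  move=> /asboolP[M /free_decomposition[pi [b [hpi hb _]]]].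
  apply: (rank_bound hpi hb (w := g)) => x; have [c hc] := hg x; exists c => i.
  by rewrite -hc subrr (frob_linear0 (hpi i)); exact: ideal0 (local_ideal hm).
have [a /asboolP[M iM] amax] := ex_maxnP P0 bound; exists a, M; split=> // n N [h hbij].
have [f fbij] := iM.
have [f' [ff' f'f]] := linear_bij_inv fbij; have [h' [hh' h'h]] := linear_bij_inv hbij.
have [|F FE] := @linear_of_fun R (root_mod charRp e) ('rV[R]_(a + n) * N)%type
    (fun x => (row_mx (f x).1 (h (f x).2).1, (h (f x).2).2)).
  move=> r u v; rewrite linearP /= linearP /=; congr (_, _).
  by rewrite -[RHS]/(r *: row_mx _ _ + row_mx _ _) scale_row_mx add_row_mx.
suff /amax : P (a + n)%N by rewrite -[X in (_ <= X)%N]addn0 leq_add2l leqn0 => /eqP.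
apply/asboolP; exists N, F.
exists (fun w : 'rV[R]_(a + n) * N => f' (lsubmx w.1, h' (rsubmx w.1, w.2))) => [x|[y z]];
  rewrite FE /=.
  rewrite row_mxKl row_mxKr -surjective_pairing hh' -surjective_pairing.
  exact: ff'.
by rewrite f'f /= h'h /= hsubmxK.
Qed.

(* Every element is a combination of the [b_l ^ p f_j], of the [g ^ p t_i], and of terms that
   every Frobenius-linear functional sends to [m]. *)
Lemma free_rank_step e a a' D N (f : 'I_D -> R) (t : 'I_N -> R) c (T : finType) (g : T -> R) :
  (forall x, exists s, x = comb p 1 t s) ->
  (forall i, exists h, c ^+ p * t i = comb p 1 f h) ->
  (forall x, exists s y z, x = comb p e g s + (c * y + z) /\ ideal_bracket m (p ^ e) z) ->
  free_rank_root charRp e a -> free_rank_root charRp e.+1 a' ->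
  (a' <= D * a + N * #|T|)%N.
Proof.
move=> ht hf hg [M [/free_decomposition[pi [b [hpi hb hM]]] nM]].
move=> [M' [/free_decomposition[pi' [b' [hpi' hb' _]]] _]].
have mi := local_ideal hm.
have := @rank_bound e.+1 a' pi' b' ('I_D * 'I_a + 'I_N * T)%type (fun u => match u with
  | inl jl => b jl.2 ^+ p * f jl.1 | inr il => g il.2 ^+ p * t il.1 end) hpi' hb'.
rewrite card_sum !card_prod !card_ord; apply => x.
have [s ->] := ht x; have [h hh] := choice hf.
have [rho hrho] := choice (fun i => hg (s i)).
have [sig {}hrho] := choice hrho; have [mu {}hrho] := choice hrho.
(* These are the coefficients that turn the part divisible by [c] into a combination of the [f j]:
   the sum of the (c sig_i)^p t_i is that of the zz_j^p f_j. *)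
pose zz j := \sum_i sig i * h i j.
pose z' j := zz j - comb p e b (fun l => pi l (zz j)).
have hz' j l : pi l (z' j) = 0.
  rewrite /z' (frob_linearB _ _ (hpi l)) (frob_linear_comb _ _ (hpi l)).
  rewrite (bigD1 l) //= hb eqxx mulr1 big1 ?addr0 ?subrr // => i il.
  by rewrite hb eq_sym (negbTE il) mulr0.
exists (fun u => match u with inl jl => pi jl.2 (zz jl.1) | inr il => rho il.1 il.2 end) => i.
rewrite [comb p e.+1 _ _]big_sumType /=.
have E1 := comb_pair charRp e f b (fun jl => pi jl.2 (zz jl.1)).
have E2 := comb_pair charRp e t g (fun il => rho il.1 il.2).
rewrite /comb /= in E1; rewrite E1; rewrite /comb /= in E2; rewrite E2 {E1 E2}.
rewrite -/(comb p 1 t s).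
set X := (X in m (pi' i X)).
have -> : X = \sum_j z' j ^+ (p ^ 1) * f j + \sum_i0 mu i0 ^+ (p ^ 1) * t i0.
  have E3 : comb p 1 t s = \sum_i0 (comb p e g (rho i0)) ^+ (p ^ 1) * t i0 +
      (\sum_j zz j ^+ (p ^ 1) * f j + \sum_i0 mu i0 ^+ (p ^ 1) * t i0).
    have -> : \sum_j zz j ^+ (p ^ 1) * f j = \sum_i0 (c * sig i0) ^+ (p ^ 1) * t i0.
      under eq_bigr do rewrite (expr_sum_pchar charRp) mulr_suml.
      rewrite exchange_big; apply: eq_bigr => i0 _.
      rewrite exprMn mulrC mulrA [t i0 * _]mulrC {1}expn1 hh mulr_suml.
      by apply: eq_bigr => j _; rewrite exprMn; ring.
    rewrite -!big_split; apply: eq_bigr => i0 _ /=.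
    by have [-> _] := hrho i0; rewrite !exprD_pchar //; ring.
  have E4 : \sum_j zz j ^+ (p ^ 1) * f j =
      \sum_j (comb p e b (fun l => pi l (zz j))) ^+ (p ^ 1) * f j +
      \sum_j z' j ^+ (p ^ 1) * f j.
    rewrite -big_split; apply: eq_bigr => j _ /=.
    by rewrite -mulrDl -exprD_pchar // subrKC.
  by rewrite /X E3 E4; ring.
rewrite (proj1 (hpi' i)) !(frob_linear_sum _ (hpi' i)); apply: idealD => //.
  (* In [y] this is a functional on R^(1/p^e), and [z' j] lies in the summand without free part. *)
  apply: ideal_sum => // j _; apply: (hM nM (fun y => pi' i (y ^+ (p ^ 1) * f j))) => //.
  split=> [y z|r y]; first by rewrite exprD_pchar // mulrDl (proj1 (hpi' i)).
  by rewrite exprMn -exprM -expnD addn1 -mulrA (proj2 (hpi' i)).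
apply: ideal_sum => // j _; have [_] := hrho j.
suff hB : ideal_bracket m (p ^ e) `<=`
    [set z | forall y, m (pi' i (z ^+ (p ^ 1) * y))] by move=> /hB.
apply: ideal_bracket_min.
  split=> [y|x1 x2 h1 h2 y|r x1 h1 y] /=.
  - by rewrite (expr0_pexp charRp) mul0r (frob_linear0 (hpi' i)); exact: ideal0.
  - by rewrite exprD_pchar // mulrDl (proj1 (hpi' i)); apply: idealD; [|exact: h1|exact: h2].
  - have := h1 (y * r ^+ (p ^ 1)); congr m; congr (pi' i _).
    by rewrite exprMn; ring.
move=> y my z; rewrite -exprM -expnD addn1 (proj2 (hpi' i)).
exact: idealMr.
Qed.

End FreeRank.

(** * Generic rank of R^(1/p), and generators modulo m and modulo c *)

Section Signature.
Variables (R : comNzRingType) (m : set R) (p : nat) (charRp : p \in [pchar R]).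
Hypotheses (hN : noetherian R) (hm : is_local m).
Hypotheses (hFfin : F_finite charRp) (hF : strongly_F_regular charRp).
Implicit Types (x y z r c : R) (s us ys : seq R) (e n d : nat).

Let hdom := F_regular_domain hN hm hF.

(** [f] is an independent family of largest size, so each generator [t i] has a nonzero multiple
    that is a combination of [f]; [c] is the product of the multipliers. *)
Lemma generic_frob_basis : exists D (f : 'I_D -> R) N (t : 'I_N -> R) c,
  [/\ frob_indep p 1 f, forall x, exists b, x = comb p 1 t b, c <> 0
    & forall i, exists h, c ^+ p * t i = comb p 1 f h].
Proof.
have [N [t ht]] := F_finite_family hFfin.
pose P D := `[< exists f : 'I_D -> R, frob_indep p 1 f >].
have P0 : exists D, P D by exists 0%N; apply/asboolP; exists (fun=> 0) => c _ [].
have bound D : P D -> (D <= N)%N.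
  move=> /asboolP[f hf]; have := frob_indep_card charRp hdom hf ht.
  by rewrite !card_ord.
have [D /asboolP[f hf] Dmax] := ex_maxnP P0 bound.
have dep x : exists c, c <> 0 /\ exists h, c ^+ (p ^ 1) * x = comb p 1 f h.
  apply: contrapT => hno; suff /Dmax : P D.+1 by rewrite ltnn.
  apply/asboolP; exists (fun i => if unlift ord0 i is Some j then f j else x) => c.
  rewrite /comb big_ord_recl unlift_none.
  under eq_bigr do rewrite liftK.
  rewrite -/(comb p 1 f (fun j => c (lift ord0 j))) => h.
  have c0 : c ord0 = 0.
    apply: contrapT => nc; apply: hno; exists (c ord0); split=> //.
    exists (fun j => - c (lift ord0 j)); rewrite (combN charRp).
    by apply/eqP; rewrite -addr_eq0 h.
  move: h; rewrite c0 (expr0_pexp charRp) mul0r add0r => /hf h i.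
  by have [j ->|->] := unliftP ord0 i; [exact: h|].
have [c hc] := choice (fun i => dep (t i)).
exists D, f, N, t, (\prod_i c i); split=> //.
  rewrite -(big_map c predT id); apply: (domain_prod hN hm hF) => x /mapP[i _ ->].
  by have [] := hc i.
move=> i; have [_ [h hh]] := hc i.
exists (fun j => (\prod_(l | l != i) c l) * h j).
rewrite (bigD1 i) //= combZ -hh exprMn expn1; ring.
Qed.

Lemma seqm_map_bracket e us ys c : (forall y, y \in ys -> m y) ->
  (forall u, u \in us -> principal c u) ->
  forall z, seqm setT (map (fun y => y ^+ (p ^ e)) ys ++ us) z ->
  exists y w, z = c * y + w /\ ideal_bracket m (p ^ e) w.
Proof.
move=> hy hu z hz; have hB := ideal_bracket_ideal m (p ^ e).
suff : [set z | exists y w, z = c * y + w /\ ideal_bracket m (p ^ e) w] z by [].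
apply: (seqm_min _ _ hz) => [|x j].
  split=> [|_ _ [y [w [-> hw]]] [y' [w' [-> hw']]]|r _ [y [w [-> hw]]]].
  - by exists 0, 0; rewrite mulr0 addr0; split=> //; exact: ideal0 hB.
  - by exists (y + y'), (w + w'); split; [ring|exact: idealD hB hw hw'].
  - by exists (r * y), (r * w); split; [ring|exact: idealM hB hw].
rewrite mem_cat => /orP[/mapP[y ys' ->]|/hu[r ->]] _.
  exists 0, (y ^+ (p ^ e) * j); rewrite mulr0 add0r; split=> //.
  by apply: (idealMr _ hB); apply: ideal_bracket_mem; exact: hy.
by exists (r * j), 0; rewrite addr0; split; [ring|exact: ideal0 hB].
Qed.

Variables (d n : nat) (g : 'I_n -> R).
Hypotheses (hd : has_krull_dim R d) (hg : forall x, exists b, m (x - comb p 1 g b)).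

Lemma residue_bound zs : (forall z, z \in zs -> m z) -> regseq setT zs -> size zs = d ->
  exists L, forall e, exists T : finType, (#|T| <= L * (p ^ d * n) ^ e)%N /\
    exists h : T -> R, forall x, exists b, ideal_bracket m (p ^ e) (x - comb p e h b).
Proof.
move=> zm zr zd; have hT := @ideal_setT R.
have [N hN'] := regular_primary hN hm hd zr zd (seqm_ideal zs hT) (fun _ h => h).
have [|l hl] := @span_mod_regular R m p charRp hN hm zs [::] N n g hg; first by rewrite cats0.
exists l => e; have [T [cT [h hh]]] := hl e; exists T; split.
  by rewrite cT zd expnMn -!expnM [(d * e)%N]mulnC; apply: eq_leq; ring.
exists h => x; have [s hs] := hh x; exists s.
have [//|y [w [-> hw]]] := @seqm_map_bracket e [::] zs 0 zm _ _ hs.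
by rewrite mul0r add0r.
Qed.

(** [c], brought into m by a factor [t], is completed to parameters and is the one entry not raised
    to the power q. This accounts for the factor p^e on the left. *)
Lemma torsion_bound J zs c : is_ideal J -> (exists2 c, J c & c <> 0) ->
  (forall z, z \in zs -> m z) -> regseq J zs -> size zs = d -> c <> 0 ->
  exists L, forall e, exists T : finType, (#|T| * p ^ e <= L * (p ^ d * n) ^ e)%N /\
    exists h : T -> R, forall x, exists b y z,
      x = comb p e h b + (c * y + z) /\ ideal_bracket m (p ^ e) z.
Proof.
move=> hJ Jnz zm zr zd nc; have hT := @ideal_setT R.
have [d0|d0] := posnP d.
  have m0 : m = [set 0] by apply: (dim0_max hN hm hF); rewrite -d0.
  have [u hu] : exists u, u * c = 1 by apply: (local_unit hN hm); rewrite m0.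
  exists 0%N => e; exists 'I_0; rewrite card_ord; split=> //.
  exists (fun=> 0) => x; exists (fun=> 0), (u * x), 0; split.
    by rewrite /comb big_ord0 add0r addr0 mulrA [c * u]mulrC hu mul1r.
  exact: ideal0 (ideal_bracket_ideal _ _).
have [t mt nt] := max_nonzero hN hm hd d0.
have nct : c * t <> 0 by exact: (domain_mul hN hm hF).
have mct : m (c * t) by exact: idealM (local_ideal hm) _.
have hct y : y \in [:: c * t] -> m y by rewrite inE => /eqP->.
have rct : regseq J [:: c * t].
  by split=> // z _ /= h; apply: (domain_cancel hN hm hF nct); rewrite h mulr0.
have [|l [rl sl ml]] := regseq_extend hN hm hJ hct zm rct zr; first by rewrite zd.
have rT := regseq_setT hN hm hF hJ Jnz ml rl.
have [N hN'] := regular_primary hN hm hd rT (etrans sl zd) (seqm_ideal _ hT) (fun _ h => h).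
have [L hL] := @span_mod_regular R m p charRp hN hm l [:: c * t] N n g hg hN'.
have sd : d = (size l).+1 by rewrite -zd -sl size_cat addn1.
exists L => e; have [T [cT [h hh]]] := hL e; exists T; split.
  rewrite cT sd expnMn -!expnM [((size l).+1 * e)%N]mulnC mulnS expnD.
  by apply: eq_leq; ring.
exists h => x; have [s hs] := hh x; exists s.
have [|u|y [w [E hw]]] := @seqm_map_bracket e [:: c * t] l c _ _ _ hs.
- by move=> y yl; apply: ml; rewrite mem_cat yl.
- by rewrite inE => /eqP->; exists t; rewrite mulrC.
by exists y, w; rewrite -E subrKC.
Qed.

End Signature.

(** * Convergence of almost non-increasing sequences *)

Section Limit.
Variable Re : realType.

Lemma cvg_almost_nonincreasing (x : nat -> Re) (K : Re) (p : nat) : (1 < p)%N -> 0 <= K ->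
  (forall e, 0 <= x e) -> (forall e, x e.+1 <= x e + K * p%:R^-1 ^+ e) ->
  exists s : Re, x @ \oo --> s.
Proof.
move=> p1 K0 x0 hx; set q : Re := p%:R^-1.
have pR : 2 <= p%:R :> Re by rewrite ler_nat.
have q0 : 0 < q by rewrite invr_gt0; apply: lt_le_trans pR.
have q2 : 2 * q <= 1 by rewrite /q ler_pdivrMr ?mul1r //; apply: lt_le_trans pR.
(* The added term drops by 2 K q^e (1 - q), which is at least K q^e as q <= 1/2; so the constant 2
   serves every p. *)
pose y e := x e + geometric (2 * K) q e.
have gE e : geometric (2 * K) q e = 2 * K * q ^+ e by [].
have ydecr : nonincreasing_seq y.
  apply/nonincreasing_seqP => e; rewrite /y !gE exprS.
  have h1 := hx e; have qe : 0 <= q ^+ e by rewrite exprn_ge0 // ltW.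
  have h2 : (1 - 2 * q) * (K * q ^+ e) >= 0.
    by apply: mulr_ge0; [rewrite subr_ge0|exact: mulr_ge0].
  rewrite -/q in h1; apply: le_trans (_ : x e + K * q ^+ e + 2 * K * (q * q ^+ e) <= _).
    by rewrite lerD2r.
  by rewrite -subr_ge0; apply: le_trans h2 _; rewrite le_eqVlt; apply/orP; left; apply/eqP; ring.
have ycvg : cvgn y.
  apply: nonincreasing_is_cvgn => //; exists 0 => _ [e _ <-].
  by rewrite /y gE addr_ge0 // !mulr_ge0 // exprn_ge0 // ltW.
have gcvg : geometric (2 * K) q @ \oo --> (0 : Re).
  by apply: cvg_geometric; rewrite ger0_norm ?ltW //; lra.
exists (limn y - 0); have -> : x = (fun e => y e - geometric (2 * K) q e).
  by apply/funext => e; rewrite /y addrK.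
exact: cvgB.
Qed.

Lemma powR_log (p d n : nat) e : (1 < p)%N -> (0 < n)%N ->
  (p ^ e)%:R `^ (d%:R + ln n%:R / ln p%:R) = ((p ^ d * n) ^ e)%:R :> Re.
Proof.
move=> p1 n0.
have p0 : (0 : Re) < p%:R by rewrite ltr0n ltnW.
have lnp : ln (p%:R : Re) != 0 by rewrite gt_eqF // ln_gt0 // ltr1n.
rewrite !natrX natrM natrX -powR_mulrn ?ler0n // powRAC powR_mulrn ?powR_ge0 //.
congr (_ ^+ e); rewrite powRD; last by apply/implyP => _; rewrite gt_eqF.
rewrite powR_mulrn ?ler0n //; congr (_ * _).
by rewrite /powR gt_eqF // divfK // lnK // posrE ltr0n.
Qed.

End Limit.

(** * Existence of the F-signature *)

Section FSignature.
Variables (R : comNzRingType) (m : set R) (k : fieldType) (res : {rmorphism R -> k}).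
Variables (p : nat) (charRp : p \in [pchar R]) (Re : realType).
Hypotheses (hN : noetherian R) (hm : is_local m).
Hypotheses (hres_surj : forall c, exists x, res x = c) (hres_ker : forall x, m x <-> res x = 0).
Hypotheses (hFfin : F_finite charRp) (hF : strongly_F_regular charRp).
Hypothesis hQG : Q_Gorenstein_punctured m res.

Lemma frob_degree_gt0 n : frob_degree k p n -> (0 < n)%N.
Proof.
case: n => // -[b hb]; have [c [+ _]] := hb 1.
by rewrite big_ord0 => /eqP; rewrite oner_eq0.
Qed.

(** The recursion is multiplied by p^e so as to stay within the natural numbers. *)
Lemma free_rank_growth : exists d n (a : nat -> nat) C,
  [/\ has_krull_dim R d, frob_degree k p n, forall e, free_rank_root charRp e (a e)
    & forall e, (a e.+1 * p ^ e <= p ^ d * n * a e * p ^ e + C * (p ^ d * n) ^ e)%N].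
Proof.
have [J [d [zs [[hJ Jnz _ hd] _ [zm zr zd] _]]]] :=
  canonical_data hN hm hres_surj hres_ker hF hQG.
have [n [hn [g hg]]] := exists_frob_degree hres_surj hres_ker hFfin.
have zT := regseq_setT hN hm hF hJ Jnz zm zr.
have [L hL] := residue_bound charRp hN hm hd hg zm zT zd.
have [D [f [N [t [c [hf ht nc hc]]]]]] := generic_frob_basis hN hm hFfin hF.
have [L' hL'] := torsion_bound hN hm hF hd hg hJ Jnz zm zr zd nc.
have gen e : exists (T : finType) (h : T -> R), forall x, exists b, x = comb p e h b.
  have [|T [_ [h hh]]] := @iterated_span R p charRp [set 0] N t (ideal_set0 R) _ e.
    by move=> x; have [b ->] := ht x; exists b; rewrite subrr.
  exists T, h => x; have [b hb] := hh x; exists b.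
  by apply/eqP; rewrite -subr_eq0; apply/eqP.
(* The D^e independent elements cannot outnumber generators of R^(1/p^e), and by Nakayama's lemma
   generators modulo m suffice. *)
have DQ : (D <= p ^ d * n)%N.
  apply: (@pow_growth L) => e; have [S [<- [h hh]]] := frob_indep_iter charRp hf e.
  have [T [cT [h' hh']]] := hL e; apply: leq_trans cT.
  apply: (frob_indep_card charRp (F_regular_domain hN hm hF) hh) => x.
  have [T' [t' ht']] := gen e.
  apply: (@frob_nakayama R m p charRp hN hm e #|T'| (t' \o enum_val)) => // y.
  have [b hb] := ht' y; exists (fun=> 0), (b \o enum_val).
  rewrite (comb0 charRp) add0r {1}hb /comb (reindex (@enum_val T' T')) //.
  by apply: onW_bij; exact: enum_val_bij.
have hfree e : exists a, free_rank_root charRp e a.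
  have [T [h hh]] := gen e; exact: (exists_free_rank charRp hN hm hres_ker hh).
have [a ha] := choice hfree.
exists d, n, a, (N * L')%N; split=> // e.
have [T [cT [h hh]]] := hL' e.
have := free_rank_step hN hm hres_ker ht hc hh (ha e) (ha e.+1).
move=> /(leq_mul (leqnn (p ^ e))); rewrite mulnC => /leq_trans; apply.
rewrite mulnC mulnDl; apply: leq_add.
  by rewrite !leq_mul2r DQ !orbT.
by rewrite -!mulnA leq_mul2l cT orbT.
Qed.

Lemma F_signature_exists : exists s : Re, is_F_signature charRp k s.
Proof.
have [d [n [a [C [hd hn ha hgr]]]]] := free_rank_growth.
have p1 := pchar_prime_gt1 charRp; have n0 := frob_degree_gt0 hn.
have [Q [QE Q0]] : exists Q, Q = (p ^ d * n)%N /\ (0 < Q)%N.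
  by exists (p ^ d * n)%N; rewrite muln_gt0 (pexp_gt0 charRp).
have QR : (0 : Re) < Q%:R by rewrite ltr0n.
have pR : (0 : Re) < p%:R by rewrite ltr0n ltnW.
rewrite -QE in hgr.
(* Dividing the recursion by Q^(e+1) p^e leaves the error (C/Q) p^(-e). *)
have [||e|s hs] := @cvg_almost_nonincreasing Re (fun e => (a e)%:R / (Q ^ e)%:R) (C%:R / Q%:R) p p1.
- by rewrite divr_ge0.
- by move=> e; rewrite divr_ge0.
- have h : (a e.+1)%:R * p%:R ^+ e <=
      Q%:R * (a e)%:R * p%:R ^+ e + C%:R * Q%:R ^+ e :> Re.
    by rewrite -!natrX -!natrM -natrD ler_nat; exact: hgr.
  rewrite !natrX ler_pdivrMr ?exprn_gt0 // -(@ler_pM2r _ (p%:R ^+ e)) ?exprn_gt0 //.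
  apply: le_trans h _; rewrite le_eqVlt; apply/orP; left; apply/eqP.
  rewrite exprS exprVn; field.
  by rewrite !expf_neq0 ?gt_eqF.
exists s, d, n, a; split=> //.
rewrite (_ : (fun e => _) = (fun e => (a e)%:R / (Q ^ e)%:R)) //.
by apply/funext => e; rewrite powR_log // QE.
Qed.

End FSignature.

Theorem theorem3p1 (R : comNzRingType) (m : set R)
  (k : fieldType) (res : {rmorphism R -> k})
  (p : nat) (charRp : p \in [pchar R]%R) (Re : realType)
  (hnoeth : noetherian R) (hlocal : is_local m)
  (hres_surj : forall y, exists x, res x = y)
  (hres_ker : forall x, m x <-> res x = 0%R)
  (hFfin : F_finite charRp)
  (hFreg : strongly_F_regular charRp)
  (hQGor : Q_Gorenstein_punctured m res) :
  condition_A p m /\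
  exists s : Re, is_F_signature charRp k s.
Proof.
split; first exact: (condition_A_holds hnoeth hlocal hres_surj hres_ker hFreg hQGor).
exact: (F_signature_exists Re hnoeth hlocal hres_surj hres_ker hFfin hFreg hQGor).
Qed.
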